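(* Let $\Gamma$ be a torsion-free closed surface group of genus at least two, realized as a discrete subgroup of $\mathsf{PSL}(2,\mathbb R)$ (so $\Lambda(\Gamma)=S^1$), let $n\ge1$, and let $\rho_1,\dots,\rho_n:\Gamma\to\mathsf{SL}(2,\mathbb R)$ be pairwise nonconjugate Fuchsian (discrete faithful) representations, $\rho_i(\gamma)=\begin{pmatrix}a_i(\gamma)&b_i(\gamma)\\c_i(\gamma)&d_i(\gamma)\end{pmatrix}$. Let $\rho:\Gamma\to\mathsf{Sp}(2n,\mathbb R)$ be $$\rho(\gamma)=\begin{pmatrix}\mathrm{diag}(a_i(\gamma))&\mathrm{diag}(b_i(\gamma))\\ \mathrm{diag}(c_i(\gamma))&\mathrm{diag}(d_i(\gamma))\end{pmatrix}.$$ Let $\alpha$ be the long simple root of $\mathfrak{sp}(2n,\mathbb R)$, $\xi^\alpha:\Lambda(\Gamma)\to\mathcal F_\alpha$ the positive limit map of $\rho$ (which is maximal, hence $\{\alpha\}$-positive), and $m_\alpha$ the arc-length (1-dimensional Hausdorff) measure on the rectifiable curve $\xi^\alpha(\Lambda(\Gamma))$ with respect to a Riemannian metric on $\mathcal F_\alpha$. Then $m_\alpha$ has exactly $n$ ergodic components under the action of $\rho(\Gamma)$.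
   Context: $\mathcal F_\alpha$ is the flag manifold of $\mathsf{Sp}(2n,\mathbb R)$ associated to the long simple root $\alpha$ (the Lagrangian Grassmannian), where $\alpha(\mathrm{diag}(\lambda_1,\dots,\lambda_n,-\lambda_1,\dots,-\lambda_n))=2\lambda_n$. The limit map $\xi^\alpha$ is the continuous $\rho$-equivariant map $\Lambda(\Gamma)\to\mathcal F_\alpha$ sending cyclically ordered tuples to positive (maximal) tuples.
   Formalization: ''Nonconjugate'' is taken in PGL(2,R) up to sign: for ρ₂=χρ₁ with χ a nontrivial ±1 character the claim fails (one component, not two). The Riemannian metric is the one induced by orthogonal projection matrices; others give the same null sets. *)

(* Defs.v *)
From HB Require Import structures.
From mathcomp Require Import all_boot all_order all_algebra.
From mathcomp Require Import boolp classical_sets reals ereal sequences.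
Set Implicit Arguments. Unset Strict Implicit. Unset Printing Implicit Defensive.
Import Order.TTheory GRing.Theory Num.Theory.
Local Open Scope classical_set_scope.
Local Open Scope ring_scope.

Section Defs.
Variable R : realType.

Definition fdist (m k : nat) (A B : 'M[R]_(m, k)) : R :=
  Num.sqrt (\sum_(i < m) \sum_(j < k) (A i j - B i j) ^+ 2).

(* An element of PSL(2,R) is represented by a matrix of SL(2,R) (up to sign). *)

(* Moebius action of a 2x2 matrix on z = x + i y in the upper half plane *)
Definition mob_den (g : 'M[R]_2) (x y : R) := (g 1 0 * x + g 1 1) ^+ 2 + (g 1 0 * y) ^+ 2.
Definition mob_re (g : 'M[R]_2) (x y : R) :=
  ((g 0 0 * x + g 0 1) * (g 1 0 * x + g 1 1) + g 0 0 * g 1 0 * y ^+ 2) / mob_den g x y.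
Definition mob_im (g : 'M[R]_2) (x y : R) := y * \det g / mob_den g x y.
(* cosh of the hyperbolic distance between x + i y (y > 0) and i *)
Definition cosh_dist_i (x y : R) := 1 + (x ^+ 2 + (y - 1) ^+ 2) / (2 * y).

(* iota : G -> SL(2,R) induces an injective homomorphism G -> PSL(2,R) whose image
   is discrete, torsion free (as G is) and cocompact: a closed surface group. *)
Definition closed_surface_group_in_PSL2 (G : groupType) (iota : G -> 'M[R]_2) :=
  [/\ (forall g, \det (iota g) = 1),
      (forall g h, iota (g * h)%g = iota g *m iota h \/ iota (g * h)%g = - (iota g *m iota h)),
      (forall g, iota g = 1%:M \/ iota g = - 1%:M -> g = 1%g),
      (exists2 e : R, 0 < e & forall g, g != 1%g ->
          e <= fdist (iota g) 1%:M /\ e <= fdist (iota g) (- 1%:M)) &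
      (forall (g : G) (k : nat), g != 1%g -> (0 < k)%N -> (g ^+ k)%g != 1%g) /\
      (exists C : R, forall x y : R, 0 < y -> exists g,
          cosh_dist_i (mob_re (iota g) x y) (mob_im (iota g) x y) <= C)].

Definition fuchsian_SL2 (G : groupType) (r : G -> 'M[R]_2) :=
  [/\ (forall g, \det (r g) = 1),
      (forall g h, r (g * h)%g = r g *m r h),
      injective r &
      (exists2 e : R, 0 < e & forall g, g != 1%g -> e <= fdist (r g) 1%:M)].

Definition pgl_conjugate (G : groupType) (r1 r2 : G -> 'M[R]_2) :=
  exists2 P : 'M[R]_2, P \in unitmx & forall g,
    r2 g = P *m r1 g *m invmx P \/ r2 g = - (P *m r1 g *m invmx P).

Definition rho_mx (G : groupType) (n : nat) (rhos : 'I_n -> G -> 'M[R]_2) (g : G)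
  : 'M[R]_(n + n) :=
  block_mx (diag_mx (\row_i rhos i g 0 0)) (diag_mx (\row_i rhos i g 0 1))
           (diag_mx (\row_i rhos i g 1 0)) (diag_mx (\row_i rhos i g 1 1)).

Definition Jmx (n : nat) : 'M[R]_(n + n) := block_mx 0 1%:M (- 1%:M) 0.
Definition omega (n : nat) (x y : 'cV[R]_(n + n)) : R := (x^T *m Jmx n *m y) 0 0.

(* A Lagrangian subspace L is represented by the orthogonal projection P onto L;
   this embeds F_alpha as a compact submanifold of the matrices. *)
Definition is_lag (n : nat) (P : 'M[R]_(n + n)) :=
  [/\ P^T = P, P *m P = P, \rank P = n & P *m Jmx n *m P = 0].
Definition in_lag (n : nat) (P : 'M[R]_(n + n)) (x : 'cV[R]_(n + n)) := P *m x = x.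
Definition lag_act (n : nat) (g : 'M[R]_(n + n)) (P Q : 'M[R]_(n + n)) :=
  forall x, in_lag Q x <-> exists2 y, in_lag P y & x = g *m y.
Definition transverse (n : nat) (P Q : 'M[R]_(n + n)) :=
  forall x, in_lag P x -> in_lag Q x -> x = 0.
(* positive (maximal) triple: L2 is the graph of T : L1 -> L3 and x |-> omega(x, T x)
   is negative definite (sign convention matched with the orientation below, so that
   for n = 1 positive triples are the cyclically ordered triples of RP^1). *)
Definition lag_pos (n : nat) (P1 P2 P3 : 'M[R]_(n + n)) :=
  [/\ is_lag P1, is_lag P2, is_lag P3,
      [/\ transverse P1 P2, transverse P2 P3 & transverse P1 P3] &
      forall x y, in_lag P1 x -> in_lag P3 y -> x != 0 -> in_lag P2 (x + y) ->
        omega x y < 0].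

(* A point of RP^1 = boundary of the upper half plane is a nonzero vector of R^2
   up to scaling (x in R <-> [x;1], infinity <-> [1;0]); gamma acts linearly. *)
Definition det2 (u v : 'cV[R]_2) := u 0 0 * v 1 0 - u 1 0 * v 0 0.
Definition cyc_pos (u v w : 'cV[R]_2) := 0 < det2 u v * det2 v w * det2 w u.

Definition positive_limit_map (G : groupType) (n : nat) (iota : G -> 'M[R]_2)
    (rho : G -> 'M[R]_(n + n)) (xi : 'cV[R]_2 -> 'M[R]_(n + n)) :=
  [/\ (forall v, v != 0 -> is_lag (xi v)),
      (forall v (t : R), v != 0 -> t != 0 -> xi (t *: v) = xi v),
      (forall v, v != 0 -> forall e : R, 0 < e -> exists2 d : R, 0 < d &
          forall w, w != 0 -> fdist v w < d -> fdist (xi v) (xi w) < e),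
      (forall g v, v != 0 -> lag_act (rho g) (xi v) (xi (iota g *m v))) &
      (forall u v w, u != 0 -> v != 0 -> w != 0 -> cyc_pos u v w ->
          lag_pos (xi u) (xi v) (xi w))].

Definition limit_curve (n : nat) (xi : 'cV[R]_2 -> 'M[R]_(n + n)) : set 'M[R]_(n + n) :=
  [set xi v | v in [set v : 'cV[R]_2 | v != 0]].

Definition diam (m k : nat) (A : set 'M[R]_(m, k)) : \bar R :=
  ereal_sup ([set 0%E] `|` [set (fdist x y)%:E | x in A & y in A]).
Definition hcontent (m k : nat) (d : R) (A : set 'M[R]_(m, k)) : \bar R :=
  ereal_inf [set (\sum_(i <oo) diam (U i))%E | U in
     [set U : nat -> set 'M[R]_(m, k) |
        A `<=` \bigcup_i U i /\ forall i, (diam (U i) <= d%:E)%E]].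
Definition hausdorff1 (m k : nat) (A : set 'M[R]_(m, k)) : \bar R :=
  ereal_sup [set hcontent d A | d in [set d : R | 0 < d]].

Definition fopen (m k : nat) (U : set 'M[R]_(m, k)) :=
  forall x, U x -> exists2 e : R, 0 < e & forall y, fdist x y < e -> U y.
Definition sigma_closed (T : Type) (S : set (set T)) :=
  [/\ S set0, (forall A, S A -> S (~` A)) &
      (forall F : nat -> set T, (forall i, S (F i)) -> S (\bigcup_i F i))].
Definition borel (m k : nat) (A : set 'M[R]_(m, k)) :=
  forall S, sigma_closed S -> (forall U, fopen U -> S U) -> S A.

Definition rho_invariant (G : groupType) (n : nat) (rho : G -> 'M[R]_(n + n))
    (A : set 'M[R]_(n + n)) :=
  forall g P Q, is_lag P -> is_lag Q -> lag_act (rho g) P Q -> (A P <-> A Q).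

Definition n_ergodic_components (G : groupType) (n : nat) (rho : G -> 'M[R]_(n + n))
    (mu : set 'M[R]_(n + n) -> \bar R) (k : nat) :=
  exists E : 'I_k -> set 'M[R]_(n + n),
    [/\ (forall i, borel (E i) /\ rho_invariant rho (E i)),
        (forall i, (0 < mu (E i))%E),
        (forall i j, i != j -> E i `&` E j = set0),
        mu (~` \bigcup_(i in [set: 'I_k]) E i) = 0%E &
        (forall i A, borel A -> rho_invariant rho A -> A `<=` E i ->
            mu A = 0%E \/ mu (E i `\` A) = 0%E)].

End Defs.

(* Main.v *)
Require Import Defs.
From HB Require Import structures.
From mathcomp Require Import all_boot all_order all_algebra.
From mathcomp Require Import all_classical all_reals all_analysis.
From mathcomp Require Import measurable_realfun ring lra.
Set Implicit Arguments. Unset Strict Implicit. Unset Printing Implicit Defensive.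
Import Order.TTheory GRing.Theory Num.Theory.
Import numFieldNormedType.Exports.
Local Open Scope classical_set_scope.
Local Open Scope ring_scope.

(** The limit map splits: carrying a point of the circle to a fixed compact set along a geodesic
    ray, the pinching of positive triples shows that the vectors of the Lagrangian at that point
    are contracted, while the symplectic forms of the n coordinate planes are preserved; these
    forms therefore vanish on the Lagrangian, which is a direct sum of lines.  The i-th line gives
    a homeomorphism phi_i of the circle that conjugates Gamma to rho_i, and in charts the curve
    is bi-Lipschitz to the graph of (phi_1, ..., phi_n).  A subset of the curve is thus
    H^1-null iff its images under all the phi_i are Lebesgue null.

    Blowing up at a point of the circle makes the action locally affine.  At a density point this
    shows that each rho_i is ergodic for the Lebesgue measure; at a point of differentiability
    it shows that phi_j o phi_i^-1 is a Moebius map as soon as it has a nonzero derivative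
    somewhere.  As rho_i and rho_j are not conjugate, the two Lebesgue measure classes are mutually
    singular, and saturating the singular sets under the countable group Gamma cuts the curve into n
    invariant pieces, on the i-th of which only the i-th class lives. *)

(** * Null sets *)

Section Lebesgue.
Context {R : realType}.
Local Notation mu := (@lebesgue_measure R).

(** Only the equivariance, continuity and positivity of [xi] are given; nothing says in advance that
    its values split, so the splitting has to be extracted from positivity. Cocompactness enters in
    one form: every point of the circle is conical. The expanding sequences are taken along an
    ultrafilter, so that all matrix entries converge together. Points of RP^1 are nonzero vectors
    and equality of points is [det2 = 0]; a rotation of each coordinate plane sends infinity to
    infinity, which makes each circle map an increasing bijection of R. [lebesgue_measure] is an
    outer measure defined on all sets, so null sets pass through Lipschitz and Moebius maps without
    measurability conditions. All the coordinates increase along the curve, so in the parameter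
    given by their sum the curve is Lipschitz; hence a part of it is null as soon as all its
    coordinate images are. Mutual singularity comes from a dichotomy: a failure of absolute
    continuity in one direction gives a set that is null for i and not null for j, and ergodicity
    for j then makes its saturation conull. *)

Lemma lebesgue_sigma_subadditive (A : (set R)^nat) :
  (mu (\bigcup_n A n) <= \sum_(i <oo) mu (A i))%E.
Proof. exact: mu_ext_sigma_subadditive. Qed.

Lemma le_lebesgue (A B : set R) : A `<=` B -> (mu A <= mu B)%E.
Proof. exact: (@le_mu_ext _ _ _ (wlength idfun)). Qed.

Lemma lebesgue_ge0 (A : set R) : (0 <= mu A)%E.
Proof. exact: mu_ext_ge0. Qed.

(** The factor 2 arises because the image of each covering interval is enclosed in an interval
    centred at the image of an arbitrary point of [E] in it. *)
Lemma lebesgue_lipschitz (f : R -> R) (E : set R) (L : R) : 0 < L ->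
  (forall p q, E p -> E q -> `|f p - f q| <= L * `|p - q|) ->
  (mu (f @` E) <= (2 * L)%:E * mu E)%E.
Proof.
move=> L0 fL.
have L20 : 0 < 2 * L by rewrite mulr_gt0.
rewrite -lee_pdivrMl//; apply: le_ereal_inf_tmp => _ [A [mA EA] <-].
rewrite lee_pdivrMl//.
have fE : f @` E `<=` \bigcup_k f @` (E `&` A k).
  by move=> _ [p Ep <-]; have [k _ Akp] := EA _ Ep; exists k => //; exists p.
apply: le_trans (le_lebesgue fE) _; apply: le_trans (lebesgue_sigma_subadditive _) _.
rewrite -nneseriesZl => [|*]; last exact: wlength_ge0.
apply: lee_nneseries => [k _ _|k _]; first exact: lebesgue_ge0.
have [->|] := eqVneq (E `&` A k) set0; last move/set0P => [q [Eq Aq]].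
  rewrite image_set0 measure0 mule_ge0// lee_fin; exact: ltW.
have [[a b] _ /= Akab] := mA k.
move: Aq; rewrite -Akab /= in_itv/= => /andP[aq qb].
rewrite wlength_itv/= lte_fin (lt_le_trans aq qb).
apply: (@le_trans _ _ (mu `[f q - L * (b - a), f q + L * (b - a)]%classic)).
  apply: le_lebesgue => z [p [Ep Ap] <-]; move: Ap; rewrite /= !in_itv/= => /andP[ap pb].
  rewrite -ler_distl; apply: le_trans (fL _ _ Ep Eq) _.
  by rewrite ler_wpM2l ?(ltW L0)// ler_distl; apply/andP; split; lra.
rewrite lebesgue_measure_itv/= lte_fin.
case: ifP => _; rewrite -!EFinD -!EFinM lee_fin; first lra.
by rewrite mulr_ge0 ?(ltW L20)// subr_ge0 ltW// (lt_le_trans aq qb).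
Qed.

Lemma lebesgue_bigcup0 (A : (set R)^nat) :
  (forall n, mu (A n) = 0) -> mu (\bigcup_n A n) = 0.
Proof.
move=> A0; apply/eqP; rewrite eq_le lebesgue_ge0 andbT.
by apply: le_trans (lebesgue_sigma_subadditive _) _; rewrite eseries0.
Qed.

Lemma lebesgue_setU0 (A B : set R) : mu A = 0 -> mu B = 0 -> mu (A `|` B) = 0.
Proof.
move=> A0 B0; rewrite -bigcup2E; apply: (@lebesgue_bigcup0 (bigcup2 A B)).
by move=> -[|[|n]]/=; rewrite ?measure0.
Qed.

Lemma lebesgue_null_sub (A B : set R) : A `<=` B -> mu B = 0 -> mu A = 0.
Proof.
by move=> AB B0; apply/eqP; rewrite eq_le lebesgue_ge0 andbT -B0 le_lebesgue.
Qed.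

(** This is the preimage of [N] under a Moebius map, written without fractions. The inverse map is
    Lipschitz only away from its pole, so [N] is cut according to the size of [a - c * z]. *)
Lemma lebesgue_mobius_null (a b c d : R) (N : set R) : a * d - b * c != 0 ->
  mu N = 0 ->
  mu [set s | exists2 z, N z & c * s + d != 0 /\ a * s + b = z * (c * s + d)] = 0.
Proof.
move=> D0 N0.
pose Nk (k : nat) := [set z | N z /\ k.+1%:R^-1 <= `|a - c * z|].
pose f z := (d * z - b) / (a - c * z).
apply: (@lebesgue_null_sub _ (\bigcup_k f @` (Nk k))) => [s [z Nz [den ez]]|].
  have zs : (a - c * z) * (c * s + d) = a * d - b * c.
    transitivity (a * (c * s + d) - c * (a * s + b)); [rewrite ez|]; ring.
  have az : a - c * z != 0.
    by apply: contraNneq D0 => az; rewrite -zs az mul0r.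
  exists (Num.truncn (`|a - c * z|^-1)) => //; exists z; last first.
    rewrite /f; apply: (mulIf az); rewrite divfK//.
    have -> : s * (a - c * z) = a * s + b - z * (c * s) - b by ring.
    by rewrite ez; ring.
  split => //; rewrite -[leRHS]invrK lef_pV2 ?posrE ?invr_gt0 ?normr_gt0//.
  by rewrite ltW// truncnS_gt.
apply: lebesgue_bigcup0 => k; apply/eqP; rewrite eq_le lebesgue_ge0 andbT.
(* [f p - f q] is the determinant times [p - q] over two denominators, each at least [k.+1%:R^-1] in
   absolute value on [Nk k]. *)
pose L := `|a * d - b * c| * (k.+1%:R * k.+1%:R).
have L0 : 0 < L by rewrite mulr_gt0// normr_gt0.
have NkN : mu (Nk k) = 0 by apply: lebesgue_null_sub N0 => z [].
rewrite (le_trans (@lebesgue_lipschitz f (Nk k) L L0 _))// ?NkN ?mule0//.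
move=> p q [_ kp] [_ kq].
have k0 : (0 < k.+1%:R^-1 :> R) by rewrite invr_gt0.
have p0 : a - c * p != 0 by rewrite -normr_gt0 (lt_le_trans k0).
have q0 : a - c * q != 0 by rewrite -normr_gt0 (lt_le_trans k0).
have -> : f p - f q = (a * d - b * c) * (p - q) * ((a - c * p)^-1 * (a - c * q)^-1).
  by rewrite /f; field; rewrite ?q0 ?p0.
rewrite !normrM /L mulrAC ler_wpM2r// ler_wpM2l// !normfV.
by rewrite ler_pM ?invr_ge0// -[leRHS]invrK lef_pV2// posrE ?normr_gt0.
Qed.

End Lebesgue.

(** * Directions of the plane *)

Section Directions.
Context {R : realType}.
Implicit Types (u v w : 'cV[R]_2) (U : set_system nat).

Definition v2 (a b : R) : 'cV[R]_2 := \col_i (if i == 0 then a else b).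

Lemma v2E0 a b : v2 a b 0 0 = a. Proof. by rewrite mxE. Qed.
Lemma v2E1 a b : v2 a b 1 0 = b. Proof. by rewrite mxE. Qed.

Lemma v2P u : u = v2 (u 0 0) (u 1 0).
Proof.
apply/colP => i; rewrite !mxE; case: i => [[|[|//]] ?] /=;
  by congr (u _ _); apply/val_inj.
Qed.

Lemma mulmx_v2 (M : 'M[R]_2) u :
  M *m u = v2 (M 0 0 * u 0 0 + M 0 1 * u 1 0) (M 1 0 * u 0 0 + M 1 1 * u 1 0).
Proof.
rewrite [LHS]v2P; congr v2; rewrite !mxE !big_ord_recl big_ord0 addr0;
  by rewrite (_ : lift _ _ = 1)//; apply/val_inj.
Qed.

Lemma scale_v2 c a b : c *: v2 a b = v2 (c * a) (c * b).
Proof. by rewrite [LHS]v2P !mxE. Qed.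

Lemma v2_inj a b c d : v2 a b = v2 c d -> a = c /\ b = d.
Proof. by move=> e; split; [rewrite -(v2E0 a b) e v2E0|rewrite -(v2E1 a b) e v2E1]. Qed.

Lemma v2_eq0 a b : (v2 a b == 0) = (a == 0) && (b == 0).
Proof.
have -> : 0 = v2 0 0 by rewrite [LHS]v2P !mxE.
by apply/eqP/andP => [/v2_inj[-> ->]//|[/eqP-> /eqP->]].
Qed.

Lemma v2x1_neq0 a : v2 a 1 != 0.
Proof. by rewrite v2_eq0 oner_eq0 andbF. Qed.

Lemma det2_v2 a b c d : det2 (v2 a b) (v2 c d) = a * d - b * c.
Proof. by rewrite /det2 !mxE. Qed.

Lemma det22 (M : 'M[R]_2) : \det M = M 0 0 * M 1 1 - M 0 1 * M 1 0.
Proof.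
have E : lift 0 (0 : 'I_1) = 1 :> 'I_2 by apply/val_inj.
rewrite (expand_det_row _ 0) !big_ord_recl big_ord0 addr0 !E /cofactor !det_mx11 !mxE /=.
have -> : lift 1 (0 : 'I_1) = 0 :> 'I_2 by apply/val_inj.
by rewrite !E /= expr0 expr1; ring.
Qed.

Lemma det2_mulmx (M : 'M[R]_2) u v : det2 (M *m u) (M *m v) = \det M * det2 u v.
Proof. rewrite !mulmx_v2 det2_v2 det22 /det2; ring. Qed.

Lemma det2C u v : det2 u v = - det2 v u.
Proof. rewrite /det2; ring. Qed.

Lemma det2_par u v : u != 0 -> det2 u v = 0 -> exists c, v = c *: u.
Proof.
rewrite (v2P u) (v2P v) det2_v2 v2_eq0.
set a := u 0 0; set b := u 1 0; set c := v 0 0; set d := v 1 0 => ab0 e.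
have [a0|a0] := eqVneq a 0.
  move: ab0; rewrite a0 eqxx /= => b0.
  have c0 : c = 0 by apply: (mulfI b0); rewrite mulr0; move: e; rewrite a0; lra.
  by exists (d / b); rewrite scale_v2 c0 mulr0 divfK.
exists (c / a); rewrite scale_v2 divfK//; congr v2.
by apply: (mulfI a0); transitivity (c * b); [lra|field].
Qed.

(** Parallelism is transitive only through a nonzero vector, whence the nonvanishing side conditions
    that recur below. *)
Lemma det2_trans u v w : v != 0 -> det2 u v = 0 -> det2 v w = 0 -> det2 u w = 0.
Proof.
move=> v0 uv /(det2_par v0)[c ->]; move: uv; rewrite /det2 !mxE => uv.
by transitivity (c * (u 0 0 * v 1 0 - u 1 0 * v 0 0)); [ring|rewrite uv mulr0].
Qed.

Lemma mulmx_neq0 (M : 'M[R]_2) u : \det M != 0 -> u != 0 -> M *m u != 0.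
Proof.
move=> M0; apply: contraNneq => Mu.
have uM : M \in unitmx by rewrite unitmxE unitfE.
by rewrite -(mulKmx uM u) Mu mulmx0.
Qed.

(** Convergence in RP^1: representatives are defined up to scaling, so factors [c k], eventually
    nonzero, may renormalise them. *)
Definition dirto U (w : nat -> 'cV[R]_2) (l : 'cV[R]_2) :=
  exists2 c : nat -> R, (\forall k \near U, c k != 0) &
    (c k * w k 0 0 @[k --> U] --> l 0 0) /\ (c k * w k 1 0 @[k --> U] --> l 1 0).

Lemma dirto_par U (FU : Filter U) (u w : nat -> 'cV[R]_2) (l : 'cV[R]_2) : (forall k, u k != 0) -> (forall k, w k != 0) ->
  (forall k, det2 (u k) (w k) = 0) -> dirto U u l -> dirto U w l.
Proof.
move=> u0 w0 uw [c c0 [cu0 cu1]].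
have /choice[d dE] k : exists d, d != 0 /\ u k = d *: w k.
  have [|d ud] := det2_par (w0 k) (v := u k); first by rewrite det2C uw oppr0.
  by exists d; split=> //; apply: contraNneq (u0 k) => d0; rewrite ud d0 scale0r.
exists (fun k => c k * d k).
  by apply: (filterS _ c0) => k ck; rewrite mulf_neq0//; case: (dE k).
have E i k : c k * d k * w k i 0 = c k * u k i 0.
  by have [_ ->] := dE k; rewrite mxE mulrA.
by split; under eq_cvg do rewrite E.
Qed.

Lemma dirto_mulmx U (FU : Filter U) (M : 'M[R]_2) (w : nat -> 'cV[R]_2) (l : 'cV[R]_2) :
  dirto U w l -> dirto U (fun k => M *m w k) (M *m l).
Proof.
move=> [c c0 [c0w c1w]]; exists c => //; split.
  under eq_cvg do rewrite mulmx_v2 v2E0 mulrDr !(mulrCA (c _)).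
  by rewrite mulmx_v2 v2E0; apply: cvgD; apply: cvgM => //; exact: cvg_cst.
under eq_cvg do rewrite mulmx_v2 v2E1 mulrDr !(mulrCA (c _)).
by rewrite mulmx_v2 v2E1; apply: cvgD; apply: cvgM => //; exact: cvg_cst.
Qed.

Lemma cvg_neq0 (T : Type) (F : set_system T) (FF : Filter F) (f : T -> R) (l : R) : l != 0 ->
  f k @[k --> F] --> l -> \forall k \near F, f k != 0.
Proof.
move=> l0 /cvgrPdist_lt /(_ `|l|); rewrite normr_gt0 => /(_ l0).
apply: filterS => k; apply: contraTneq => ->.
by rewrite subr0 ltxx.
Qed.

Lemma dirto_ratio0 U (FU : Filter U) (w : nat -> 'cV[R]_2) (l : 'cV[R]_2) : l 0 0 != 0 -> dirto U w l ->
  (\forall k \near U, w k 0 0 != 0) /\ w k 1 0 / w k 0 0 @[k --> U] --> l 1 0 / l 0 0.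
Proof.
move=> l0 [c c0 [c0w c1w]].
have n0 := cvg_neq0 FU l0 c0w.
split; first by apply: (filterS _ n0) => k; rewrite mulf_eq0 negb_or => /andP[].
have : (c k * w k 1 0) / (c k * w k 0 0) @[k --> U] --> l 1 0 / l 0 0.
  by apply: cvgM => //; exact: cvgV.
apply: cvg_trans; apply: near_eq_cvg; apply: (filterS2 _ _ c0 n0) => k ck.
rewrite mulf_eq0 negb_or => /andP[_ wk].
by field; rewrite ?ck ?wk.
Qed.

Lemma dirto_ratio1 U (FU : Filter U) (w : nat -> 'cV[R]_2) (l : 'cV[R]_2) : l 1 0 != 0 -> dirto U w l ->
  (\forall k \near U, w k 1 0 != 0) /\ w k 0 0 / w k 1 0 @[k --> U] --> l 0 0 / l 1 0.
Proof.
move=> l0 [c c0 [c0w c1w]].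
have n0 := cvg_neq0 FU l0 c1w.
split; first by apply: (filterS _ n0) => k; rewrite mulf_eq0 negb_or => /andP[].
have : (c k * w k 0 0) / (c k * w k 1 0) @[k --> U] --> l 0 0 / l 1 0.
  by apply: cvgM => //; exact: cvgV.
apply: cvg_trans; apply: near_eq_cvg; apply: (filterS2 _ _ c0 n0) => k ck.
rewrite mulf_eq0 negb_or => /andP[_ wk].
by field; rewrite ?ck ?wk.
Qed.

(** Order and bijectivity force continuity, see [incr_homeo_continuous]. *)
Definition incr_homeo (phi psi : R -> R) :=
  [/\ {mono phi : x y / x <= y}, cancel phi psi & cancel psi phi].

Lemma incr_homeo_sym phi psi : incr_homeo phi psi -> incr_homeo psi phi.
Proof. by move=> [m k1 k2]; split=> // x y; rewrite -m !k2. Qed.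

Lemma incr_homeo_lt phi psi : incr_homeo phi psi -> {mono phi : x y / x < y}.
Proof. by move=> [m _ _]; exact: leW_mono. Qed.

Lemma incr_homeo_comp phi psi phi' psi' : incr_homeo phi psi -> incr_homeo phi' psi' ->
  incr_homeo (phi \o phi') (psi' \o psi).
Proof.
move=> [m k1 k2] [m' k1' k2']; split=> [x y|x|x] /=; first by rewrite m m'.
  by rewrite k1.
by rewrite k2'.
Qed.

Lemma incr_homeo_continuous phi psi : incr_homeo phi psi -> continuous phi.
Proof.
move=> H; have H' := incr_homeo_sym H; move: (H) (H') => [_ k1 k2] _ x.
apply/cvgrPdist_lt => e e0.
have h1 : psi (phi x - e) < x by rewrite -{2}(k1 x) (incr_homeo_lt H'); lra.
have h2 : x < psi (phi x + e) by rewrite -{1}(k1 x) (incr_homeo_lt H'); lra.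
have : x \in `](psi (phi x - e)), (psi (phi x + e))[ by rewrite in_itv/= h1.
move=> /near_in_itvoo; apply: filterS => y; rewrite in_itv/= => /andP[].
rewrite -(incr_homeo_lt H) k2 => a; rewrite -(incr_homeo_lt H) k2 => b.
by rewrite distrC ltr_distl a.
Qed.

(* The homeomorphism of the projective line that extends [phi] and fixes infinity. *)
Definition plift (phi : R -> R) (w : 'cV[R]_2) : 'cV[R]_2 :=
  if w 1 0 == 0 then v2 1 0 else v2 (phi (w 0 0 / w 1 0)) 1.

Lemma plift_neq0 phi w : plift phi w != 0.
Proof. by rewrite /plift; case: ifP => _; rewrite v2_eq0 oner_eq0 ?andbF. Qed.

Lemma plift_v2 phi x : plift phi (v2 x 1) = v2 (phi x) 1.
Proof. by rewrite /plift v2E0 v2E1 oner_eq0 divr1. Qed.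

Lemma plift_e1 phi : plift phi (v2 1 0) = v2 1 0.
Proof. by rewrite /plift v2E1 eqxx. Qed.

Lemma pliftZ phi c w : c != 0 -> plift phi (c *: w) = plift phi w.
Proof.
move=> c0; rewrite /plift !mxE mulf_eq0 (negPf c0) /=; case: eqVneq => // w0.
by congr (v2 (phi _) _); field; rewrite ?c0 ?w0.
Qed.

Lemma plift_det2 phi psi u v : incr_homeo phi psi -> u != 0 -> v != 0 ->
  det2 (plift phi u) (plift phi v) = 0 -> det2 u v = 0.
Proof.
move=> [_ k1 _]; rewrite /plift (v2P u) (v2P v) !v2_eq0 !v2E0 !v2E1 det2_v2.
set a := u 0 0; set b := u 1 0; set c := v 0 0; set d := v 1 0.
have [->|b0] := eqVneq b 0; have [->|d0] := eqVneq d 0; rewrite det2_v2.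
- by move=> *; ring.
- by move=> *; lra.
- by move=> *; lra.
- move=> _ _ e; have /(can_inj k1) e' : phi (a / b) = phi (c / d) by lra.
  have -> : a = a / b * b by rewrite divfK.
  by rewrite e'; field.
Qed.

Lemma plift_comp phi phi' w : plift (phi \o phi') w = plift phi (plift phi' w).
Proof.
rewrite /plift; case: (eqVneq (w 1 0) 0) => w0; first by rewrite v2E1 eqxx.
by rewrite v2E0 v2E1 oner_eq0 divr1.
Qed.

Lemma plift_dirto U (FU : Filter U) phi psi (w : nat -> 'cV[R]_2) (l : 'cV[R]_2) : incr_homeo phi psi -> l != 0 ->
  dirto U w l -> dirto U (fun k => plift phi (w k)) (plift phi l).
Proof.
move=> H l0 dw.
have [l1|l1] := eqVneq (l 1 0) 0; last first.
  have [w0 cw] := dirto_ratio1 FU l1 dw.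
  have /(continuous_cvg _ (incr_homeo_continuous H (x := _))) cphi := cw.
  exists (fun=> 1); first by near=> k; exact: oner_neq0.
  rewrite /plift (negPf l1) v2E0 v2E1; split.
    apply: cvg_trans cphi; apply: near_eq_cvg; apply: (filterS _ w0) => k wk /=.
    by rewrite (negPf wk) v2E0 mul1r.
  apply: cvg_near_cst; apply: (filterS _ w0) => k wk /=.
  by rewrite (negPf wk) v2E1 mul1r.
have l00 : l 0 0 != 0 by move: l0; rewrite {1}(v2P l) v2_eq0 l1 eqxx andbT.
have [w0 cw] := dirto_ratio0 FU l00 dw; rewrite l1 mul0r in cw.
(* Near infinity the representative with coordinates [phi] and 1 is divided by [phi]; when [w k] is
   exactly infinity, [plift] returns [v2 1 0] and the factor is 1. *)
pose c k := if w k 1 0 == 0 then 1 else (phi (w k 0 0 / w k 1 0))^-1.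
have cphi : forall e, 0 < e -> \forall k \near U, w k 1 0 != 0 ->
    phi (w k 0 0 / w k 1 0) != 0 /\ `|(phi (w k 0 0 / w k 1 0))^-1| < e.
  move=> e e0.
  (* Beyond [B] in absolute value a point has passed the preimage of [e^-1] or of [- e^-1], so [phi]
     exceeds [e^-1] in absolute value there. *)
  pose B := `|psi e^-1| + `|psi (- e^-1)| + 1.
  have B0 : 0 < B by rewrite /B addrC ltr_wpDr// addr_ge0.
  have B1 : 0 < B^-1 by rewrite invr_gt0.
  have := cw; move/cvgrPdist_lt => /(_ _ B1).
  apply: filterS2 w0 => k w0 + w1; rewrite sub0r normrN => h.
  have {}h : B < `|w k 0 0 / w k 1 0|.
    rewrite -invf_div normfV -[ltLHS]invrK ltf_pV2// posrE ?invr_gt0//.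
    by rewrite normr_gt0 mulf_neq0 ?invr_eq0.
  set s := w k 0 0 / w k 1 0 in h *.
  have ei0 : 0 < e^-1 by rewrite invr_gt0.
  move: (H) => [_ k1 k2].
  have hs : e^-1 < `|phi s|.
    have [s0|s0] := leP 0 s.
      apply: lt_le_trans (ler_norm _); rewrite -(k2 e^-1) (incr_homeo_lt H).
      apply: le_lt_trans (ler_norm _) _; move: h; rewrite (ger0_norm s0); apply: le_lt_trans.
      by rewrite /B -addrA lerDl addr_ge0.
    rewrite -normrN; apply: lt_le_trans (ler_norm _).
    rewrite ltrNr -(k2 (- e^-1)) (incr_homeo_lt H).
    move: h; rewrite (ltr0_norm s0) ltrNr => /lt_le_trans; apply.
    rewrite lerNl; apply: le_trans (ler_norm _) _; rewrite normrN /B addrAC lerDr.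
    by rewrite addr_ge0.
  have p0 : phi s != 0 by rewrite -normr_gt0 (lt_trans ei0).
  by split=> //; rewrite normfV -[ltRHS]invrK ltf_pV2 ?posrE ?normr_gt0.
exists c.
  have := cphi 1 ltr01; apply: filterS => k h; rewrite /c; case: (eqVneq (w k 1 0) 0) => [_|w1].
    exact: oner_neq0.
  by rewrite invr_eq0; have [] := h w1.
rewrite {2 4}/plift l1 eqxx v2E0 v2E1; split.
  apply: cvg_near_cst.
  have := cphi 1 ltr01; apply: filterS => k h; rewrite /c /plift /=; case: (eqVneq (w k 1 0) 0) => [_|w1].
    by rewrite v2E0 mulr1.
  by rewrite v2E0 mulVf//; have [] := h w1.
apply/cvgrPdist_lt => e e0; have := cphi _ e0; apply: filterS => k h.
rewrite sub0r normrN /c /plift; case: (eqVneq (w k 1 0) 0) => [_|w1]; rewrite v2E1.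
  by rewrite mulr0 normr0.
by rewrite mulr1; have [] := h w1.
Unshelve. all: by end_near. Qed.

End Directions.

(** * Blow-up at conical points *)

Section BlowUp.
Context {R : realType}.
Implicit Types (U : set_system nat).

(* [v] is a conical limit point: [m] expands the circle at [v]. *)
Definition conical U (m : nat -> 'M[R]_2) (v a b : 'cV[R]_2) :=
  [/\ dirto U (fun k => m k *m v) a,
      (forall w, det2 w v != 0 -> dirto U (fun k => m k *m w) b) &
      det2 a b != 0].

Definition circle_equivariant (m M : 'M[R]_2) (phi : R -> R) :=
  forall w, w != 0 -> det2 (M *m plift phi w) (plift phi (m *m w)) = 0.

Lemma det2_neq0l (u v : 'cV[R]_2) : det2 u v != 0 -> u != 0.
Proof. by apply: contraNneq => ->; rewrite /det2 !mxE; apply/eqP; ring. Qed.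

Lemma det2_neq0r (u v : 'cV[R]_2) : det2 u v != 0 -> v != 0.
Proof. by apply: contraNneq => ->; rewrite /det2 !mxE; apply/eqP; ring. Qed.

(** Although [phi] is only continuous, it transports limit directions, so [M k] inherits from [m k]
    the attraction towards the image of [b] and the exceptional point [phi t]. A Moebius map is
    determined by three points; following [phi t], [phi t + 1] and infinity shows that, at scale
    [rho k] around [phi t], [h] after [M k] is nearly the identity in [r]. *)
Lemma blowup U (PU : ProperFilter U) (m M : nat -> 'M[R]_2) phi psi t a b :
  incr_homeo phi psi -> (forall k, \det (m k) = 1) -> (forall k, \det (M k) = 1) ->
  (forall k, circle_equivariant (m k) (M k) phi) ->
  conical U m (v2 t 1) a b ->
  exists h : 'M[R]_2, [/\ 0 < \det h, det2 (h *m plift phi b) (v2 1 0) = 0 &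
    exists rho delta eps : nat -> R,
    [/\ rho k @[k --> U] --> 0, delta k @[k --> U] --> 0, eps k @[k --> U] --> 0 &
      \forall k \near U, 0 < rho k /\ exists2 s, s != 0 &
        forall r, h *m (M k *m v2 (phi t + rho k * r) 1)
                = s *: v2 (r + delta k) (1 + eps k * r)]].
Proof.
move=> H dm dM mM [ca cb ab].
have a0 := det2_neq0l ab; have b0 := det2_neq0r ab.
have FU : Filter U by apply: PU.
have cM w l : w != 0 -> l != 0 -> dirto U (fun k => m k *m w) l ->
    dirto U (fun k => M k *m plift phi w) (plift phi l).
  move=> w0 l0 /(plift_dirto FU H l0); apply: dirto_par => // k.
  - exact: plift_neq0.
  - by apply: mulmx_neq0; rewrite ?dM ?oner_neq0 ?plift_neq0.
  - by rewrite det2C mM ?oppr0.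
set a' := plift phi a; set b' := plift phi b.
pose D := det2 a' b'.
have D0 : D != 0.
  by apply: contraNneq ab => D0; apply/eqP; exact: plift_det2 H a0 b0 D0.
(* [h] sends [a'] to 0 and [b'] to infinity. The factor [D] makes its determinant [D * D], positive
   for either orientation of the pair. *)
pose h : 'M[R]_2 := \matrix_(i, j) (if i == 0 then (if j == 0 then a' 1 0 else - a' 0 0)
   else (if j == 0 then D * b' 1 0 else - (D * b' 0 0))).
have hE w : h *m w = v2 (det2 w a') (D * det2 w b').
  by rewrite mulmx_v2 !mxE /=; congr v2; rewrite /det2; ring.
have dh : \det h = D * D by rewrite det22 !mxE /= /D /det2; ring.
have dh0 : 0 < \det h by rewrite dh -expr2 exprn_even_gt0.
exists h; split => //.
  by rewrite hE det2_v2 /det2; ring.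
have hb : h *m b' = v2 (- D) 0 by rewrite hE; congr v2; rewrite /D /det2; ring.
have ha : h *m a' = v2 0 (D * D) by rewrite hE; congr v2; rewrite /D /det2; ring.
have c1 w : det2 w (v2 t 1) != 0 -> dirto U (fun k => h *m (M k *m plift phi w)) (v2 (- D) 0).
  move=> wt; rewrite -hb; apply: dirto_mulmx; apply: cM => //; last exact: cb.
  exact: det2_neq0l wt.
have ce1 : dirto U (fun k => h *m (M k *m v2 1 0)) (v2 (- D) 0).
  by rewrite -(plift_e1 phi); apply: c1; rewrite det2_v2 mul0r subr0 mulr1 oner_neq0.
(* The convergence of this third point to infinity is what forces [rho] to tend to 0. *)
have cy : dirto U (fun k => h *m (M k *m v2 (phi t + 1) 1)) (v2 (- D) 0).
  have -> : v2 (phi t + 1) 1 = plift phi (v2 (psi (phi t + 1)) 1).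
    by rewrite plift_v2; case: H => _ _ ->.
  apply: c1; rewrite det2_v2 mulr1 mul1r subr_eq0.
  apply/eqP => e; have := congr1 phi e; case: H => _ _ ->; lra.
have cx : dirto U (fun k => h *m (M k *m v2 (phi t) 1)) (v2 0 (D * D)).
  rewrite -ha -plift_v2; apply: dirto_mulmx; apply: cM => //; exact: v2x1_neq0.
pose P k := h *m (M k *m v2 1 0); pose Q k := h *m (M k *m v2 (phi t) 1).
have PQ k r : h *m (M k *m v2 (phi t + r) 1) =
    v2 (Q k 0 0 + r * P k 0 0) (Q k 1 0 + r * P k 1 0).
  have -> : v2 (phi t + r) 1 = v2 (phi t) 1 + r *: v2 1 0.
    by rewrite [RHS]v2P !mxE /=; congr v2; ring.
  by rewrite !mulmxDr -!scalemxAr [LHS]v2P; congr v2; rewrite !mxE.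
have [|P0 ceps] := dirto_ratio0 FU (w := P) _ ce1; first by rewrite v2E0 oppr_eq0.
have [|Q1 cdel] := dirto_ratio1 FU (w := Q) _ cx; first by rewrite v2E1 mulf_neq0.
have [|Y0 ceta] := dirto_ratio0 FU _ cy; first by rewrite v2E0 oppr_eq0.
rewrite ?v2E0 ?v2E1 ?mul0r in ceps cdel ceta.
(* The image of [phi t + x] is [Q k + x *: P k]; the scale is chosen so that [x = rho k * r] gives
   the first coordinate [Q k 1 0 * (r + delta k)]. *)
pose rho k := Q k 1 0 / P k 0 0.
pose eta k := (h *m (M k *m v2 (phi t + 1) 1)) 1 0 / (h *m (M k *m v2 (phi t + 1) 1)) 0 0.
pose delta k := Q k 0 0 / Q k 1 0.
pose eps k := P k 1 0 / P k 0 0.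
have nearU : \forall k \near U, [/\ P k 0 0 != 0, Q k 1 0 != 0,
    Q k 0 0 + 1 * P k 0 0 != 0 & `|eps k * delta k| < 1 /\ `|eta k * delta k| < 1].
  have c1' : eps k * delta k @[k --> U] --> (0 * 0 : R) by apply: cvgM.
  have c2' : eta k * delta k @[k --> U] --> (0 * 0 : R) by apply: cvgM.
  rewrite mulr0 in c1' c2'.
  move/cvgrPdist_lt : c1' => /(_ 1 ltr01) n1; move/cvgrPdist_lt : c2' => /(_ 1 ltr01) n2.
  near=> k; split.
  - by near: k.
  - by near: k.
  - by near: k; apply: (filterS _ Y0) => k; rewrite PQ v2E0.
  - split; near: k.
      by apply: (filterS _ n1) => k; rewrite sub0r normrN.
    by apply: (filterS _ n2) => k; rewrite sub0r normrN.
exists rho, delta, eps; split => //.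
- have : (eta k - eps k) / (1 - eta k * delta k) @[k --> U] --> (0 - 0 : R) / (1 - 0 * 0).
    apply: cvgM; first exact: cvgB.
    apply: cvgV; first by rewrite mulr0 subr0 oner_neq0.
    by apply: cvgB; [exact: cvg_cst|exact: cvgM].
  rewrite subr0 mul0r; apply: cvg_trans; apply: near_eq_cvg.
  apply: (filterS _ nearU) => k [p0 q1 y0 [_ ed]].
  have ed1 : 1 - eta k * delta k != 0.
    by apply: contraTneq ed => /eqP; rewrite subr_eq0 => /eqP <-; rewrite normr1 ltxx.
  apply: (mulIf ed1); rewrite divfK// /rho /eps /delta /eta PQ v2E0 v2E1.
  rewrite mul1r in y0 *; rewrite mul1r.
  by field; rewrite ?p0 ?q1 ?y0.
- apply: (filterS _ nearU) => k [p0 q1 _ [ed _]]; split.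
    (* The sign of [rho k] is that of [det2 (P k) (Q k)], which equals [\det h] since [M k] has
       determinant 1. *)
    have : 0 < P k 0 0 * Q k 1 0 * (1 - eps k * delta k).
      have -> : P k 0 0 * Q k 1 0 * (1 - eps k * delta k) = det2 (P k) (Q k).
        by rewrite /det2 /eps /delta; field; rewrite ?p0 ?q1.
      by rewrite /P /Q !det2_mulmx dM mul1r det2_v2 mul0r subr0 mulr1 mulr1.
    rewrite pmulr_lgt0; last by move: ed; rewrite ltr_norml => /andP[]; lra.
    have pp : 0 < P k 0 0 * P k 0 0 by rewrite -expr2 exprn_even_gt0.
    have -> : P k 0 0 * Q k 1 0 = P k 0 0 * P k 0 0 * rho k by rewrite /rho; field.
    by rewrite pmulr_rgt0.
  exists (Q k 1 0) => // r; rewrite PQ scale_v2 /rho /delta /eps.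
  by congr v2; field; rewrite ?p0 ?q1.
Unshelve. all: by end_near. Qed.

End BlowUp.

(** * Conical limit points from cocompactness *)

Section Conical.
Context {R : realType}.

Definition sqnorm22 (M : 'M[R]_2) := M 0 0 ^+ 2 + M 0 1 ^+ 2 + (M 1 0 ^+ 2 + M 1 1 ^+ 2).

Lemma mulmx22 (M N : 'M[R]_2) i j : (M *m N) i j = M i 0 * N 0 j + M i 1 * N 1 j.
Proof.
rewrite !mxE !big_ord_recl big_ord0 addr0.
by rewrite (_ : lift _ _ = 1)//; apply/val_inj.
Qed.

(** [x + i y] is the image of [i] under [h], and cosh d(B i, i) is half the squared norm of B for B
    in SL(2,R). A bound on hyperbolic distance thus becomes a bound on matrix entries. *)
Lemma cosh_dist_sqnorm (m h : 'M[R]_2) : \det m = 1 -> \det h = 1 ->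
  let n := h 1 0 ^+ 2 + h 1 1 ^+ 2 in
  let x := (h 0 0 * h 1 0 + h 0 1 * h 1 1) / n in
  let y := n^-1 in
  cosh_dist_i (mob_re m x y) (mob_im m x y) = sqnorm22 (m *m h) / 2 /\ 0 < y.
Proof.
move=> dm dh n x y.
have n0 : 0 < n.
  rewrite lt_neqAle addr_ge0 ?sqr_ge0// andbT eq_sym paddr_eq0 ?sqr_ge0// !expf_eq0 /=.
  by apply: contra_eqN dh => /andP[/eqP h0 /eqP h1]; rewrite det22 h0 h1 !mulr0 subr0 eq_sym oner_eq0.
split; last by rewrite invr_gt0.
pose A := (m *m h) 0 0; pose B := (m *m h) 0 1.
pose C := (m *m h) 1 0; pose D := (m *m h) 1 1.
have dmh : A * D - B * C = 1 by rewrite -[RHS]mulr1 -{1}dm -dh -det_mulmx det22.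
pose N := C ^+ 2 + D ^+ 2.
have N0 : 0 < N.
  rewrite lt_neqAle addr_ge0 ?sqr_ge0// andbT eq_sym paddr_eq0 ?sqr_ge0// !expf_eq0 /=.
  by apply: contra_eqN dmh => /andP[/eqP h0 /eqP h1]; rewrite h0 h1 !mulr0 subr0 eq_sym oner_eq0.
rewrite !det22 in dm dh.
have nn0 := lt0r_neq0 n0; have NN0 := lt0r_neq0 N0.
have den : mob_den m x y = N / n.
  have -> : N = ((m 1 0 * (h 0 0 * h 1 0 + h 0 1 * h 1 1) + m 1 1 * n) ^+ 2
      + m 1 0 ^+ 2 * (h 0 0 * h 1 1 - h 0 1 * h 1 0) ^+ 2) / n.
    by rewrite /N /C /D !mulmx22 /n; field.
  by rewrite dh /mob_den /x /y /n; field.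
have im : mob_im m x y = N^-1.
  by rewrite /mob_im den det22 dm /y; field; rewrite ?nn0 ?NN0.
have re : mob_re m x y = (A * C + B * D) / N.
  have -> : A * C + B * D = ((m 0 0 * (h 0 0 * h 1 0 + h 0 1 * h 1 1) + m 0 1 * n) *
      (m 1 0 * (h 0 0 * h 1 0 + h 0 1 * h 1 1) + m 1 1 * n)
      + m 0 0 * m 1 0 * (h 0 0 * h 1 1 - h 0 1 * h 1 0) ^+ 2) / n.
    by rewrite /A /B /C /D !mulmx22 /n; field.
  rewrite /mob_re den dh /x /y; move: n N nn0 NN0 {n0 N0 x y den im} => n N nn0 NN0.
  by field; rewrite ?nn0 ?NN0.
rewrite /cosh_dist_i re im /sqnorm22 -/A -/B -/C -/D -/N.
have -> : A ^+ 2 + B ^+ 2 = ((A * C + B * D) ^+ 2 + (A * D - B * C) ^+ 2) / N.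
  by rewrite /N; field.
rewrite dmh; move: (A * C + B * D) => z; move: N NN0 {N0 den im re} => N NN0.
by field.
Qed.

Lemma ultra_fmap (T T' : Type) (f : T -> T') (U : set_system T) :
  UltraFilter U -> UltraFilter (f @ U).
Proof.
move=> UU; split; first exact: fmap_proper_filter.
move=> G PG fUG; apply/seteqP; split=> // A GA.
have [//|fA] := in_ultra_setVsetC (f @^-1` A) UU.
have /fUG GnA : (f @ U) (~` A) by [].
have FG : Filter G by case: PG.
have : G (A `&` ~` A) by apply: filterI.
by rewrite setICr => /filter_not_empty.
Qed.

Lemma ultra_bounded_cvg (U : set_system nat) (FU : UltraFilter U) (f : nat -> R) (K : R) :
  (forall k, `|f k| <= K) -> exists l : R, f k @[k --> U] --> l.
Proof.
move=> fK; have : compact `[- K, K]%classic by exact: segment_compact.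
rewrite compact_ultra => /(_ _ (@ultra_fmap _ _ f _ FU)) [].
- by apply: (@filterE _ U) => k; have := fK k; rewrite ler_norml /= in_itv/=.
- by move=> l [_ fl]; exists l.
Qed.

(* The points of the geodesic ray that ends at [v] return to a fixed compact set of the
   hyperbolic plane. *)
Lemma conical_exists (G : groupType) (iota : G -> 'M[R]_2) (v : 'cV[R]_2) :
  closed_surface_group_in_PSL2 iota -> v != 0 ->
  exists g : nat -> G, exists2 U : set_system nat, ProperFilter U & exists a b,
    conical U (fun k => iota (g k)) v a b.
Proof.
move=> [diota _ _ _ [_ [C hC]]] v0.
have hC' h : \det h = 1 -> exists g, sqnorm22 (iota g *m h) <= C * 2.
  move=> dh; have [g hg] := hC ((h 0 0 * h 1 0 + h 0 1 * h 1 1) / (h 1 0 ^+ 2 + h 1 1 ^+ 2))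
    _ (cosh_dist_sqnorm (diota 1%g) dh).2.
  exists g; move: hg; rewrite (cosh_dist_sqnorm (diota g) dh).1.
  by rewrite ler_pdivrMr.
have n0 : 0 < v 0 0 ^+ 2 + v 1 0 ^+ 2.
  rewrite lt_neqAle addr_ge0 ?sqr_ge0// andbT eq_sym paddr_eq0 ?sqr_ge0// !expf_eq0 /=.
  by move: v0; rewrite {1}(v2P v) v2_eq0.
have nn0 := lt0r_neq0 n0.
pose N := v 0 0 ^+ 2 + v 1 0 ^+ 2.
pose p := v2 (v 1 0 / N) (- (v 0 0 / N)).
have dpv : det2 p v = 1 by rewrite /det2 /p v2E0 v2E1 /N; field.
pose s (k : nat) : R := k.+1%:R^-1.
have s0 k : 0 < s k by rewrite invr_gt0.
(* In the basis [p], [v] of determinant 1 this is a diagonal flow: the images of [i] under the [h k]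
   lie on a geodesic ray that ends at [v]. *)
pose h k : 'M[R]_2 := \matrix_(i, j) (if j == 0 then p i 0 * s k else v i 0 / s k).
have dh k : \det (h k) = 1.
  have sk := lt0r_neq0 (s0 k); rewrite det22 !mxE /= -[RHS]dpv /det2 /p !mxE /=.
  by move: (s k) sk => sk sk0; field; rewrite ?sk0 ?nn0.
have /choice[g gC] k := hC' _ (dh k).
(* The matrices [B k] are bounded; an ultrafilter finer than the one at infinity makes their four
   entries converge. Their columns are multiples of the images of [p] and [v], and the determinant 1
   keeps the two limits independent. *)
have [U [UU ooU]] := ultraFilterLemma (F := \oo : set_system nat) _.
pose B k := iota (g k) *m h k.
have Bbd k i j : `|B k i j| <= Num.sqrt (C * 2).
  rewrite -sqrtr_sqr; apply: ler_wsqrtr; apply: le_trans (gC k); rewrite /sqnorm22 -/(B k).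
  have i01 : forall l : 'I_2, l = 0 \/ l = 1.
    by case=> [[|[|//]] ?]; [left|right]; apply/val_inj.
  have q0 := sqr_ge0 (B k 0 0); have q1 := sqr_ge0 (B k 0 1).
  have q2 := sqr_ge0 (B k 1 0); have q3 := sqr_ge0 (B k 1 1).
  by have [->|->] := i01 i; have [->|->] := i01 j; lra.
have lB i j := ultra_bounded_cvg UU (fun k => Bbd k i j).
have [b0 cb0] := lB 0 0; have [a0 ca0] := lB 0 1.
have [b1 cb1] := lB 1 0; have [a1 ca1] := lB 1 1.
have BE k : B k 0 0 * B k 1 1 - B k 0 1 * B k 1 0 = 1.
  by rewrite -det22 det_mulmx diota dh mulr1.
have dab : b0 * a1 - a0 * b1 = 1.
  have c1 : B k 0 0 * B k 1 1 - B k 0 1 * B k 1 0 @[k --> U] --> b0 * a1 - a0 * b1.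
    by apply: cvgB; apply: cvgM.
  have c2 : B k 0 0 * B k 1 1 - B k 0 1 * B k 1 0 @[k --> U] --> (1 : R).
    by under eq_cvg do rewrite BE; exact: cvg_cst.
  exact: (cvg_unique _ c1 c2).
have Bp k i : B k i 0 = (iota (g k) *m p) i 0 * s k.
  by rewrite /B !mxE big_distrl /=; apply: eq_bigr => j _; rewrite !mxE /= mulrA.
have Bv k i : B k i 1 = (iota (g k) *m v) i 0 / s k.
  by rewrite /B !mxE big_distrl /=; apply: eq_bigr => j _; rewrite !mxE /= mulrA.
have cs : s k @[k --> U] --> (0 : R).
  by move=> A /(@cvg_harmonic R) hA; exact: ooU.
exists g, U; first exact: ultra_proper.
exists (v2 a0 a1), (v2 b0 b1); split.
- exists (fun k => (s k)^-1); first by apply: filterE => k; rewrite invr_eq0 lt0r_neq0.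
  by split; rewrite ?v2E0 ?v2E1; under eq_cvg do rewrite mulrC -Bv.
(* Rescaled by [s k / al], the image of [w] differs from the first column of [B k] by a multiple of
   the second of order [s k * s k]: only the component along [p] survives. *)
- move=> w wv; pose al := det2 w v; pose be := det2 p w.
  have wE : w = al *: p + be *: v.
    rewrite [LHS]v2P [RHS]v2P; congr v2; rewrite !mxE -[LHS]mulr1 -dpv /al /be /det2 /p /=.
      by rewrite v2E0 v2E1; ring.
    by rewrite v2E0 v2E1; ring.
  exists (fun k => s k / al).
    by apply: filterE => k; rewrite mulf_neq0 ?invr_eq0 ?(lt0r_neq0 (s0 k)).
  have E k i : s k / al * (iota (g k) *m w) i 0 = B k i 0 + be / al * (s k * s k) * B k i 1.
    rewrite Bp Bv wE mulmxDr -!scalemxAr; move: (iota (g k) *m p) (iota (g k) *m v) => x y.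
    by rewrite !mxE; field; rewrite wv lt0r_neq0.
  have cE i (l l' : R) : B k i 0 @[k --> U] --> l -> B k i 1 @[k --> U] --> l' ->
      s k / al * (iota (g k) *m w) i 0 @[k --> U] --> l.
    move=> cl cl'; under eq_cvg do rewrite E.
    have : B k i 0 + be / al * (s k * s k) * B k i 1 @[k --> U] --> l + be / al * (0 * 0) * l'.
      by apply: cvgD => //; apply: cvgM => //; apply: cvgM; [exact: cvg_cst|exact: cvgM].
    by rewrite !mulr0 mul0r addr0.
  by split; rewrite ?v2E0 ?v2E1; [exact: cE ca0|exact: cE ca1].
- by rewrite det2_v2; apply/eqP => e; have := dab; lra.
Qed.

End Conical.

(** * Ergodicity *)

Section Ergodicity.
Context {R : realType}.
Local Notation mu := (@lebesgue_measure R).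

Lemma near_at_right0 (P : R -> Prop) : (\forall r \near 0^'+, P r) ->
  exists2 d : R, 0 < d & forall r, 0 < r < d -> P r.
Proof.
move=> /nbhs_ballP[d /= d0 h]; exists d => // r /andP[r0 rd].
by apply: h => //; rewrite /ball/= sub0r normrN gtr0_norm.
Qed.

Lemma density_point (C : set R) : measurable C -> mu C != 0%E ->
  exists2 x, C x & forall e : R, 0 < e -> exists2 d : R, 0 < d & forall r, 0 < r < d ->
    (mu (~` C `&` ball x r) <= (e * r)%:E)%E.
Proof.
move=> mC C0.
have [x [Cx hx]] : exists x, C x /\ (mu (~` C `&` ball x r) * (mu (ball x r))^-1
    @[r --> 0^'+] --> (\1_(~` C) x : R)%:E)%E.
  apply: contrapT => /forallNP h; move/negP: C0; apply; apply/eqP.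
  apply: (@measure_negligible _ _ _ mu) => //.
  apply: negligibleS (lebesgue_density (measurableC mC)) => x Cx /= hx.
  by apply: (h x).
exists x => // e e0; apply: near_at_right0.
have e20 : 0 < e / 2 by rewrite divr_gt0.
move: hx; rewrite indicE memNset ?mulr0n//=.
move=> /fine_cvgP[_ /cvgrPdist_lt /(_ _ e20)].
have : \forall r \near 0^'+, (0 : R) < r by exact: nbhs_right_gt.
apply: filterS2 => r r0.
have mB : mu (ball x r) = (r *+ 2)%:E by rewrite lebesgue_measure_ball// ltW.
have fin : mu (~` C `&` ball x r) \is a fin_num.
  rewrite ge0_fin_numE ?lebesgue_ge0//; apply: (@le_lt_trans _ _ (mu (ball x r))).
    by apply: le_lebesgue => y [].
  by rewrite mB ltry.
have r20 : r *+ 2 != 0 by rewrite mulrn_eq0/= gt_eqF.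
rewrite sub0r normrN /= mB.
rewrite -(fineK fin) inver (negPf r20) -EFinM /= lee_fin.
move=> /(le_lt_trans (ler_norm _)); rewrite ltr_pdivrMr ?mulrn_wgt0// => /ltW.
by rewrite -[r *+ 2]mulr_natr mulrA mulrAC divfK.
Qed.

(** The action is projective and may send a point to infinity; invariance is tested on pairs of
    finite points. *)
Definition inv_action (G : Type) (sigma : G -> 'M[R]_2) (C : set R) :=
  forall g s s', det2 (sigma g *m v2 s 1) (v2 s' 1) = 0 -> (C s <-> C s').

Lemma cvg0_norm_lt (U : set_system nat) (FU : Filter U) (f : nat -> R) (e : R) : 0 < e ->
  f k @[k --> U] --> 0 -> \forall k \near U, `|f k| < e.
Proof.
move=> e0 /cvgrPdist_lt /(_ _ e0); apply: filterS => k.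
by rewrite sub0r normrN.
Qed.

Lemma line_null (h : 'M[R]_2) : \det h != 0 -> mu [set s | h 1 0 * s + h 1 1 = 0] = 0%E.
Proof.
rewrite det22 => dh; have [h0|h0] := eqVneq (h 1 0) 0.
  have [h1|h1] := eqVneq (h 1 1) 0.
    by move: dh; rewrite h0 h1 !mulr0 subrr eqxx.
  rewrite (_ : [set s | _] = set0) ?measure0// -subset0 => s /=.
  by rewrite h0 mul0r add0r => /eqP; rewrite (negPf h1).
apply: lebesgue_null_sub (lebesgue_measure_set1 (- h 1 1 / h 1 0)) => s /= e.
by apply: (mulIf h0); rewrite divfK//; lra.
Qed.

(** Around a density point [x], the complement of [C] occupies a negligible part of the window of
    size [rho k]. The group element magnifies this window to a fixed size and preserves [C], so in
    the coordinate [h] the complement has arbitrarily small measure on every bounded interval. *)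
Lemma ergodic_action (G : Type) (iota sigma : G -> 'M[R]_2) phi psi :
  incr_homeo phi psi ->
  (forall g, \det (iota g) = 1) -> (forall g, \det (sigma g) = 1) ->
  (forall g, circle_equivariant (iota g) (sigma g) phi) ->
  (forall t, exists g : nat -> G, exists2 U : set_system nat, ProperFilter U &
     exists a b, conical U (fun k => iota (g k)) (v2 t 1) a b) ->
  forall C, measurable C -> inv_action sigma C -> mu C = 0%E \/ mu (~` C) = 0%E.
Proof.
move=> H di ds eqv con C mC iC.
have [->|C0] := eqVneq (mu C) 0%E; [by left|right].
have [x Cx dens] := density_point mC C0.
have [g [U PU [a [b cab]]]] := con (psi x).
have FU : Filter U by apply: PU.
have [h [dh _ [rho [delta [eps [crho cdelta ceps nearU]]]]]] :=
  blowup PU H (fun k => di (g k)) (fun k => ds (g k)) (fun k => eqv (g k)) cab.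
have dh0 : \det h != 0 by rewrite lt0r_neq0.
have phix : phi (psi x) = x by case: H.
rewrite phix in nearU.
pose D (K : nat) := [set z | `|z| <= K%:R /\ exists2 s, ~ C s &
  det2 (h *m v2 s 1) (v2 z 1) = 0].
have D0 K : mu (D K) = 0%E.
  apply/eqP; rewrite eq_le lebesgue_ge0 andbT; apply/lee_addgt0Pr => e e0.
  rewrite add0e.
  (* For [|z| <= K], once [|delta k| < 1] and [|eps k * z| < 1/2], the preimage [r z] of [z] under
     the blown-up map has absolute value at most [2 * (K + 1)]. *)
  pose L : R := 2 * (K%:R + 1).
  have L2 : 2 <= L by rewrite /L mulrDr mulr1 lerDr mulr_ge0.
  have L0 : 0 < L by lra.
  (* 16 is the factor 2 of [lebesgue_lipschitz] times the 8 in the Lipschitz constant [8 / rho k],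
     and the window has radius [rho k * (L + 1)]: the product is exactly [e]. *)
  have e'0 : 0 < e / (16 * (L + 1)) by rewrite divr_gt0// mulr_gt0//; lra.
  have [d d0 hd] := dens _ e'0.
  have dL0 : 0 < d / (L + 1) by rewrite divr_gt0//; lra.
  have eL0 : 0 < (2 * L)^-1 by rewrite invr_gt0; lra.
  have n1 := cvg0_norm_lt FU dL0 crho.
  have n2 := cvg0_norm_lt FU ltr01 cdelta.
  have n3 := cvg0_norm_lt FU eL0 ceps.
  have := @filterI _ U FU _ _ nearU (@filterI _ U FU _ _ n1 (@filterI _ U FU _ _ n2 n3)).
  move=> /(@filter_ex _ U PU)[k [[r0 [s s0 hs]] [r1 [d1 e1]]]].
  pose r z := (z - delta k) / (1 - eps k * z).
  have eL (z : R) : `|z| <= L -> `|eps k * z| < 2^-1.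
    move=> zL; rewrite normrM; apply: (@le_lt_trans _ _ (`|eps k| * L)).
      by rewrite ler_wpM2l.
    have -> : 2^-1 = (2 * L)^-1 * L by field; exact: lt0r_neq0.
    by rewrite ltr_pM2r.
  pose E := ~` C `&` [set p | `|p - x| <= rho k * L].
  pose T r := (r + delta k) / (1 + eps k * r).
  pose f p := T ((p - x) / rho k).
  have sub : D K `<=` f @` E.
    move=> z [zK [c nCc hz]].
    have zL : `|z| <= L.
      by apply: le_trans zK _; rewrite /L; have : (0:R) <= K%:R by []; lra.
    have := eL z zL; rewrite ltr_norml => /andP[ez1 ez2].
    have q0 : 0 < 1 - eps k * z by lra.
    have rL : `|r z| <= L.
      rewrite /r normrM normfV (gtr0_norm q0) ler_pdivrMr//.
      apply: (@le_trans _ _ (L * 2^-1)); last by rewrite ler_wpM2l ?ltW//; lra.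
      apply: le_trans (ler_normB _ _) _; rewrite /L mulrAC divff// mul1r.
      by apply: lerD => //; exact: ltW.
    have rz : r z + delta k = z * (1 + eps k * r z).
      by rewrite /r; field; exact: lt0r_neq0.
    have := eL _ rL; rewrite ltr_norml => /andP[er1 er2].
    have q1 : 1 + eps k * r z != 0 by rewrite lt0r_neq0//; lra.
    exists (x + rho k * r z); last first.
      rewrite /f /T (addrC x) addrK mulrAC divff ?lt0r_neq0// mul1r rz mulfK//.
    split; last by rewrite /= (addrC x) addrK normrM (gtr0_norm r0) ler_wpM2l// ltW.
    (* Invariance enters here: [sigma (g k)] carries [x + rho k * r z] to [c]. *)
    move=> Cp; apply: nCc; apply: (iC (g k) _ _ _).1 Cp.
    have : det2 (h *m (sigma (g k) *m v2 (x + rho k * r z) 1)) (h *m v2 c 1) = 0.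
      rewrite hs; apply: (@det2_trans _ _ (v2 z 1)); first exact: v2x1_neq0.
        rewrite scale_v2 det2_v2 rz; ring.
      by rewrite det2C hz oppr0.
    by rewrite det2_mulmx => /eqP; rewrite mulf_eq0 (negPf dh0) => /eqP.
  have lip p q : E p -> E q -> `|f p - f q| <= (8 / rho k) * `|p - q|.
    have bd y : E y -> `|(y - x) / rho k| <= L.
      by move=> [_ /=]; rewrite normrM normfV (gtr0_norm r0) ler_pdivrMr// mulrC.
    move=> /bd bp /bd bq.
    have := eL _ bp; have := eL _ bq; rewrite !ltr_norml => /andP[q1 q2] /andP[p1 p2].
    rewrite /f /T; set P := (p - x) / rho k in p1 p2 *; set Q := (q - x) / rho k in q1 q2 *.
    have pos1 : 0 < 1 + eps k * P by lra.
    have pos2 : 0 < 1 + eps k * Q by lra.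
    have -> : (P + delta k) / (1 + eps k * P) - (Q + delta k) / (1 + eps k * Q) =
       (p - q) / rho k * ((1 - eps k * delta k) / ((1 + eps k * P) * (1 + eps k * Q))).
      have -> : (p - q) / rho k = P - Q by rewrite /P /Q; field; exact: lt0r_neq0.
      by field; rewrite !lt0r_neq0.
    set X := (1 - eps k * delta k) / _.
    (* The numerator is at most 2 and each of the two denominators at least 1/2. *)
    have X8 : `|X| <= 8.
      rewrite /X.
      rewrite normrM normfV ger0_norm; last first.
        rewrite subr_ge0; apply: le_trans (ler_norm _) _; rewrite normrM.
        rewrite -[leRHS]mulr1 ler_pM ?(ltW d1)//.
        apply: le_trans (ltW e1) _; rewrite invf_le1; lra.
      rewrite (gtr0_norm (mulr_gt0 pos1 pos2)) ler_pdivrMr ?mulr_gt0//.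
      have ed : `|eps k * delta k| <= 1.
        rewrite normrM -[leRHS]mulr1 ler_pM ?(ltW d1)//.
        by apply: le_trans (ltW e1) _; rewrite invf_le1; lra.
      move: ed; rewrite ler_norml => /andP[ed1 _].
      have : 4^-1 <= (1 + eps k * P) * (1 + eps k * Q).
        have -> : 4^-1 = 2^-1 * 2^-1 :> R by field.
        by apply: ler_pM; lra.
      lra.
    rewrite normrM normrM (gtr0_norm (x := (rho k)^-1)) ?invr_gt0//.
    apply: le_trans (ler_wpM2l _ X8) _; first by rewrite mulr_ge0// invr_ge0 ltW.
    by rewrite mulrC mulrA mulrAC.
  apply: le_trans (le_lebesgue sub) _.
  have r8 : 0 < 8 / rho k by rewrite divr_gt0.
  apply: le_trans (lebesgue_lipschitz r8 lip) _.
  have subE : E `<=` ~` C `&` ball x (rho k * (L + 1)).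
    move=> y [nCy /= yx]; split=> //; rewrite /ball/= distrC.
    by apply: le_lt_trans yx _; rewrite ltr_pM2l//; lra.
  have := hd (rho k * (L + 1)); rewrite -ltr_pdivlMr; last lra.
  rewrite (le_lt_trans (ler_norm _) r1) mulr_gt0//; last lra.
  move=> /(_ isT) hmu.
  apply: (@le_trans _ _ ((2 * (8 / rho k))%:E *
     (e / (16 * (L + 1)) * (rho k * (L + 1)))%:E)%E).
    apply: lee_wpmul2l; first by rewrite lee_fin mulr_ge0// ltW.
    by apply: le_trans hmu; exact: le_lebesgue.
  rewrite -EFinM lee_fin; have -> //: 2 * (8 / rho k) * (e / (16 * (L + 1)) * (rho k * (L + 1))) = e.
  have L1 : L + 1 != 0 by rewrite lt0r_neq0//; lra.
  by field; rewrite L1 lt0r_neq0.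
rewrite det22 in dh0.
have := lebesgue_mobius_null dh0 (lebesgue_bigcup0 D0).
have := @line_null h; rewrite det22 => /(_ dh0) l0 m0.
apply: lebesgue_null_sub (lebesgue_setU0 l0 m0) => s nCs.
have [e|ne] := eqVneq (h 1 0 * s + h 1 1) 0; [by left|right].
exists ((h 0 0 * s + h 0 1) / (h 1 0 * s + h 1 1)); last by rewrite divfK.
set z := _ / _; exists (Num.truncn `|z|).+1 => //; split; first by rewrite ltW// truncnS_gt.
exists s => //; rewrite mulmx_v2 !v2E0 !v2E1 !mulr1 det2_v2 mulr1 /z.
by field.
Qed.
End Ergodicity.

(** * Rigidity *)

Section HomeoMeasure.
Context {R : realType}.
Local Notation mu := (@lebesgue_measure R).

Lemma incr_homeo_measurable phi psi : @incr_homeo R phi psi -> measurable_fun setT phi.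
Proof. by move=> H; apply: continuous_measurable_fun; exact: incr_homeo_continuous H. Qed.

Lemma measurable_homeo_preimage phi psi (A : set R) : incr_homeo phi psi ->
  measurable A -> measurable (phi @^-1` A).
Proof.
by move=> H mA; rewrite -[X in measurable X]setTI; exact: incr_homeo_measurable H _ _ mA.
Qed.

Lemma homeo_preimage_itv phi psi x y : @incr_homeo R phi psi ->
  psi @^-1` `]x, y[ = `](phi x), (phi y)[%classic /\
  psi @^-1` `]x, y] = `](phi x), (phi y)]%classic /\
  psi @^-1` `[x, y] = `[phi x, phi y]%classic.
Proof.
move=> H; case: (H) => m k1 k2.
have e1 a z : (a < psi z) = (phi a < z) by rewrite -(incr_homeo_lt H) k2.
have e2 a z : (psi z < a) = (z < phi a) by rewrite -(incr_homeo_lt H) k2.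
have e3 a z : (a <= psi z) = (phi a <= z) by rewrite -m k2.
have e4 a z : (psi z <= a) = (z <= phi a) by rewrite -m k2.
by do 2?split; apply/seteqP; split=> z /=; rewrite !in_itv/= ?e1 ?e2 ?e3 ?e4.
Qed.

(** As [psi] is the inverse of [phi], this is the length of the image of [A] under [phi], the
    Stieltjes measure of [phi]; the preimage form makes additivity immediate. *)
Definition homeo_measure phi psi (H : @incr_homeo R phi psi) :
  set (measurableTypeR R) -> \bar R := fun A => mu (psi @^-1` A).

Section measure.
Context phi psi (H : @incr_homeo R phi psi).
Let m0 : homeo_measure H set0 = 0%E.
Proof. by rewrite /homeo_measure preimage_set0 measure0. Qed.
Let mge0 A : (0 <= homeo_measure H A)%E.
Proof. exact: lebesgue_ge0. Qed.
Let msigma : semi_sigma_additive (homeo_measure H).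
Proof.
move=> F mF tF mUF; rewrite /homeo_measure preimage_bigcup.
have mp A : measurable A -> measurable (psi @^-1` A).
  by apply: measurable_homeo_preimage; exact: incr_homeo_sym H.
apply: measure_semi_sigma_additive.
- by move=> n; exact: mp (mF n).
- apply/trivIsetP => /= i j _ _ ij; rewrite -preimage_setI.
  by move/trivIsetP : tF => /(_ _ _ _ _ ij) ->//; rewrite preimage_set0.
- by rewrite -preimage_bigcup; exact: mp mUF.
Qed.
HB.instance Definition _ := isMeasure.Build _ _ _ (homeo_measure H) m0 mge0 msigma.
End measure.

(* [phi] is the distribution function of [homeo_measure H], whose Radon-Nikodym density is nonzero
   at some Lebesgue point. *)
Lemma homeo_derivative phi psi : incr_homeo phi psi ->
  (forall N : set R, measurable N -> mu N = 0%E -> mu (psi @^-1` N) = 0%E) ->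
  exists x, exists2 m : R, 0 < m & forall e : R, 0 < e -> exists2 d : R, 0 < d &
    forall u, `|u| < d -> `|phi (x + u) - phi x - m * u| <= e * `|u|.
Proof.
move=> H ac.
have H' := incr_homeo_sym H.
have phi01 : phi 0 < phi 1 by rewrite (incr_homeo_lt H).
have nuoo : (homeo_measure H `[0%R, 1%R] < +oo)%E.
  rewrite /homeo_measure (homeo_preimage_itv _ _ H).2.2 lebesgue_measure_itv/= lte_fin phi01.
  by rewrite -EFinB ltry.
have mI : measurable (`[0%R, 1%R]%classic : set (measurableTypeR R)).
  exact: (@measurable_itv R `[0%R, 1%R]).
(* Restricting to [[0, 1]] makes the measure finite, and its distribution function there is
   [phi - phi 0]. *)
pose nu0 : {finite_measure set (measurableTypeR R) -> \bar R} := mfrestr mI nuoo.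
pose nu := charge_of_finite_measure nu0.
have nuE A : nu A = mu (psi @^-1` (A `&` `[0%R, 1%R])) by [].
have nu01 (x : R) : 0 <= x <= 1 -> nu `]-oo, x]%classic = (phi x - phi 0)%:E.
  move=> /andP[x0 x1]; rewrite nuE.
  have -> : `]-oo, x]%classic `&` `[0%R, 1%R] = `[0%R, x]%classic.
    apply/seteqP; split=> z /=; rewrite !in_itv/=; first by move=> [-> /andP[->]].
    by move=> /andP[-> zx]; rewrite zx (le_trans zx).
  rewrite (homeo_preimage_itv _ _ H).2.2 lebesgue_measure_itv/= lte_fin (incr_homeo_lt H).
  move: x0; rewrite le_eqVlt => /predU1P[<-|->]; last by rewrite -EFinB.
  by rewrite ltxx subrr.
have numu : nu `<< mu.
  move=> A A0 B mB BA; rewrite nuE.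
  apply: lebesgue_null_sub (ac B mB (A0 B mB BA)) => z.
  by case.
pose f := Radon_Nikodym nu mu.
have fint : mu.-integrable setT f by exact: Radon_Nikodym_integrable.
pose g : R -> R := fine \o f.
have gE : EFin \o g = f.
  by apply/funext => x; rewrite /g /= fineK//; exact: Radon_Nikodym_fin_num.
have gint : mu.-integrable setT (EFin \o g) by rewrite gE.
pose G x := (\int[mu]_(t in [set` `]-oo, x]]) (g t))%R.
have GE x : 0 <= x <= 1 -> G x = phi x - phi 0.
  move=> x01; rewrite /G /Rintegral.
  under eq_integral do rewrite -[(g _)%:E]/((EFin \o g) _) gE.
  transitivity (fine (nu `]-oo, x]%classic)); last by rewrite nu01.
  by congr fine; rewrite -(Radon_Nikodym_integral numu).
have ae : {ae mu, forall x, derivable G x 1 /\ derive1 G x = g x}.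
  apply: FTC1Ny.
    by move=> y; apply: integrableS gint.
  by apply: open_integrable_locally => //; exact: openT.
have [x [x01 [dG G'] gx0]] : exists x, [/\ 0 < x < 1, derivable G x 1 /\ derive1 G x = g x & g x != 0].
  (* If the density vanished almost everywhere on []0, 1[], that interval would have measure 0
     instead of [phi 1 - phi 0]. *)
  apply: contrapT => /forallNP no.
  have ae0 : ae_eq mu `]0%R, 1%R[%classic f (cst 0%E).
    move: ae; apply: filterS; first exact: (ae_filter_ringOfSetsType mu).
    move=> x Px; rewrite /= in_itv/= => x01.
    rewrite -gE /=; congr EFin; apply/eqP; apply: contrapT => /negP gx.
    by apply: (no x).
  have : nu `]0%R, 1%R[%classic = (phi 1 - phi 0)%:E.
    rewrite nuE setIidl; last by apply: subset_itv; rewrite bnd_simp.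
    by rewrite (homeo_preimage_itv _ _ H).1 lebesgue_measure_itv/= lte_fin phi01.
  have -> : nu `]0%R, 1%R[%classic = (\int[mu]_(x in `]0%R, 1%R[) f x)%E.
    exact: (Radon_Nikodym_integral numu).
  rewrite (ae_eq_integral (cst 0%E))//; last first.
    by apply: measurable_funTS; case/integrableP: fint.
  by rewrite integral0 => -[] e; move: phi01; rewrite -subr_gt0 -e ltxx.
have der : forall e : R, 0 < e -> exists2 d : R, 0 < d &
    forall u, `|u| < d -> `|phi (x + u) - phi x - g x * u| <= e * `|u|.
  move=> e e0.
  have cG : cvg ((fun h : R => h^-1 *: (G (h + x) - G x)) @ 0^').
    suff <- : (fun h : R => h^-1 *: ((G \o shift x) (h *: (1 : R)) - G x)) =
        (fun h : R => h^-1 *: (G (h + x) - G x)) by exact: dG.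
    by apply/funext => h /=; rewrite [h%:A]mulr1.
  have : (fun h : R => h^-1 *: (G (h + x) - G x)) @ 0^' --> g x by rewrite -G'; exact: cG.
  move=> /cvgrPdist_lt/(_ _ e0) /nbhs_ballP[d /= d0 hd].
  (* Keeps [x + u] inside [[0, 1]], where [G] is known to be [phi - phi 0]. *)
  pose d' := Num.min d (Num.min x (1 - x)).
  case/andP: x01 => x0 x1.
  exists d'; first by rewrite !lt_min d0 x0 subr_gt0.
  move=> u; rewrite !lt_min => /and3P[ud ux u1].
  have [->|u0] := eqVneq u 0; first by rewrite addr0 subrr mulr0 subr0 normr0 mulr0.
  have := hd u; rewrite /ball/= sub0r normrN => /(_ ud u0).
  move: ux u1; rewrite !ltr_norml => /andP[ux1 ux2] /andP[u11 u12].
  rewrite !GE; [|lra..].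
  rewrite -[X in X *: _]/(u^-1) => h.
  have -> : phi (x + u) - phi x - g x * u = - (g x - u^-1 *: (phi (u + x) - phi 0 - (phi x - phi 0))) * u.
    by rewrite /GRing.scale/= (addrC u); field.
  by rewrite normrM normrN ler_wpM2r// ltW// ltr_norml.
exists x; exists (g x) => //.
rewrite lt_neqAle eq_sym gx0 /= leNgt; apply/negP => gn.
(* A negative slope would make [phi] decrease just to the right of [x]. *)
have e0 : 0 < - g x / 2 by rewrite divr_gt0// oppr_gt0.
have [d d0 hd] := der _ e0.
have d20 : 0 < d / 2 by rewrite divr_gt0.
have := hd (d / 2); rewrite (gtr0_norm d20) => /(_ _) /(le_trans (ler_norm _)) => h.
have {}h : phi (x + d / 2) - phi x - g x * (d / 2) <= - g x / 2 * (d / 2) by apply: h; lra.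
have : phi x < phi (x + d / 2) by rewrite (incr_homeo_lt H); lra.
have : 0 < (- g x) * (d / 2) by rewrite mulr_gt0// oppr_gt0.
lra.
Qed.
End HomeoMeasure.

(** * Circle maps conjugating two actions, and Moebius conjugacy *)

Section Rigidity.
Context {R : realType}.
Implicit Types (phi psi : R -> R) (u v w : 'cV[R]_2).

Lemma plift_par phi u v : u != 0 -> v != 0 -> det2 u v = 0 -> plift phi u = plift phi v.
Proof.
move=> u0 v0 /(det2_par u0)[c vE]; rewrite vE pliftZ//.
by apply: contraNneq v0 => c0; rewrite vE c0 scale0r.
Qed.

Lemma plift_id u : u != 0 -> det2 (plift id u) u = 0.
Proof.
rewrite /plift {1}(v2P u) v2_eq0; case: (eqVneq (u 1 0) 0) => u1.
  by move=> _; rewrite /det2 v2E0 v2E1 u1; ring.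
by move=> _; rewrite /det2 v2E0 v2E1 divfK// mul1r subrr.
Qed.

Lemma pliftK phi psi u : incr_homeo phi psi -> u != 0 ->
  det2 (plift phi (plift psi u)) u = 0.
Proof.
move=> [_ _ k] u0; rewrite -plift_comp (_ : phi \o psi = id) ?plift_id//.
exact/funext.
Qed.

Lemma plift_conj phi1 psi1 phi2 w : incr_homeo phi1 psi1 ->
  plift (phi2 \o psi1) (plift phi1 w) = plift phi2 w.
Proof.
by move=> [_ k _]; rewrite -plift_comp; congr plift; apply/funext => x /=; rewrite k.
Qed.

Lemma unit_vec_neq0 (M : 'M[R]_2) u : \det M = 1 -> u != 0 -> M *m u != 0.
Proof. by move=> M1; apply: mulmx_neq0; rewrite M1 oner_neq0. Qed.

Lemma conj_equivariant (m M1 M2 : 'M[R]_2) phi1 psi1 phi2 : incr_homeo phi1 psi1 ->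
  \det m = 1 -> \det M1 = 1 -> \det M2 = 1 ->
  circle_equivariant m M1 phi1 -> circle_equivariant m M2 phi2 ->
  circle_equivariant M1 M2 (phi2 \o psi1).
Proof.
move=> H dm d1 d2 e1 e2 w w0.
pose w' := plift psi1 w.
have w'0 : w' != 0 by exact: plift_neq0.
have ww' : det2 w (plift phi1 w') = 0 by rewrite det2C (pliftK H w0) oppr0.
have M1w : det2 (M1 *m w) (plift phi1 (m *m w')) = 0.
  apply: (@det2_trans _ _ (M1 *m plift phi1 w')).
  - by rewrite unit_vec_neq0 ?plift_neq0.
  - by rewrite det2_mulmx ww' mulr0.
  - exact: e1.
rewrite (plift_par _ (unit_vec_neq0 d1 w0) (plift_neq0 _ _) M1w) (plift_conj _ _ H).
by rewrite plift_comp; exact: e2.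
Qed.

(* Both circle maps blow up to affine maps along the same sequence, and the derivative compares
   the two scales, so that in the limit the conjugacy is projective. *)
Lemma smooth_conjugacy_mobius (m M1 M2 : nat -> 'M[R]_2) U phi1 psi1 phi2 psi2 a b (x mm : R) :
  ProperFilter U -> incr_homeo phi1 psi1 -> incr_homeo phi2 psi2 ->
  (forall k, \det (m k) = 1) -> (forall k, \det (M1 k) = 1) -> (forall k, \det (M2 k) = 1) ->
  (forall k, circle_equivariant (m k) (M1 k) phi1) ->
  (forall k, circle_equivariant (m k) (M2 k) phi2) ->
  conical U m (v2 (psi1 x) 1) a b -> 0 < mm ->
  (forall e : R, 0 < e -> exists2 d : R, 0 < d & forall u : R, `|u| < d ->
     `|phi2 (psi1 (x + u)) - phi2 (psi1 x) - mm * u| <= e * `|u|) ->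
  exists2 P : 'M[R]_2, P \in unitmx &
    forall w, w != 0 -> det2 (P *m plift phi1 w) (plift phi2 w) = 0.
Proof.
move=> PU H1 H2 dm d1 d2 e1 e2 con mm0 der.
have FU : Filter U by apply: PU.
have [h1 [dh1 h1b [rho [delta [eps [crho cdel ceps nearU]]]]]] := blowup PU H1 dm d1 e1 con.
have [h2 [dh2 h2b [rho' [delta' [eps' [crho' cdel' ceps' nearU']]]]]] := blowup PU H2 dm d2 e2 con.
have u1 : h1 \in unitmx by rewrite unitmxE unitfE lt0r_neq0.
have u2 : h2 \in unitmx by rewrite unitmxE unitfE lt0r_neq0.
have phix : phi1 (psi1 x) = x by case: H1.
rewrite phix in nearU.
pose F := phi2 \o psi1.
have HF : incr_homeo F (phi1 \o psi2) by exact: incr_homeo_comp H2 (incr_homeo_sym H1).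
pose ur r := invmx h1 *m v2 r 1.
have h1ur r : h1 *m ur r = v2 r 1 by rewrite /ur mulKVmx.
have ur0 r : ur r != 0.
  by apply: contraTneq (v2x1_neq0 r) => e; rewrite -h1ur e mulmx0 eqxx.
(* [y] is the conjugacy [F] read in the coordinate [h1] at the source and [h2] at the target. *)
pose y r := h2 *m plift F (ur r).
have cy r : dirto U (fun k => h2 *m (M2 k *m v2 (F (x + rho k * r)) 1)) (y r).
  apply: dirto_mulmx.
  have c1 : dirto U (fun k => M1 k *m v2 (x + rho k * r) 1) (ur r).
    have : dirto U (fun k => v2 (r + delta k) (1 + eps k * r)) (v2 r 1).
      exists (fun=> 1); first by apply: filterE => k; exact: oner_neq0.
      split; under eq_cvg do rewrite mul1r ?v2E0 ?v2E1; rewrite ?v2E0 ?v2E1.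
        have : r + delta k @[k --> U] --> r + 0 by apply: cvgD => //; exact: cvg_cst.
        by rewrite addr0.
      have : 1 + eps k * r @[k --> U] --> 1 + 0 * r.
        by apply: cvgD; [exact: cvg_cst|apply: cvgM => //; exact: cvg_cst].
      by rewrite mul0r addr0.
    move=> /(dirto_mulmx FU (invmx h1)) [c c0 [l0 l1]].
    (* The scalar exists only eventually along [U]; elsewhere it takes the default value 0. *)
    have /choice[s hs] : forall k, exists s, (0 < rho k /\ exists2 s : R, s != 0 &
        forall r, h1 *m (M1 k *m v2 (x + rho k * r) 1) = s *: v2 (r + delta k) (1 + eps k * r)) ->
        s != 0 /\ h1 *m (M1 k *m v2 (x + rho k * r) 1) = s *: v2 (r + delta k) (1 + eps k * r).
      move=> k; case: (pselect (exists2 s : R, s != 0 &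
        forall r, h1 *m (M1 k *m v2 (x + rho k * r) 1) = s *: v2 (r + delta k) (1 + eps k * r))).
        by move=> [s s0 hs]; exists s.
      by move=> no; exists 0 => -[_].
    exists (fun k => c k / s k).
      by apply: (filterS2 _ _ c0 nearU) => k ck /hs[s0 _]; rewrite mulf_neq0// invr_eq0.
    have E i k : (0 < rho k /\ exists2 s : R, s != 0 &
        forall r, h1 *m (M1 k *m v2 (x + rho k * r) 1) = s *: v2 (r + delta k) (1 + eps k * r)) ->
        c k * (invmx h1 *m v2 (r + delta k) (1 + eps k * r)) i 0
        = c k / s k * (M1 k *m v2 (x + rho k * r) 1) i 0.
      move=> /hs[s0 hk]; have -> : M1 k *m v2 (x + rho k * r) 1 =
          s k *: (invmx h1 *m v2 (r + delta k) (1 + eps k * r)).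
        by rewrite scalemxAr -hk mulKmx.
      by rewrite [in RHS]mxE mulrA divfK.
    by split; [move: l0|move: l1]; apply: cvg_trans; apply: near_eq_cvg;
      apply: (filterS _ nearU) => k /E ->.
  have := plift_dirto FU HF (ur0 r) c1; apply: dirto_par => // k.
  - exact: plift_neq0.
  - by rewrite unit_vec_neq0// v2x1_neq0.
  - rewrite det2C -(plift_v2 F) (conj_equivariant H1 (dm k) (d1 k) (d2 k)) ?oppr0//.
    exact: v2x1_neq0.
(* [b] lies at infinity in both coordinates and [F] is injective, so finite points stay finite. *)
have yb r : det2 (y r) (v2 1 0) != 0.
  have pb0 : plift phi2 b != 0 by exact: plift_neq0.
  apply: contraTneq (oner_neq0 R) => e.
  have : det2 (y r) (h2 *m plift phi2 b) = 0.
    apply: (det2_trans _ e); first by rewrite v2_eq0 oner_eq0.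
    by rewrite det2C h2b oppr0.
  rewrite det2_mulmx => /eqP; rewrite mulf_eq0 (gt_eqF dh2) /= -(plift_conj phi2 b H1).
  move=> /eqP /(plift_det2 HF (ur0 r) (plift_neq0 _ _)) e'.
  have : det2 (h1 *m ur r) (h1 *m plift phi1 b) = 0 by rewrite det2_mulmx e' mulr0.
  rewrite h1ur => e''.
  have := det2_trans (mulmx_neq0 (lt0r_neq0 dh1) (plift_neq0 phi1 b)) e'' h1b.
  by rewrite det2_v2 => e3; rewrite negbK; apply/eqP; lra.
have y1 r : y r 1 0 != 0.
  by apply: contraNneq (yb r) => e; rewrite /det2 v2E0 v2E1 e; apply/eqP; ring.
pose f r := y r 0 0 / y r 1 0.
(* The increment of [F] measured at the scale of the second action; it converges to the affine
   coordinate [f r] because the second blow-up is also nearly the identity. *)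
pose r' r k := (F (x + rho k * r) - F x) / rho' k.
have cr' r : r' r k @[k --> U] --> f r.
  have [n0 cq] := dirto_ratio1 FU (y1 r) (cy r).
  set q := (X in X @ _ --> _) in cq.
  have : (q k - delta' k) / (1 - eps' k * q k) @[k --> U] --> (f r - 0) / (1 - 0 * f r).
    apply: cvgM; first exact: cvgB.
    apply: cvgV; first by rewrite mul0r subr0 oner_neq0.
    by apply: cvgB; [exact: cvg_cst|exact: cvgM].
  rewrite mul0r !subr0 divr1; apply: cvg_trans; apply: near_eq_cvg.
  have ceq : eps' k * q k @[k --> U] --> 0 * f r by apply: cvgM.
  rewrite mul0r in ceq.
  have ned : eps' k * delta' k @[k --> U] --> (0 * 0 : R) by apply: cvgM.
  rewrite mul0r in ned.
  have n1 := cvg0_norm_lt FU ltr01 ceq.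
  have n2 := cvg0_norm_lt FU ltr01 ned.
  have n12 := @filterI _ U FU _ _ n1 n2.
  apply: (filterS3 _ _ n0 nearU' n12) => k n0k [r'0 [s s0 hs]] [q1 ed1].
  have q10 : 1 - eps' k * q k != 0.
    by apply: contraTneq q1 => /eqP; rewrite subr_eq0 => /eqP <-; rewrite normr1 ltxx.
  have Fr : F (x + rho k * r) = phi2 (psi1 x) + rho' k * r' r k.
    by rewrite /r' [rho' k * _]mulrC divfK ?lt0r_neq0// [RHS]addrC -[phi2 (psi1 x)]/(F x) subrK.
  have := hs (r' r k); rewrite -Fr => hk.
  apply: (mulIf q10); rewrite divfK//.
  have n3 : 1 + eps' k * r' r k != 0.
    by move: n0k; rewrite hk scale_v2 v2E1 mulf_eq0 negb_or => /andP[].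
  have qE : q k = (r' r k + delta' k) / (1 + eps' k * r' r k).
    by rewrite /q hk scale_v2 v2E0 v2E1 -mulf_div divff// mul1r.
  by rewrite qE; field.
(* The same increment measured at the first scale and divided by the derivative [mm];
   differentiability makes it converge to [r]. *)
pose eta r k := (F (x + rho k * r) - F x) / (mm * rho k).
have ceta r : eta r k @[k --> U] --> r.
  apply/cvgrPdist_le => e e0.
  have e'0 : 0 < e * mm / (`|r| + 1) by rewrite divr_gt0 ?mulr_gt0// ltr_wpDl.
  have [d d0 hd] := der _ e'0.
  have d'0 : 0 < d / (`|r| + 1) by rewrite divr_gt0// ltr_wpDl.
  have n1 := cvg0_norm_lt FU d'0 crho.
  apply: (filterS2 _ _ nearU n1) => k [r0 _] rd.
  have r1 : 0 < `|r| + 1 by rewrite ltr_wpDl.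
  have := hd (rho k * r); rewrite normrM.
  have -> : `|rho k| * `|r| < d.
    move: rd; rewrite ltr_pdivlMr//; apply: le_lt_trans.
    by rewrite ler_wpM2l// lerDl.
  move=> /(_ isT); rewrite -/(F (x + rho k * r)) -/(F x) => h.
  have -> : r - eta r k = - (F (x + rho k * r) - F x - mm * (rho k * r)) / (mm * rho k).
    by rewrite /eta; field; rewrite !lt0r_neq0.
  rewrite mulNr normrN normrM normfV (gtr0_norm (mulr_gt0 mm0 r0)).
  rewrite ler_pdivrMr ?mulr_gt0//; apply: le_trans h _.
  rewrite (gtr0_norm r0).
  have -> : e * mm / (`|r| + 1) * (rho k * `|r|) = e * (mm * rho k) * (`|r| / (`|r| + 1)).
    by field; rewrite lt0r_neq0.
  rewrite -[leRHS]mulr1 ler_wpM2l//; first by rewrite !mulr_ge0// ltW.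
  by rewrite ler_pdivrMr// mul1r lerDl.
(* The two scales are not compared directly: both [r' r k / r' 1 k] and [eta r k / eta 1 k] are the
   same quotient of increments, so [f r / f 1] can only be [r]. *)
have fE r : f r = f 1 * r.
  have : r' 1 k / eta 1 k * eta r k @[k --> U] --> f 1 / 1 * r.
    by apply: cvgM => //; apply: cvgM => //; apply: cvgV.
  rewrite divr1 => c1.
  have c2 : r' 1 k / eta 1 k * eta r k @[k --> U] --> f r.
    move: (cr' r); apply: cvg_trans; apply: near_eq_cvg.
    have n1 := cvg_neq0 FU (oner_neq0 R) (ceta 1).
    apply: (filterS3 _ _ n1 nearU nearU') => k e10 [r0 _] [r'0 _].
    move: e10; rewrite /eta mulf_eq0 negb_or => /andP[F0 _].
    have rn := lt0r_neq0 r0; have rn' := lt0r_neq0 r'0; have mn := lt0r_neq0 mm0.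
    by rewrite /r' /eta; field; rewrite ?F0 ?rn ?rn' ?mn.
  exact: (cvg_unique _ c2 c1).
pose c := f 1.
have yE r : det2 (v2 (c * r) 1) (y r) = 0.
  by rewrite /det2 v2E0 v2E1 /c -fE /f divfK// mul1r subrr.
have c0 : c != 0.
  apply/eqP => c0.
  have e01 : det2 (y 0) (y 1) = 0.
    apply: (@det2_trans _ _ (v2 0 1)); first exact: v2x1_neq0.
      by have := yE 0; rewrite mulr0 det2C => /eqP; rewrite oppr_eq0 => /eqP.
    by have := yE 1; rewrite c0 mul0r.
  move: e01; rewrite det2_mulmx => /eqP; rewrite mulf_eq0 (gt_eqF dh2) /= => /eqP.
  move=> /(plift_det2 HF (ur0 0) (ur0 1)) e.
  have : det2 (h1 *m ur 0) (h1 *m ur 1) = 0 by rewrite det2_mulmx e mulr0.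
  by rewrite !h1ur det2_v2; lra.
pose Dc : 'M[R]_2 := \matrix_(i, j) (if i == j then (if i == 0 then c else 1) else 0).
have DcE p q : Dc *m v2 p q = v2 (c * p) q.
  by rewrite mulmx_v2 !mxE /=; congr v2; ring.
have dDc : \det Dc != 0 by rewrite det22 !mxE /= mulr0 subr0 mulr1.
have uDc : Dc \in unitmx by rewrite unitmxE unitfE.
exists (invmx h2 *m Dc *m h1).
  by rewrite !unitmx_mul unitmx_inv u1 u2 uDc.
move=> w w0; rewrite -(plift_conj phi2 w H1) -/F.
set u := plift phi1 w; have un0 : u != 0 by exact: plift_neq0.
suff : det2 (h2 *m (invmx h2 *m Dc *m h1 *m u)) (h2 *m plift F u) = 0.
  by rewrite det2_mulmx => /eqP; rewrite mulf_eq0 (gt_eqF dh2) => /eqP.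
rewrite !mulmxA mulmxV// mul1mx -mulmxA.
have [q0|q0] := eqVneq ((h1 *m u) 1 0) 0.
  have ub : det2 u (plift phi1 b) = 0.
    have : det2 (h1 *m u) (h1 *m plift phi1 b) = 0.
      apply: (@det2_trans _ _ (v2 1 0)); first by rewrite v2_eq0 oner_eq0.
        by rewrite /det2 v2E0 v2E1 q0; ring.
      by rewrite det2C h1b oppr0.
    by rewrite det2_mulmx => /eqP; rewrite mulf_eq0 (gt_eqF dh1) => /eqP.
  rewrite (plift_par F un0 (plift_neq0 _ _) ub) (plift_conj _ _ H1).
  apply: (@det2_trans _ _ (v2 1 0)); first by rewrite v2_eq0 oner_eq0.
    by rewrite (v2P (h1 *m u)) q0 DcE det2_v2; ring.
  by rewrite det2C h2b oppr0.
pose r := (h1 *m u) 0 0 / (h1 *m u) 1 0.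
have uur : det2 u (ur r) = 0.
  have : det2 (h1 *m u) (h1 *m ur r) = 0.
    by rewrite h1ur /det2 v2E0 v2E1 /r; field.
  by rewrite det2_mulmx => /eqP; rewrite mulf_eq0 (gt_eqF dh1) => /eqP.
rewrite (plift_par F un0 (ur0 r) uur) -/(y r).
apply: det2_trans (yE r); first exact: v2x1_neq0.
by rewrite (v2P (h1 *m u)) DcE det2_v2 /r; field.
Qed.

(** [X] fixes every direction, hence is scalar, as seen on [v2 1 0], [v2 0 1] and [v2 1 1].
    Determinant 1 leaves a sign, which is the ambiguity in [pgl_conjugate]. *)
Lemma mobius_conjugate (G : groupType) (iota s1 s2 : G -> 'M[R]_2) phi1 psi1 phi2 (P : 'M[R]_2) :
  incr_homeo phi1 psi1 -> P \in unitmx ->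
  (forall g, \det (iota g) = 1) -> (forall g, \det (s1 g) = 1) -> (forall g, \det (s2 g) = 1) ->
  (forall g, circle_equivariant (iota g) (s1 g) phi1) ->
  (forall g, circle_equivariant (iota g) (s2 g) phi2) ->
  (forall w, w != 0 -> det2 (P *m plift phi1 w) (plift phi2 w) = 0) ->
  pgl_conjugate s1 s2.
Proof.
move=> H uP di d1 d2 e1 e2 hP; exists P => // g.
have P0 : \det P != 0 by rewrite -unitfE -unitmxE.
have us1 : s1 g \in unitmx by rewrite unitmxE d1 unitr1.
have dP u : u != 0 -> det2 (s2 g *m (P *m u)) (P *m (s1 g *m u)) = 0.
  move=> u0; pose w := plift psi1 u.
  have w0 : w != 0 by exact: plift_neq0.
  have gw0 : iota g *m w != 0 by rewrite unit_vec_neq0.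
  have uw : det2 u (plift phi1 w) = 0 by rewrite det2C (pliftK H u0) oppr0.
  have pp x : plift phi2 x != 0 by exact: plift_neq0.
  have pp1 x : plift phi1 x != 0 by exact: plift_neq0.
  apply: (@det2_trans _ _ (s2 g *m plift phi2 w)); first exact: unit_vec_neq0.
    rewrite det2_mulmx; have -> : det2 (P *m u) (plift phi2 w) = 0; last by rewrite mulr0.
    apply: det2_trans (hP _ w0); first exact: mulmx_neq0.
    by rewrite det2_mulmx uw mulr0.
  apply: (@det2_trans _ _ (plift phi2 (iota g *m w))) => //; first exact: e2.
  apply: (@det2_trans _ _ (P *m plift phi1 (iota g *m w))); first exact: mulmx_neq0.
    by rewrite det2C hP ?oppr0.
  rewrite det2_mulmx; apply/eqP; rewrite mulf_eq0 (negPf P0) /=; apply/eqP.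
  apply: (@det2_trans _ _ (s1 g *m plift phi1 w)); first exact: unit_vec_neq0.
    by rewrite det2C e1 ?oppr0.
  by rewrite det2_mulmx det2C uw oppr0 mulr0.
pose X := invmx (s1 g) *m (invmx P *m s2 g *m P).
have XE u : u != 0 -> det2 (X *m u) u = 0.
  move=> u0.
  have : det2 ((P *m s1 g) *m (X *m u)) ((P *m s1 g) *m u) = 0.
    rewrite -(dP _ u0) /X; congr det2; last by rewrite mulmxA.
    by rewrite !mulmxA -(mulmxA P) mulmxV// mulmx1 mulmxV// mul1mx.
  rewrite det2_mulmx det_mulmx d1 mulr1 => /eqP; rewrite mulf_eq0 (negPf P0) /=.
  by move/eqP.
have X10 : X 1 0 = 0.
  have := XE (v2 1 0); rewrite v2_eq0 oner_eq0 /= => /(_ isT).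
  by rewrite mulmx_v2 !v2E0 !v2E1 det2_v2; lra.
have X01 : X 0 1 = 0.
  have := XE (v2 0 1) (v2x1_neq0 0).
  by rewrite mulmx_v2 !v2E0 !v2E1 det2_v2; lra.
have X11 : X 0 0 = X 1 1.
  have := XE (v2 1 1) (v2x1_neq0 1).
  by rewrite mulmx_v2 !v2E0 !v2E1 det2_v2 X10 X01; lra.
have dX : \det X = 1.
  rewrite /X !det_mulmx !det_inv d1 d2 invr1 mulr1 mul1r mulVf//.
have X1 : X 0 0 = 1 \/ X 0 0 = -1.
  move: dX; rewrite det22 X10 X01 -X11 mulr0 subr0 -expr2 => /eqP.
  by rewrite sqrf_eq1 => /orP[/eqP|/eqP]; [left|right].
have Xs : X = (X 0 0)%:M.
  apply/matrixP => i j; rewrite [RHS]mxE.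
  have i01 : forall l : 'I_2, l = 0 \/ l = 1.
    by case=> [[|[|//]] ?]; [left|right]; apply/val_inj.
  by have [->|->] := i01 i; have [->|->] := i01 j; rewrite ?X10 ?X01 -?X11 //= mulr1n.
have s2E : s2 g = P *m (s1 g *m X) *m invmx P.
  by rewrite /X (mulKVmx us1) !mulmxA mulmxV// mul1mx -mulmxA mulmxV// mulmx1.
rewrite s2E Xs; case: X1 => ->; [left|right].
  by rewrite mulmx1.
by rewrite -scalemx1 scaleN1r mulmxN mulmx1 mulmxN mulNmx.
Qed.

End Rigidity.

(** * Invariant pieces of the circle *)

Section Components.
Context {R : realType}.
Local Notation mu := (@lebesgue_measure R).

Lemma ord2P (l : 'I_2) : l = 0 \/ l = 1.
Proof. by case: l => [[|[|//]] ?]; [left|right]; apply/val_inj. Qed.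

Lemma fdist22_le (A B : 'M[R]_2) d : 0 <= d -> (forall i j, `|A i j - B i j| <= d) ->
  fdist A B <= 2 * d.
Proof.
move=> d0 h; rewrite -(ger0_norm (mulr_ge0 _ d0))// -sqrtr_sqr; apply: ler_wsqrtr.
have q i j : (A i j - B i j) ^+ 2 <= d ^+ 2.
  by rewrite -[leLHS]real_normK ?num_real// ler_sqr ?nnegrE.
rewrite !big_ord_recl !big_ord0 !addr0 exprMn.
have := q ord0 ord0; have := q ord0 (lift ord0 ord0).
have := q (lift ord0 ord0) ord0; have := q (lift ord0 ord0) (lift ord0 ord0).
lra.
Qed.

(** Discreteness is given only at the identity, so two elements are compared through [g * h^-1]. The
    code of [g] is a bound on the entries of its inverse together with its own entries rounded on a
    grid fine enough for that bound. *)
Lemma fuchsian_countable (G : groupType) (r : G -> 'M[R]_2) : fuchsian_SL2 r ->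
  exists e : nat -> G, forall g, exists k, e k = g.
Proof.
move=> [dr hr _ [e e0 he]].
suff [f finj] : exists f : G -> nat, injective f.
  have /choice[s hs] k : exists g : G, forall g', f g' = k -> g = g'.
    have [[g <-]|no] := pselect (exists g, f g = k).
      by exists g => g' /finj.
    by exists 1%g => g' fg; case: no; exists g'.
  by exists s => g; exists (f g); exact: hs.
(* With grid step [(M K)^-1] the entries of [r (g * h^-1) - 1] are at most [2 * K / M K], and
   [fdist22_le] costs another factor 2: the distance stays below [e / 2]. *)
pose M (K : nat) : R := 8 * (K%:R + 1) / e.
have M0 K : 0 < M K by rewrite divr_gt0// mulr_gt0// ltr_wpDl.
pose K g : nat := maxn (\max_(p : 'I_2 * 'I_2) (Num.truncn `|r g p.1 p.2|).+1)%N
  (\max_(p : 'I_2 * 'I_2) (Num.truncn `|r g^-1%g p.1 p.2|).+1)%N.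
have hK g i j : `|r g^-1%g i j| <= (K g)%:R.
  apply: le_trans (ltW (truncnS_gt _)) _; rewrite ler_nat /K leq_max; apply/orP; right.
  exact: (leq_bigmax (F := fun p : 'I_2 * 'I_2 => (Num.truncn `|r g^-1%g p.1 p.2|).+1) (i, j)).
pose code g := (K g, [ffun p : 'I_2 * 'I_2 => Num.floor (r g p.1 p.2 * M (K g))]).
exists (fun g => pickle (code g)).
move=> g h /(pcan_inj pickleK)[Kgh /ffunP cgh].
have close i j : `|r g i j - r h i j| <= (M (K g))^-1.
  have := cgh (i, j); rewrite !ffunE /= -Kgh => fe.
  have := real_floor_le (num_real (r g i j * M (K g))).
  have := real_floorD1_gt (num_real (r g i j * M (K g))).
  have := real_floor_le (num_real (r h i j * M (K g))).
  have := real_floorD1_gt (num_real (r h i j * M (K g))).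
  rewrite fe !intrD => a b c d.
  have : `|(r g i j - r h i j) * M (K g)| <= 1.
    by rewrite mulrBl ler_norml; apply/andP; split; lra.
  by rewrite normrM (gtr0_norm (M0 _)) -ler_pdivlMr// div1r.
apply: contrapT => /eqP gh.
have g1 : (g * h^-1)%g != 1%g.
  by apply: contra_neq gh => /(congr1 (fun x => x * h)%g); rewrite mulgVK mul1g.
have := he _ g1; rewrite leNgt => /negP; apply.
have r1 : r 1%g = 1%:M.
  have u1 : r 1%g \in unitmx by rewrite unitmxE dr unitr1.
  by have := hr 1%g 1%g; rewrite mulg1 => /(congr1 (mulmx (invmx (r 1%g)))); rewrite mulKmx// mulVmx.
have XE : r (g * h^-1)%g - 1%:M = (r g - r h) *m r h^-1%g.
  by rewrite mulmxBl -!hr mulgV r1.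
have bd i j : `|r (g * h^-1)%g i j - 1%:M i j| <= (M (K g))^-1 * (K g)%:R + (M (K g))^-1 * (K g)%:R.
  have -> : r (g * h^-1)%g i j - 1%:M i j = (r (g * h^-1)%g - 1%:M) i j by rewrite !mxE.
  rewrite XE mulmx22; apply: le_trans (ler_normD _ _) _.
  by rewrite !normrM !mxE Kgh; apply: lerD; apply: ler_pM => //; rewrite -?Kgh.
have Mi : 0 <= (M (K g))^-1 by rewrite invr_ge0 ltW.
apply: le_lt_trans (fdist22_le _ bd) _; first by rewrite addr_ge0// mulr_ge0.
have Kp : 0 < (K g)%:R + 1 :> R by rewrite ltr_wpDl.
have -> : 2 * ((M (K g))^-1 * (K g)%:R + (M (K g))^-1 * (K g)%:R) = e / 2 * ((K g)%:R / ((K g)%:R + 1)).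
  by rewrite /M; field; rewrite ?lt0r_neq0.
apply: (@le_lt_trans _ _ (e / 2)); last lra.
rewrite -[leRHS]mulr1 ler_wpM2l//; first by rewrite ltW// divr_gt0.
by rewrite ler_pdivrMr// mul1r lerDl.
Qed.

End Components.

(** * Saturated sets and mutual singularity *)

Section CircleComponents.
Context {R : realType} (G : groupType) (iota : G -> 'M[R]_2).
Local Notation mu := (@lebesgue_measure R).
Hypothesis surf : closed_surface_group_in_PSL2 iota.
Variable enumG : nat -> G.
Hypothesis enumGP : forall g, exists k, enumG k = g.

Implicit Types (u w : 'cV[R]_2) (g h : G).

Let di g : \det (iota g) = 1. Proof. by case: surf. Qed.

Lemma e1_neq0 : v2 1 0 != 0 :> 'cV[R]_2.
Proof. by rewrite v2_eq0 oner_eq0. Qed.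

Lemma surface_neq0 g u : u != 0 -> iota g *m u != 0.
Proof. by move=> u0; rewrite unit_vec_neq0. Qed.

(** [iota] is multiplicative only up to sign, and the sign disappears in a parallelism relation. *)
Lemma surface_mul g h u w : det2 (iota (g * h)%g *m u) w = 0 <->
  det2 (iota g *m (iota h *m u)) w = 0.
Proof.
case: surf => _ hom _ _ _; rewrite mulmxA; case: (hom g h) => -> //.
rewrite mulNmx; set x := _ *m u.
have -> : det2 (- x) w = - det2 x w by rewrite /det2 !mxE; ring.
by split=> /eqP; rewrite ?oppr_eq0 => /eqP // ->; rewrite oppr0.
Qed.

Lemma surface1 : iota 1%g = 1%:M \/ iota 1%g = - 1%:M.
Proof.
have u1 : iota 1%g \in unitmx by rewrite unitmxE di unitr1.
case: surf => _ hom _ _ _; case: (hom 1%g 1%g); rewrite mulg1.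
  by move=> /(congr1 (mulmx (invmx (iota 1%g)))); rewrite mulKmx// mulVmx// => <-; left.
move=> /(congr1 (mulmx (invmx (iota 1%g)))); rewrite mulmxN mulKmx// mulVmx// => e.
by right; rewrite e opprK.
Qed.

Lemma surface1_par u : det2 (iota 1%g *m u) u = 0.
Proof. by case: surface1 => ->; rewrite ?mulNmx mul1mx /det2 ?mxE; ring. Qed.

Lemma surface_inv g u w : u != 0 -> w != 0 ->
  det2 (iota g *m u) w = 0 <-> det2 (iota g^-1%g *m w) u = 0.
Proof.
have dir h (x y : 'cV[R]_2) : x != 0 -> y != 0 -> det2 (iota h *m x) y = 0 -> det2 (iota h^-1%g *m y) x = 0.
  move=> x0 y0 e.
  have e1 : det2 (iota h^-1%g *m (iota h *m x)) x = 0.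
    by apply/surface_mul; rewrite mulVg surface1_par.
  apply: det2_trans e1; first by rewrite !surface_neq0.
  by rewrite det2_mulmx det2C e oppr0 mulr0.
move=> u0 w0; split; first exact: dir.
by move=> /(dir _ _ _ w0 u0); rewrite invgK.
Qed.

(** The finite points of the orbit of [N]. [N] is a predicate on vectors, so that it may also be the
    point at infinity. *)
Definition saturation (N : 'cV[R]_2 -> Prop) : set R :=
  [set t | exists g, exists w : 'cV[R]_2, [/\ w != 0, N w & det2 (iota g *m v2 t 1) w = 0]].

Lemma saturation_inv N : inv_action iota (saturation N).
Proof.
have dir g s s' : det2 (iota g *m v2 s 1) (v2 s' 1) = 0 -> saturation N s' -> saturation N s.
  move=> e [h [w [w0 Nw hw]]]; exists (h * g)%g, w; split => //.
  apply/surface_mul; apply: det2_trans hw; first by rewrite surface_neq0 ?v2x1_neq0.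
  by rewrite det2_mulmx e mulr0.
move=> g s s' e; split; last exact: dir e.
apply: (dir g^-1%g).
exact: (surface_inv g (v2x1_neq0 s) (v2x1_neq0 s')).1 e.
Qed.

Lemma saturationE N :
  saturation N = \bigcup_k [set t | exists w : 'cV[R]_2, [/\ w != 0, N w & det2 (iota (enumG k) *m v2 t 1) w = 0]].
Proof.
apply/seteqP; split => t /=.
  by move=> [g [w hw]]; have [k kg] := enumGP g; exists k => //; exists w; rewrite kg.
by move=> [k _ [w hw]]; exists (enumG k), w.
Qed.

Definition affine_dir (N : set R) (w : 'cV[R]_2) := exists2 t, N t & w = v2 t 1.

Lemma measurable_saturation_affine N : measurable N -> measurable (saturation (affine_dir N)).
Proof.
move=> mN; rewrite saturationE; apply: bigcupT_measurable => k.
set m := iota (enumG k).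
pose D := [set t : R | m 1 0 * t + m 1 1 != 0].
pose f t := (m 0 0 * t + m 0 1) / (m 1 0 * t + m 1 1).
have cden : continuous (fun t : R => m 1 0 * t + m 1 1).
  by move=> t; apply: cvgD; [apply: cvgM; [exact: cvg_cst|exact: cvg_id]|exact: cvg_cst].
have oD : open D.
  rewrite (_ : D = (fun t : R => m 1 0 * t + m 1 1) @^-1` [set x | x != 0]) //.
  by apply: open_comp => [t _|]; [exact: cden|exact: open_neq].
rewrite (_ : [set t | _] = D `&` f @^-1` N).
  apply: open_continuous_measurable_fun => //; last exact: open_measurable.
  move=> t; rewrite inE => Dt; apply: cvgM; last exact: cvgV (cden t).
  by apply: cvgD; [apply: cvgM; [exact: cvg_cst|exact: cvg_id]|exact: cvg_cst].
apply/seteqP; split=> t /=.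
  move=> [w [w0 [s Ns ->]]]; rewrite mulmx_v2 !v2E0 !v2E1 !mulr1 det2_v2 mulr1 => e.
  have n0 : m 1 0 * t + m 1 1 != 0.
    apply: contraTneq (surface_neq0 (enumG k) (v2x1_neq0 t)) => e'.
    rewrite -/m mulmx_v2 !v2E0 !v2E1 !mulr1 e' v2_eq0 eqxx andbT negbK; apply/eqP.
    by move: e; rewrite e'; lra.
  split => //; rewrite /f; suff -> : (m 0 0 * t + m 0 1) / (m 1 0 * t + m 1 1) = s by [].
  by apply: (mulIf n0); rewrite divfK//; lra.
move=> [Dt Nf]; exists (v2 (f t) 1); split; first exact: v2x1_neq0.
  by exists (f t).
rewrite /D /= in Dt.
by rewrite mulmx_v2 !v2E0 !v2E1 !mulr1 det2_v2 mulr1 /f; field.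
Qed.

Lemma measurable_saturation_e1 : measurable (saturation (eq (v2 1 0))).
Proof.
rewrite saturationE; apply: bigcupT_measurable => k.
set m := iota (enumG k).
have cden : continuous (fun t : R => m 1 0 * t + m 1 1).
  by move=> t; apply: cvgD; [apply: cvgM; [exact: cvg_cst|exact: cvg_id]|exact: cvg_cst].
rewrite (_ : [set t | _] = (fun t : R => m 1 0 * t + m 1 1) @^-1` [set 0]).
  rewrite -[X in measurable X]setTI.
  by apply: continuous_measurable_fun => //; exact: measurable_set1.
apply/seteqP; split=> t /=.
  by move=> [w [_ <-]]; rewrite mulmx_v2 !v2E0 !v2E1 det2_v2; lra.
move=> e; exists (v2 1 0); split => //; first exact: e1_neq0.
by rewrite mulmx_v2 !v2E0 !v2E1 !mulr1 det2_v2 e; ring.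
Qed.

Lemma inv_action_homeo (sigma : G -> 'M[R]_2) phi psi B : incr_homeo phi psi ->
  (forall g, \det (sigma g) = 1) ->
  (forall g, circle_equivariant (iota g) (sigma g) phi) ->
  inv_action iota B -> inv_action sigma (psi @^-1` B).
Proof.
move=> H ds eqv iB g s s' e; apply: (iB g).
have [_ _ k2] := H.
apply: (plift_det2 H); rewrite ?surface_neq0 ?v2x1_neq0//.
rewrite plift_v2 k2; apply: det2_trans e.
  by rewrite unit_vec_neq0 ?v2x1_neq0.
by rewrite det2C -{1}(k2 s) -plift_v2 eqv ?oppr0// v2x1_neq0.
Qed.

(** In the coordinate [phi], the saturation is a countable union of preimages, under the Moebius
    maps [sigma g], of a null set. *)
Lemma saturation_null (sigma : G -> 'M[R]_2) phi psi N : incr_homeo phi psi ->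
  (forall g, \det (sigma g) = 1) ->
  (forall g, circle_equivariant (iota g) (sigma g) phi) ->
  mu (psi @^-1` N) = 0%E -> mu (psi @^-1` saturation (affine_dir N)) = 0%E.
Proof.
move=> H ds eqv N0; rewrite saturationE preimage_bigcup; apply: lebesgue_bigcup0 => k.
set s := sigma (enumG k); have [_ k1 k2] := H.
have ds0 : s 0 0 * s 1 1 - s 0 1 * s 1 0 != 0 by rewrite -det22 ds oner_neq0.
apply: lebesgue_null_sub (lebesgue_mobius_null ds0 N0) => z [w [w0 [t Nt ->]] e].
have : det2 (s *m v2 z 1) (v2 (phi t) 1) = 0.
  rewrite -(plift_v2 phi t) -{1}(k2 z) -plift_v2.
  apply: det2_trans (eqv _ _ (v2x1_neq0 _)) _; first exact: plift_neq0.
  rewrite (plift_par phi _ _ e) ?surface_neq0 ?v2x1_neq0//.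
  by rewrite /det2; ring.
rewrite mulmx_v2 !v2E0 !v2E1 !mulr1 det2_v2 mulr1 => e'.
exists (phi t); first by rewrite /= k1.
split; last by lra.
apply: contraTneq (unit_vec_neq0 (ds (enumG k)) (v2x1_neq0 z)) => e0.
rewrite -/s mulmx_v2 !v2E0 !v2E1 !mulr1 e0 v2_eq0 eqxx andbT negbK; apply/eqP.
by move: e'; rewrite e0; lra.
Qed.

Lemma saturation_e1_null (sigma : G -> 'M[R]_2) phi psi : incr_homeo phi psi ->
  (forall g, \det (sigma g) = 1) ->
  (forall g, circle_equivariant (iota g) (sigma g) phi) ->
  mu (psi @^-1` saturation (eq (v2 1 0))) = 0%E.
Proof.
move=> H ds eqv; rewrite saturationE preimage_bigcup; apply: lebesgue_bigcup0 => k.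
set s := sigma (enumG k); have [_ k1 k2] := H.
have ds0 : \det s != 0 by rewrite ds oner_neq0.
apply: lebesgue_null_sub (line_null ds0) => z [w [w0 <- e]].
have : det2 (s *m v2 z 1) (v2 1 0) = 0.
  rewrite -{1}(k2 z) -plift_v2.
  apply: det2_trans (eqv _ _ (v2x1_neq0 _)) _; first exact: plift_neq0.
  rewrite (plift_par phi _ _ e) ?surface_neq0 ?v2x1_neq0 ?e1_neq0// plift_e1.
  by rewrite /det2; ring.
by rewrite mulmx_v2 !v2E0 !v2E1 !mulr1 det2_v2 /=; lra.
Qed.

Lemma surface_conical t : exists g : nat -> G, exists2 U : set_system nat, ProperFilter U &
  exists a b, conical U (fun k => iota (g k)) (v2 t 1) a b.
Proof. exact: conical_exists surf (v2x1_neq0 t). Qed.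

Lemma circle_components (n : nat) (sigma : 'I_n -> G -> 'M[R]_2) (phi psi : 'I_n -> R -> R) :
  (forall i, incr_homeo (phi i) (psi i)) ->
  (forall i g, \det (sigma i g) = 1) ->
  (forall i g, circle_equivariant (iota g) (sigma i g) (phi i)) ->
  (forall i j, i != j -> ~ pgl_conjugate (sigma i) (sigma j)) ->
  exists T : 'I_n -> set R, [/\ (forall i, measurable (T i) /\ inv_action iota (T i)),
    (forall i, T i `<=` ~` saturation (eq (v2 1 0))),
    (forall i j, i != j -> T i `&` T j = set0) &
    (forall i, mu (psi i @^-1` ~` T i) = 0%E /\
      forall j, i != j -> mu (psi j @^-1` T i) = 0%E)].
Proof.
move=> H ds eqv nconj.
have H' i := incr_homeo_sym (H i).
have mpsi i A : measurable A -> measurable (psi i @^-1` A).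
  exact: measurable_homeo_preimage.
(* If every [i]-null measurable set were [j]-null, [phi j \o psi i] would be absolutely continuous,
   have a nonzero derivative somewhere, and so make the two representations conjugate. *)
have sing i j : i != j -> exists N : set R, [/\ measurable N,
    mu (psi i @^-1` N) = 0%E & mu (psi j @^-1` N) != 0%E].
  move=> ij; apply: contrapT => /forallNP no; apply: (nconj _ _ ij).
  have [] := @homeo_derivative R (phi j \o psi i) (phi i \o psi j) _ _.
  - exact: incr_homeo_comp (H j) (H' i).
  - move=> N mN N0; apply/eqP; apply: contrapT => /negP nN.
    apply: (no (phi i @^-1` N)); split=> //.
      exact: measurable_homeo_preimage (H i) mN.
    rewrite -comp_preimage (_ : phi i \o psi i = id) ?preimage_id//.
    by apply/funext => x /=; case: (H i).
  - move=> x [m m0 der].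
    have [g [U PU [a [b cab]]]] := surface_conical (psi i x).
    have [P uP hP] := smooth_conjugacy_mobius PU (H i) (H j) (fun k => di (g k))
      (fun k => ds i (g k)) (fun k => ds j (g k)) (fun k => eqv i (g k)) (fun k => eqv j (g k))
      cab m0 der.
    exact: mobius_conjugate (H i) uP di (ds i) (ds j) (eqv i) (eqv j) hP.
(* [S (i, j)] is null for [i], and conull for [j] by ergodicity since it contains a set that is not
   [j]-null. On the diagonal it takes the default value [set0]. *)
have /choice[S hS] : forall p : 'I_n * 'I_n, exists S : set R, p.1 != p.2 ->
    [/\ measurable S, inv_action iota S, mu (psi p.1 @^-1` S) = 0%E &
        mu (psi p.2 @^-1` ~` S) = 0%E].
  move=> [i j] /=; have [->|ij] := eqVneq i j; first by exists set0.
  have [N [mN N0 N1]] := sing _ _ ij.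
  exists (saturation (affine_dir N)) => _.
  have mS := measurable_saturation_affine mN.
  have iS := @saturation_inv (affine_dir N).
  split => //; first exact: saturation_null (H i) (ds i) (eqv i) N0.
  have [e|//] := ergodic_action (H j) di (ds j) (eqv j) surface_conical (mpsi j _ mS)
    (inv_action_homeo (H j) (ds j) (eqv j) iS).
  case/eqP: N1; apply: lebesgue_null_sub e => z Nz.
  by exists 1%g, (v2 (psi j z) 1); split; [exact: v2x1_neq0|exists (psi j z)|exact: surface1_par].
pose O := saturation (eq (v2 1 0)).
(* Removing [S (i, j)] makes the pieces disjoint outright and not only up to null sets. Removing the
   orbit [O] of infinity keeps every orbit in [T i] within the affine line. *)
pose T i := ~` O `&` \bigcap_(j in [set j | j != i]) (S (j, i) `&` ~` S (i, j)).
have hSji i j : j != i -> [/\ measurable (S (j, i)), inv_action iota (S (j, i)),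
    mu (psi j @^-1` S (j, i)) = 0%E & mu (psi i @^-1` ~` S (j, i)) = 0%E].
  by move=> ji; exact: (hS (j, i)).
exists T; split.
- move=> i; split.
    apply: measurableI; first by apply: measurableC; exact: measurable_saturation_e1.
    apply: fin_bigcap_measurable => [|j ji]; first exact: finite_finset.
    have [m1 _ _ _] := hSji _ _ ji; rewrite /= eq_sym in ji; have [m2 _ _ _] := hSji _ _ ji.
    by apply: measurableI => //; exact: measurableC.
  move=> g s s' e; have iO := @saturation_inv (eq (v2 1 0)) _ _ _ e.
  split=> -[nO h]; (split; first by move=> /iO) => j ji; have [h1 h2] := h _ ji;
    have [_ i1 _ _] := hSji _ _ ji; rewrite /= eq_sym in ji; have [_ i2 _ _] := hSji _ _ ji;
    have iS1 := i1 _ _ _ e; have iS2 := i2 _ _ _ e; by split; [apply/iS1|move=> /iS2].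
- by move=> i t [].
- move=> i j ij; rewrite -subset0 => t [[_ hi] [_ hj]].
  have [_ h1] := hj _ ij; rewrite eq_sym in ij; have [h2 _] := hi _ ij.
  exact: h1.
- move=> i; split; last first.
    move=> j ij; have ji := ij; rewrite eq_sym in ji; have [_ _ h _] := hSji _ _ ji.
    by apply: lebesgue_null_sub h => z [_ /(_ _ ji)[]].
  (* The finite union over [j] is indexed by the naturals, with [set0] outside the range, to fit
     countable subadditivity. *)
  have sub : (psi i @^-1` (~` T i)) `<=` (psi i @^-1` O) `|`
      \bigcup_k (psi i @^-1` (if insub k is Some j then
         if j != i then ~` S (j, i) `|` S (i, j) else set0 else set0)).
    move=> z /= nT; apply: contrapT => no; apply: nT; split.
      by move=> Oz; apply: no; left.
    move=> j ji; split; apply: contrapT => h; apply: no; right; exists (val j) => //=;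
      rewrite valK; (have -> : j != i by exact: ji); [by left|right].
    exact: contrapT.
  apply: lebesgue_null_sub sub (lebesgue_setU0 _ _).
    exact: saturation_e1_null (H i) (ds i) (eqv i).
  apply: lebesgue_bigcup0 => k; case: insub => [j|]; last by rewrite preimage_set0 measure0.
  case: ifP => ji; last by rewrite preimage_set0 measure0.
  rewrite preimage_setU; apply: lebesgue_setU0; first by have [] := hSji _ _ ji.
  by rewrite eq_sym in ji; have [] := hSji _ _ ji.
Qed.

End CircleComponents.

(** * Hausdorff measure of curves *)

Section SumHomeo.
Context {R : realType}.
Local Notation mu := (@lebesgue_measure R).
Implicit Types phi psi : R -> R.

Lemma incr_homeo_of_surj phi : {mono phi : x y / x <= y} -> (forall y, exists x, phi x = y) ->
  exists psi, incr_homeo phi psi.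
Proof.
move=> m /choice[psi k]; exists psi; split=> // x.
by apply: (inc_inj m); rewrite k.
Qed.

(** In the parameter [phi1 \+ phi2], the Stieltjes measures of the two coordinates add up to
    Lebesgue measure: on an interval their sum is its length, and uniqueness does the rest. *)
Lemma add_homeo phi1 psi1 phi2 psi2 : incr_homeo phi1 psi1 -> incr_homeo phi2 psi2 ->
  exists2 psi, incr_homeo (phi1 \+ phi2) psi & forall B : set R, measurable B ->
    mu (psi1 @^-1` B) = 0%E -> mu (psi2 @^-1` B) = 0%E -> mu (psi @^-1` B) = 0%E.
Proof.
move=> H1 H2; have [m1 k1 k1'] := H1; have [m2 k2 k2'] := H2.
have lt12 : {homo phi1 \+ phi2 : x y / x < y}.
  by move=> x y xy /=; apply: ltrD; rewrite ?(incr_homeo_lt H1) ?(incr_homeo_lt H2).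
have [psi H] : exists psi, incr_homeo (phi1 \+ phi2) psi.
  apply: incr_homeo_of_surj => [|y]; first exact: le_mono.
  (* The sum is at most [y] at the smaller of these points and at least [y] at the larger. *)
  pose a := psi1 (y / 2); pose b := psi2 (y / 2).
  have y2 : y = y / 2 + y / 2 by lra.
  have ca : phi1 a = y / 2 by rewrite k1'.
  have cb : phi2 b = y / 2 by rewrite k2'.
  have [|||x _ xE] := @IVT R (phi1 \+ phi2) (Num.min a b) (Num.max a b) y.
  - by rewrite ge_min le_max lexx.
  - apply: continuous_subspaceT => x; apply: cvgD.
      exact: incr_homeo_continuous H1 x.
    exact: incr_homeo_continuous H2 x.
  - have lo : (phi1 \+ phi2) (Num.min a b) <= y.
      rewrite [leRHS]y2 -{1}ca -cb /=; apply: lerD; rewrite ?m1 ?m2 ge_min lexx ?orbT//.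
    have hi : y <= (phi1 \+ phi2) (Num.max a b).
      rewrite [leLHS]y2 -{1}ca -cb /=; apply: lerD; rewrite ?m1 ?m2 le_max lexx ?orbT//.
    by rewrite ge_min le_max lo hi orbT.
  by exists x.
exists psi => // B mB B1 B2.
have H' := incr_homeo_sym H.
pose HA := incr_homeo_comp H1 H'; pose HB := incr_homeo_comp H2 H'.
have [mm k k'] := H.
have preE phi' psi' (H0 : incr_homeo phi' psi') :
    homeo_measure (incr_homeo_comp H0 H') (psi @^-1` B) = mu (psi' @^-1` B).
  rewrite /homeo_measure -comp_preimage (_ : psi \o _ = psi')//.
  by apply/funext => x; exact: k.
have eA : homeo_measure HA (psi @^-1` B) = mu (psi1 @^-1` B) := preE _ _ H1.
have eB : homeo_measure HB (psi @^-1` B) = mu (psi2 @^-1` B) := preE _ _ H2.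
transitivity (measure_add (homeo_measure HA) (homeo_measure HB) (psi @^-1` B)); last first.
  by rewrite measure_addE /= eA eB B1 B2 adde0.
apply: lebesgue_measure_unique; last exact: measurable_homeo_preimage H' mB.
move=> _ [[a b] _ <-].
transitivity (measure_add (homeo_measure HA) (homeo_measure HB) `]a, b]%classic); last by [].
rewrite measure_addE /= /homeo_measure (homeo_preimage_itv _ _ HA).2.1 (homeo_preimage_itv _ _ HB).2.1.
rewrite !lebesgue_measure_itv/= !lte_fin (incr_homeo_lt H1) (incr_homeo_lt H2) !(incr_homeo_lt H').
case: ifP => _; last by rewrite adde0.
rewrite -!EFinD; congr EFin.
by have := k' a; have := k' b => /= <- <-; rewrite !k; ring.
Qed.

(* The Lebesgue measure of [Psi @^-1` B] is the sum of those of the [psi i @^-1` B]. *)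
Lemma sum_homeo (n : nat) (phi psi : 'I_n.+1 -> R -> R) : (forall i, incr_homeo (phi i) (psi i)) ->
  exists2 Psi, incr_homeo (fun t => \sum_i phi i t) Psi & forall B : set R, measurable B ->
    (forall i, mu (psi i @^-1` B) = 0%E) -> mu (Psi @^-1` B) = 0%E.
Proof.
elim: n phi psi => [|n IH] phi psi H.
  exists (psi ord0); last by move=> B _; exact.
  by rewrite (_ : (fun t => _) = phi ord0)//; apply/funext => t; rewrite big_ord1.
have [Psi1 H1 h1] := IH (fun i => phi (widen_ord (leqnSn _) i)) (fun i => psi (widen_ord (leqnSn _) i))
  (fun i => H _).
have [Psi H2 h2] := add_homeo H1 (H ord_max).
exists Psi; last by move=> B mB B0; apply: h2 => //; exact: h1.
rewrite (_ : (fun t => _) = (fun t => \sum_i phi (widen_ord (leqnSn _) i) t) \+ phi ord_max)//.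
by apply/funext => t; rewrite big_ord_recr.
Qed.

End SumHomeo.

(** * Hausdorff-null subsets of a curve *)

Section Hausdorff.
Context {R : realType}.
Local Notation mu := (@lebesgue_measure R).
Variable m : nat.
Implicit Types A C : set 'M[R]_m.

Lemma fdist_ge0 (x y : 'M[R]_m) : 0 <= fdist x y.
Proof. exact: sqrtr_ge0. Qed.

Lemma diam_ge0 A : (0 <= diam A)%E.
Proof. by apply: ereal_sup_ubound; left. Qed.

Lemma le_diam A x y : A x -> A y -> ((fdist x y)%:E <= diam A)%E.
Proof. by move=> Ax Ay; apply: ereal_sup_ubound; right; exists x => //; exists y. Qed.

Lemma diam_le A (d : R) : 0 <= d -> (forall x y, A x -> A y -> fdist x y <= d) ->
  (diam A <= d%:E)%E.
Proof.
move=> d0 h; apply: ge_ereal_sup => _ [->|[x Ax [y Ay <-]]]; rewrite lee_fin//.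
exact: h.
Qed.

Lemma hcontent_ge0 d A : (0 <= hcontent d A)%E.
Proof.
apply: le_ereal_inf_tmp => _ [U _ <-].
by apply: nneseries_ge0 => k _ _; exact: diam_ge0.
Qed.

Lemma hausdorff1_ge0 A : (0 <= hausdorff1 A)%E.
Proof.
apply: le_trans (hcontent_ge0 1 A) _; apply: ereal_sup_ubound.
by exists 1 => //=; exact: ltr01.
Qed.

Lemma hausdorff1_eq0P A : hausdorff1 A = 0%E -> forall e : R, 0 < e ->
  exists U : nat -> set 'M[R]_m, [/\ A `<=` \bigcup_i U i, forall i, (diam (U i) <= 1)%E &
    (\sum_(i <oo) diam (U i) < e%:E)%E].
Proof.
move=> A0 e e0.
have : (hcontent 1 A < e%:E)%E.
  apply: (@le_lt_trans _ _ 0%E); last by rewrite lte_fin.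
  by rewrite -A0; apply: ereal_sup_ubound; exists 1 => //=; exact: ltr01.
by move=> /ereal_inf_lt[_ [U [AU dU] <-] lte]; exists U.
Qed.

(** A covering set [U k] projects into an interval of length twice the Lipschitz constant times its
    diameter. The coordinate is Lipschitz only where it is bounded, hence the cut by [K]; covers at
    scale 1 suffice and have finite diameters. *)
Lemma hausdorff1_null_chart (gamma : R -> 'M[R]_m) phi psi C A : incr_homeo phi psi ->
  (forall t, C (gamma t)) ->
  (forall K : R, exists2 L : R, 0 < L & forall t t', `|phi t| <= K -> `|phi t'| <= K ->
     `|phi t - phi t'| <= L * fdist (gamma t) (gamma t')) ->
  hausdorff1 (A `&` C) = 0%E -> mu (psi @^-1` [set t | A (gamma t)]) = 0%E.
Proof.
move=> H Cg lip A0; have [mo k k'] := H.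
pose B (K : nat) := [set s | `|s| <= K%:R /\ A (gamma (psi s))].
apply: (@lebesgue_null_sub _ _ (\bigcup_K B K)) => [s As|].
  by exists (Num.truncn `|s|).+1 => //; split => //; rewrite ltW// truncnS_gt.
apply: lebesgue_bigcup0 => K; apply/eqP; rewrite eq_le lebesgue_ge0 andbT.
apply/lee_addgt0Pr => e e0; rewrite add0e.
have [L L0 hL] := lip K%:R.
have L20 : 0 < 2 * L by rewrite mulr_gt0.
have eL : 0 < e / (2 * L) by rewrite divr_gt0.
have [U [AU dU sU]] := hausdorff1_eq0P A0 eL.
pose S k := [set s | B K s /\ U k (gamma (psi s))].
have BS : B K `<=` \bigcup_k S k.
  by move=> s Bs; have [|j _ Uj] := AU (gamma (psi s)); [split; [case: Bs|exact: Cg]|exists j].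
apply: le_trans (le_lebesgue BS) _; apply: le_trans (lebesgue_sigma_subadditive _) _.
have -> : e%:E = ((2 * L)%:E * (e / (2 * L))%:E)%E.
  by rewrite -EFinM; congr EFin; field; exact: lt0r_neq0.
apply: (@le_trans _ _ ((2 * L)%:E * \sum_(i <oo) diam (U i))%E); last first.
  by rewrite lee_pmul2l//; exact: ltW.
rewrite -nneseriesZl => [|*]; last exact: diam_ge0.
apply: lee_nneseries => [j _ _|j _]; first exact: lebesgue_ge0.
have [->|] := eqVneq (S j) set0; last move/set0P => [s0 [[s0K _] Us0]].
  by rewrite measure0 mule_ge0 ?diam_ge0// lee_fin ltW.
have fin : diam (U j) \is a fin_num.
  by rewrite ge0_fin_numE ?diam_ge0// (le_lt_trans (dU j))// ltry.
pose r := fine (diam (U j)).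
have rE : diam (U j) = r%:E by rewrite /r fineK.
have r0 : 0 <= r by rewrite -lee_fin -rE diam_ge0.
apply: (@le_trans _ _ (mu `[s0 - L * r, s0 + L * r]%classic)).
  apply: le_lebesgue => s [[sK _] Us] /=; rewrite in_itv/= -ler_distl.
  have := hL (psi s) (psi s0); rewrite !k' => /(_ sK s0K) h; apply: le_trans h _.
  rewrite ler_wpM2l ?(ltW L0)//; rewrite -lee_fin -rE; exact: le_diam.
rewrite rE lebesgue_measure_itv/= lte_fin; case: ifP => _.
  by rewrite -!EFinD -!EFinM lee_fin; lra.
by rewrite -EFinM lee_fin mulr_ge0// ltW.
Qed.

(** Parametrised by the sum of the increasing coordinates, the curve is [L]-Lipschitz, so a null set
    of parameters has a null image. The point [pt] stands for the one at infinity. *)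
Lemma hausdorff1_null_curve (gamma : R -> 'M[R]_m) pt n (phi psi : 'I_n.+1 -> R -> R) C A L :
  (forall i, incr_homeo (phi i) (psi i)) ->
  C `<=` range gamma `|` [set pt] -> 0 < L ->
  (forall t t', fdist (gamma t) (gamma t') <= L * \sum_i `|phi i t - phi i t'|) ->
  measurable [set t | A (gamma t)] ->
  (forall i, mu (psi i @^-1` [set t | A (gamma t)]) = 0%E) ->
  hausdorff1 (A `&` C) = 0%E.
Proof.
move=> H Cg L0 lip mA A0.
have [Psi HS nS] := sum_homeo H.
have {nS} S0 := nS _ mA A0.
have [_ k k'] := HS.
have lipS s s' : fdist (gamma (Psi s)) (gamma (Psi s')) <= L * `|s - s'|.
  have main x y : x <= y -> fdist (gamma (Psi x)) (gamma (Psi y)) <= L * `|x - y|.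
    move=> xy; apply: le_trans (lip _ _) _; rewrite ler_wpM2l ?(ltW L0)//.
    rewrite distrC ger0_norm ?subr_ge0// -{2}(k' y) -{2}(k' x) -sumrB.
    apply: ler_sum => i _; rewrite distrC ger0_norm// subr_ge0.
    have [mi _ _] := H i; rewrite mi; have [mP _ _] := incr_homeo_sym HS.
    by rewrite mP.
  have [ss|/ltW ss] := leP s s'; first exact: main.
  have -> : fdist (gamma (Psi s)) (gamma (Psi s')) = fdist (gamma (Psi s')) (gamma (Psi s)).
    rewrite /fdist; congr (Num.sqrt _); apply: eq_bigr => i _; apply: eq_bigr => j _.
    by rewrite -sqrrN opprB.
  by rewrite distrC; exact: main.
apply/eqP; rewrite eq_le hausdorff1_ge0 andbT.
apply: ge_ereal_sup => _ [d d0 <-]; rewrite /= in d0.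
apply/lee_addgt0Pr => e e0; rewrite add0e.
(* One bound on the total length serves twice: it controls the sum by [e], and each single diameter
   by [d]. *)
pose e' := Num.min e d / L.
have e'0 : 0 < e' by rewrite divr_gt0// lt_min e0.
have : (mu (Psi @^-1` [set t | A (gamma t)]) < e'%:E)%E by rewrite S0 lte_fin.
move=> /ereal_inf_lt[_ [I [mI AI] <-] sI].
(* Index 0 is spent on the point [pt], of diameter 0; the cover of the parameters is shifted by
   one. *)
pose U j := if j is j'.+1 then (gamma \o Psi) @` I j' else [set pt].
have dU0 : diam (U 0%N) = 0%E.
  apply/eqP; rewrite eq_le diam_ge0 andbT; apply: diam_le => // x y -> ->.
  rewrite /fdist big1 ?sqrtr0// => i _; rewrite big1// => j _.
  by rewrite subrr expr0n.
have dUS j : (diam (U j.+1) <= L%:E * wlength idfun (I j))%E.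
  have [[a b] _ /= Iab] := mI j.
  rewrite -Iab wlength_itv/= lte_fin; case: ifPn => [ab|ab]; rewrite -?EFinD -?EFinM.
    apply: diam_le; first by rewrite mulr_ge0 ?subr_ge0 ?ltW.
    move=> _ _ [s Is <-] [s' Is' <-] /=; apply: le_trans (lipS _ _) _.
    rewrite ler_wpM2l ?(ltW L0)//; move: Is Is'; rewrite /= !in_itv/=.
    move=> /andP[s1 s2] /andP[s1' s2'].
    by rewrite ler_distl; apply/andP; split; lra.
  rewrite mulr0; apply: diam_le => // x y [s Is _]; move: Is; rewrite /= in_itv/=.
  by move=> /andP[s1 s2]; move: ab; rewrite (lt_le_trans s1 s2).
have w0 j : (0 <= wlength idfun (I j))%E by exact: wlength_ge0.
have sumU : (\sum_(j <oo) diam (U j) <= L%:E * \sum_(j <oo) wlength idfun (I j))%E.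
  rewrite nneseries_recl// => [|j _]; last exact: diam_ge0.
  rewrite dU0 add0e -(@nneseries_addn _ (fun j => diam (U j)) 1%N) => [|j]; last exact: diam_ge0.
  rewrite -nneseriesZl//; apply: lee_nneseries => [j _ _|j _]; first exact: diam_ge0.
  by rewrite addn1; exact: dUS.
have Le' : (L%:E * e'%:E)%E = (Num.min e d)%:E.
  by rewrite -EFinM /e' mulrC divfK// lt0r_neq0.
have sumU' : (\sum_(j <oo) diam (U j) <= (Num.min e d)%:E)%E.
  by apply: le_trans sumU _; rewrite -Le' lee_pmul2l// ltW.
apply: (@le_trans _ _ (\sum_(j <oo) diam (U j))%E); last first.
  by apply: le_trans sumU' _; rewrite lee_fin ge_min lexx.
apply: ereal_inf_lbound; exists U => //; split.
  move=> P [AP /Cg[[t _ tP]|->]]; last by exists 0%N.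
  have [|j _ Ij] := AI (\sum_i phi i t).
    by rewrite /= k tP.
  by exists j.+1 => //; exists (\sum_i phi i t) => //=; rewrite k.
case=> [|j]; first by rewrite dU0 lee_fin ltW.
apply: le_trans (dUS j) _.
apply: (@le_trans _ _ (L%:E * e'%:E)%E); last by rewrite Le' lee_fin ge_min lexx orbT.
rewrite lee_pmul2l//; apply: le_trans (ltW sI).
apply: (@le_trans _ _ (\sum_(0 <= i < j.+1) wlength idfun (I i))%E).
  by rewrite big_nat_recr//= leeDr// sume_ge0.
by apply: nneseries_lim_ge => i _ _; exact: w0.
Qed.

End Hausdorff.

(** * Lagrangian subspaces *)

Section MatrixNorm.
Context {R : realType}.

Definition n1 (m k : nat) (M : 'M[R]_(m, k)) : R := \sum_i \sum_j `|M i j|.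

Lemma n1_ge0 m k (M : 'M[R]_(m, k)) : 0 <= n1 M.
Proof. by apply: sumr_ge0 => i _; apply: sumr_ge0. Qed.

Lemma n1D m k (M N : 'M[R]_(m, k)) : n1 (M + N) <= n1 M + n1 N.
Proof.
rewrite /n1 -big_split; apply: ler_sum => i _; rewrite -big_split; apply: ler_sum => j _.
by rewrite mxE ler_normD.
Qed.

Lemma n1N m k (M : 'M[R]_(m, k)) : n1 (- M) = n1 M.
Proof. by apply: eq_bigr => i _; apply: eq_bigr => j _; rewrite mxE normrN. Qed.

Lemma n1_entry m k (M : 'M[R]_(m, k)) i j : `|M i j| <= n1 M.
Proof.
rewrite /n1 (bigD1 i)//= (bigD1 j)//= -addrA lerDl addr_ge0//.
  by apply: sumr_ge0.
by apply: sumr_ge0 => l _; apply: sumr_ge0.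
Qed.

Lemma n1M m k l (M : 'M[R]_(m, k)) (N : 'M[R]_(k, l)) : n1 (M *m N) <= n1 M * n1 N.
Proof.
apply: (@le_trans _ _ (\sum_i \sum_j \sum_a `|M i a| * `|N a j|)).
  apply: ler_sum => i _; apply: ler_sum => j _; rewrite mxE.
  apply: le_trans (ler_norm_sum _ _ _) _; apply: ler_sum => a _.
  by rewrite normrM.
rewrite /n1 mulr_suml; apply: ler_sum => i _.
rewrite exchange_big /= mulr_suml; apply: ler_sum => a _.
rewrite -mulr_sumr ler_wpM2l// (bigD1 a)//= lerDl.
by apply: sumr_ge0 => b _; apply: sumr_ge0.
Qed.

Definition mxcvg (U : set_system nat) m k (M : nat -> 'M[R]_(m, k)) (L : 'M[R]_(m, k)) :=
  forall i j, M l i j @[l --> U] --> L i j.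

Lemma cvg_bigsum (U : set_system nat) (FU : Filter U) (I : finType) (f : nat -> I -> R) (l : I -> R) :
  (forall i, f k i @[k --> U] --> l i) -> \sum_i f k i @[k --> U] --> \sum_i l i.
Proof.
move=> h; elim: (index_enum I) => [|i r IH].
  by under eq_cvg do rewrite big_nil; rewrite big_nil; exact: cvg_cst.
by under eq_cvg do rewrite big_cons; rewrite big_cons; apply: cvgD.
Qed.

Lemma mxcvgM (U : set_system nat) (FU : Filter U) m k l (M : nat -> 'M[R]_(m, k)) (N : nat -> 'M[R]_(k, l)) M0 N0 :
  mxcvg U M M0 -> mxcvg U N N0 -> mxcvg U (fun a => M a *m N a) (M0 *m N0).
Proof.
move=> hM hN i j; under eq_cvg do rewrite mxE; rewrite mxE.
by apply: cvg_bigsum => a; apply: cvgM; [exact: hM|exact: hN].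
Qed.

Lemma mxcvgB (U : set_system nat) (FU : Filter U) m k (M N : nat -> 'M[R]_(m, k)) M0 N0 :
  mxcvg U M M0 -> mxcvg U N N0 -> mxcvg U (fun a => M a - N a) (M0 - N0).
Proof.
by move=> hM hN i j; under eq_cvg do rewrite !mxE; rewrite !mxE; apply: cvgB.
Qed.

Lemma mxcvg_cst (U : set_system nat) (FU : Filter U) m k (M : 'M[R]_(m, k)) : mxcvg U (fun=> M) M.
Proof. by move=> i j; exact: cvg_cst. Qed.

Lemma mxcvg_n1 (U : set_system nat) (FU : Filter U) m k (M : nat -> 'M[R]_(m, k)) :
  mxcvg U M 0 -> n1 (M l) @[l --> U] --> 0.
Proof.
move=> hM; have : n1 (M l) @[l --> U] --> \sum_(i < m) \sum_(j < k) `|(0 : 'M[R]_(m, k)) i j|.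
  by apply: cvg_bigsum => i; apply: cvg_bigsum => j; apply: cvg_norm; exact: hM.
by rewrite big1// => i _; rewrite big1// => j _; rewrite mxE normr0.
Qed.

End MatrixNorm.

(** * Projections onto Lagrangians and positive triples *)

Section Lagrangian.
Context {R : realType} {n : nat}.
Implicit Types (P Q W : 'M[R]_(n + n)) (x y z : 'cV[R]_(n + n)).
Local Notation J := (Jmx R n).

Lemma JT : J^T = - J.
Proof.
by rewrite /Jmx tr_block_mx !trmx0 trmx1 linearN /= trmx1 opp_block_mx !oppr0 opprK.
Qed.

Lemma JJ : J *m J = - 1%:M.
Proof.
rewrite /Jmx mulmx_block !mul0mx !mulmx0 !add0r !addr0 mul1mx mulmx1.
by rewrite [in RHS]scalar_mx_block opp_block_mx !oppr0.
Qed.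

Lemma JJT : J *m J^T = 1%:M.
Proof. by rewrite JT mulmxN JJ opprK. Qed.

Lemma JTJ : J^T *m J = 1%:M.
Proof. by rewrite JT mulNmx JJ opprK. Qed.

Definition pr (i : 'I_n) x : 'cV[R]_2 := v2 (x (lshift n i) 0) (x (rshift n i) 0).

Lemma omegaE x y : omega x y = \sum_i det2 (pr i x) (pr i y).
Proof.
rewrite /omega -{1}(vsubmxK x) -{1}(vsubmxK y) -mulmxA /Jmx mul_block_col !mul0mx !mul1mx add0r addr0.
rewrite mulNmx mul1mx tr_col_mx mul_row_col mulmxN !mxE -sumrB; apply: eq_bigr => i _.
by rewrite /pr det2_v2 !mxE.
Qed.

Lemma omegaDl x y z : omega (x + y) z = omega x z + omega y z.
Proof. by rewrite /omega linearD /= !mulmxDl mxE. Qed.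
Lemma omegaDr x y z : omega z (x + y) = omega z x + omega z y.
Proof. by rewrite /omega mulmxDr mxE. Qed.
Lemma omegaZl c x y : omega (c *: x) y = c * omega x y.
Proof. by rewrite /omega linearZ /= -!scalemxAl mxE. Qed.
Lemma omegaZr c x y : omega x (c *: y) = c * omega x y.
Proof. by rewrite /omega -scalemxAr mxE. Qed.
Lemma omegaC x y : omega x y = - omega y x.
Proof. by rewrite !omegaE -sumrN; apply: eq_bigr => i _; rewrite det2C. Qed.

Lemma omega_n1 x y : `|omega x y| <= n1 x * n1 J * n1 y.
Proof.
apply: le_trans (n1_entry _ 0 0) _; apply: le_trans (n1M _ _) _.
rewrite ler_wpM2r ?n1_ge0//; apply: le_trans (n1M _ _) _.
rewrite ler_wpM2r ?n1_ge0// /n1 exchange_big /= le_eqVlt; apply/orP; left; apply/eqP.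
by apply: eq_bigr => i _; apply: eq_bigr => j _; rewrite mxE.
Qed.

Lemma sqnorm_eq0 (m : nat) (x : 'cV[R]_m) : (x^T *m x) 0 0 = 0 -> x = 0.
Proof.
rewrite mxE => /eqP; rewrite psumr_eq0 => [/allP h|i _]; last first.
  by rewrite mxE -expr2 sqr_ge0.
apply/colP => i; have := h i (mem_index_enum _); rewrite !mxE /= -expr2 expf_eq0 /=.
by move/eqP.
Qed.

Lemma unitmx_inj (m : nat) (M : 'M[R]_m) : (forall x : 'cV[R]_m, M *m x = 0 -> x = 0) -> M \in unitmx.
Proof.
move=> h; rewrite -unitmx_tr -row_free_unit -kermx_eq0; apply/eqP/row_matrixP => i.
rewrite row0; apply: trmx_inj; rewrite trmx0; apply: h.
apply: trmx_inj; rewrite trmx_mul trmxK trmx0 -row_mul mulmx_ker.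
by rewrite row0.
Qed.

(** The orthogonal complement of a Lagrangian is its image under [J]. The two projections annihilate
    each other and their ranks add up to the dimension, so their sum is an invertible idempotent. *)
Lemma lag_compl P : is_lag P -> 1%:M - P = J *m P *m J^T.
Proof.
move=> [PT PP rP PJP]; pose Q := J *m P *m J^T.
have PQ : P *m Q = 0 by rewrite /Q !mulmxA PJP mul0mx.
have QP : Q *m P = 0 by rewrite /Q JT mulmxN mulNmx -!mulmxA (mulmxA P) PJP mulmx0 oppr0.
have QQ : Q *m Q = Q.
  by rewrite /Q !mulmxA -(mulmxA _ J^T J) JTJ mulmx1 -(mulmxA J) PP.
have Ju : J \in unitmx by apply: (mulmx1_unit JJT).1.
have JTu : J^T \in unitmx by rewrite unitmx_tr.
have rQ : \rank Q = n.
  rewrite /Q mxrankMfree ?row_free_unit// (eqmxMfull P (_ : row_full J)) ?row_full_unit//.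
have sP : (P <= (P + Q)%R)%MS.
  by apply/submxP; exists P; rewrite mulmxDr PP PQ addr0.
have sQ : (Q <= (P + Q)%R)%MS.
  by apply/submxP; exists Q; rewrite mulmxDr QP QQ add0r.
have cap0 : (P :&: Q)%MS = 0.
  apply/row_matrixP => i; rewrite row0; set u := row i _.
  have uP : (u <= P)%MS := submx_trans (row_sub _ _) (capmxSl _ _).
  have uQ : (u <= Q)%MS := submx_trans (row_sub _ _) (capmxSr _ _).
  have [a ua] := submxP uP; have [b ub] := submxP uQ.
  have uPe : u *m P = u by rewrite ua -mulmxA PP.
  have uQe : u *m Q = u by rewrite ub -mulmxA QQ.
  by rewrite -uPe -uQe -mulmxA QP mulmx0.
have full : row_full (P + Q)%R.
  have rPQ : \rank (P + Q)%MS = (n + n)%N by rewrite (mxrank_disjoint_sum cap0) rP rQ.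
  rewrite -col_leq_rank; apply: (@leq_trans (\rank (P + Q)%MS)); first by rewrite rPQ.
  by apply: mxrankS; rewrite addsmx_sub sP sQ.
have uPQ : P + Q \in unitmx by rewrite -row_full_unit.
have idPQ : (P + Q) *m (P + Q) = P + Q by rewrite mulmxDl !mulmxDr PP QQ PQ QP addr0 add0r.
have : P + Q = 1%:M by rewrite -[LHS](mulKmx uPQ) idPQ mulVmx.
by move=> <-; rewrite addrC addKr.
Qed.

Lemma in_lag_compl P x : is_lag P -> (1%:M - P) *m x = J *m (P *m (J^T *m x)).
Proof. by move=> LP; rewrite lag_compl// !mulmxA. Qed.

Lemma in_lagM P x : is_lag P -> in_lag P (P *m x).
Proof. by move=> [_ PP _ _]; rewrite /in_lag mulmxA PP. Qed.

Lemma in_lagD P x y : in_lag P x -> in_lag P y -> in_lag P (x + y).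
Proof. by rewrite /in_lag mulmxDr => -> ->. Qed.

Lemma in_lagZ P c x : in_lag P x -> in_lag P (c *: x).
Proof. by rewrite /in_lag -scalemxAr => ->. Qed.

Lemma lag_omega0 P x y : is_lag P -> in_lag P x -> in_lag P y -> omega x y = 0.
Proof.
move=> [PT _ _ PJP] <- <-; rewrite /omega trmx_mul PT.
by rewrite -!mulmxA (mulmxA P) (mulmxA (P *m _)) PJP mul0mx mulmx0 mxE.
Qed.

(** Maximality of a Lagrangian: testing [z] against the projection of [J^T *m z] shows that this
    projection vanishes, hence so does the part of [z] orthogonal to [P]. *)
Lemma lag_orthP P z : is_lag P -> (forall y, in_lag P y -> omega z y = 0) -> in_lag P z.
Proof.
move=> LP h; have [PT PP _ _] := LP.
have t0 : P *m (J^T *m z) = 0.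
  apply: sqnorm_eq0; have := h _ (in_lagM (J^T *m z) LP); rewrite /omega => <-; congr (_ 0 0).
  by rewrite !trmx_mul PT trmxK -!mulmxA (mulmxA P P) PP.
have := in_lag_compl z LP; rewrite t0 mulmx0 mulmxBl mul1mx => /eqP.
by rewrite subr_eq0 eq_sym => /eqP.
Qed.

Lemma transverse_sum_unit P Q : is_lag P -> is_lag Q -> transverse P Q -> P + Q \in unitmx.
Proof.
move=> LP LQ tPQ; apply: unitmx_inj => x; rewrite mulmxDl => e.
have Px : P *m x = 0.
  apply: tPQ; first exact: in_lagM.
  have -> : P *m x = Q *m (- x) by rewrite mulmxN; apply/eqP; rewrite -addr_eq0 e.
  exact: in_lagM.
have Qx : Q *m x = 0 by rewrite Px add0r in e.
have jx T : is_lag T -> T *m x = 0 -> in_lag T (J^T *m x).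
  move=> LT Tx; have := in_lag_compl x LT; rewrite mulmxBl mul1mx Tx subr0 => {1}->.
  by rewrite /in_lag (mulmxA J^T) JTJ mul1mx mulmxA; have [_ -> _ _] := LT.
have Jx0 : J^T *m x = 0 by apply: tPQ; exact: jx.
by rewrite -[x]mul1mx -JJT -mulmxA Jx0 mulmx0.
Qed.

Lemma transverse_decomp P Q x : is_lag P -> is_lag Q -> transverse P Q ->
  exists p q, [/\ in_lag P p, in_lag Q q & x = p + q].
Proof.
move=> LP LQ /(transverse_sum_unit LP LQ) u; pose z := invmx (P + Q) *m x.
exists (P *m z), (Q *m z); split; [exact: in_lagM..|].
by rewrite -mulmxDl /z mulKVmx.
Qed.

(** Transversality in quantitative form: [1%:M - Q] is injective on the Lagrangian of [P]. The
    matrix identity is stable under small perturbations of [P] and [Q], with the same [N]. *)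
Lemma transverse_left_inverse P Q : is_lag P -> is_lag Q -> transverse P Q ->
  exists N, N *m (1%:M - Q) *m P = P.
Proof.
move=> [PT PP rP PJP] [QT QQ rQ QJQ] tPQ.
have Q2 : (1%:M - Q) *m (1%:M - Q) = 1%:M - Q.
  by rewrite mulmxBl mul1mx mulmxBr mulmx1 QQ subrr subr0.
have QT2 : (1%:M - Q)^T = 1%:M - Q by rewrite linearB /= trmx1 QT.
pose E := P *m (1%:M - Q) *m P + (1%:M - P).
have EP : E *m P = P *m (1%:M - Q) *m P.
  by rewrite /E mulmxDl -mulmxA PP mulmxBl mul1mx PP subrr addr0.
have PE : P *m E = P *m (1%:M - Q) *m P.
  have P1 : P *m (1%:M - P) = 0 by rewrite mulmxBr mulmx1 PP subrr.
  by rewrite /E mulmxDr !mulmxA PP P1 addr0.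
have uE : E \in unitmx.
  apply: unitmx_inj => x Ex.
  have h1 : P *m (1%:M - Q) *m P *m x = 0 by rewrite -PE -mulmxA Ex mulmx0.
  have Px : P *m x = x.
    have : (1%:M - P) *m x = 0 by rewrite -[RHS]Ex /E [RHS]mulmxDl h1 add0r.
    by rewrite mulmxBl mul1mx => /eqP; rewrite subr_eq0 eq_sym => /eqP.
  have h2 : (1%:M - Q) *m x = 0.
    apply: sqnorm_eq0; rewrite trmx_mul QT2 -{1}Px trmx_mul PT.
    have -> : x^T *m P *m (1%:M - Q) *m ((1%:M - Q) *m x) = x^T *m (P *m (1%:M - Q) *m P *m x).
      by rewrite -{2}Px -!mulmxA (mulmxA (1%:M - Q) (1%:M - Q)) Q2.
    by rewrite h1 mulmx0 mxE.
  apply: tPQ; first exact: Px.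
  by apply/eqP; rewrite eq_sym -subr_eq0 -{1}[x]mul1mx -mulmxBl h2.
by exists (invmx E *m P); rewrite -!mulmxA (mulmxA P) -EP mulKmx.
Qed.

(** If [Q] is the graph of T from [P] to [W], then omega(x, T s) is a bilinear form on [P]:
    symmetric because [Q] is Lagrangian, negative by positivity of the triple. Here [y] is T x and
    [t] is T s. *)
Lemma omega_cauchy_schwarz P Q W x y s t : lag_pos P Q W ->
  in_lag P x -> in_lag W y -> in_lag Q (x + y) ->
  in_lag P s -> in_lag W t -> in_lag Q (s + t) ->
  omega x t ^+ 2 <= omega x y * omega s t.
Proof.
move=> [LP LQ LW _ neg] Px Wy Qxy Ps Wt Qst.
have sym : omega x t = omega s y.
  have := lag_omega0 LQ Qxy Qst; rewrite !omegaDl !omegaDr.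
  rewrite (lag_omega0 LP Px Ps) (lag_omega0 LW Wy Wt) (omegaC y s); lra.
have neg0 p q : in_lag P p -> in_lag W q -> in_lag Q (p + q) -> omega p q <= 0.
  move=> Pp Wq Qpq; have [->|p0] := eqVneq p 0.
    by rewrite -(scale0r (0 : 'cV[R]_(n + n))) omegaZl mul0r.
  by apply: ltW; exact: neg.
have [s0|s0] := eqVneq s 0.
  have z0 v : omega s v = 0 by rewrite s0 -(scale0r (0 : 'cV[R]_(n + n))) omegaZl mul0r.
  by rewrite sym !z0 mulr0 expr0n.
have st : omega s t < 0 by exact: neg.
pose l := - (omega x t) / omega s t.
have := neg0 (x + l *: s) (y + l *: t).
have -> : x + l *: s + (y + l *: t) = (x + y) + l *: (s + t).
  by rewrite scalerDr addrACA.
move=> /(_ (in_lagD Px (in_lagZ _ Ps)) (in_lagD Wy (in_lagZ _ Wt)) (in_lagD Qxy (in_lagZ _ Qst))).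
rewrite !omegaDl !omegaDr !omegaZl !omegaZr -sym.
have -> : omega x y + l * omega x t + (l * omega x t + l * (l * omega s t)) =
  omega x y - omega x t ^+ 2 / omega s t by rewrite /l; field; rewrite ltr0_neq0.
rewrite subr_le0 ler_ndivlMr// => h; lra.
Qed.

Lemma n1_sqr_le x : n1 x ^+ 2 <= (n + n)%:R ^+ 2 * (x^T *m x) 0 0.
Proof.
have xx i : x i 0 ^+ 2 <= (x^T *m x) 0 0.
  rewrite mxE (bigD1 i)//= mxE -expr2 lerDl.
  by apply: sumr_ge0 => j _; rewrite mxE -expr2 sqr_ge0.
have x0 : 0 <= (x^T *m x) 0 0.
  by rewrite mxE; apply: sumr_ge0 => j _; rewrite mxE -expr2 sqr_ge0.
rewrite -(sqr_sqrtr x0) -exprMn ler_sqr ?nnegrE ?n1_ge0 ?mulr_ge0 ?sqrtr_ge0//.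
rewrite /n1 (eq_bigr (fun i => `|x i 0|)); last by move=> i _; rewrite big_ord1.
apply: (@le_trans _ _ (\sum_(i < n + n) Num.sqrt ((x^T *m x) 0 0))).
  by apply: ler_sum => i _; rewrite -sqrtr_sqr; exact: ler_wsqrtr.
by rewrite sumr_const card_ord mulr_natl.
Qed.

(** Two factors [n1 J] compare [x] with its part outside [W] and the third bounds [omega s t]; the
    fourth power of the dimension comes from squaring [n1_sqr_le]. *)
Definition pinch_const : R := n1 J ^+ 3 * (n + n)%:R ^+ 4.

(* The bound is uniform over positive triples: if [Q] is close to [W] and [P] is quantitatively
   transverse to [W], then the vectors of [P] on which the form of the triple is bounded are short. *)
Lemma lag_pinching P Q W x y (c eta : R) : lag_pos P Q W ->
  in_lag P x -> in_lag W y -> in_lag Q (x + y) -> 0 < c -> eta <= c / 2 ->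
  (forall z, in_lag P z -> c * n1 z <= n1 ((1%:M - W) *m z)) ->
  n1 (Q - W) <= eta ->
  c ^+ 3 * n1 x ^+ 2 <= pinch_const * (2 * - omega x y) * eta.
Proof.
move=> pos Px Wy Qxy c0 ec hc hQW.
have [LP LQ LW [tPQ tQW tPW] neg] := pos.
(* This test vector satisfies [J *m t = (1%:M - W) *m x], so it controls [x] by transversality, and
   [omega x t] is its squared norm. *)
pose t := W *m (J^T *m x).
have Wt : in_lag W t by exact: in_lagM.
have [p [q [Pp Qq tE]]] := transverse_decomp t LP LQ tPQ.
pose s := - p.
have Ps : in_lag P s by rewrite /s -scaleN1r; exact: in_lagZ.
have Qst : in_lag Q (s + t) by rewrite /s tE addKr.
have qE : - omega x y >= 0.
  rewrite oppr_ge0; have [->|x0] := eqVneq x 0; last by apply: ltW; exact: neg.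
  by rewrite -(scale0r (0 : 'cV[R]_(n + n))) omegaZl mul0r.
have tt : omega x t = (t^T *m t) 0 0.
  have [WT WW _ _] := LW.
  by rewrite /omega /t !trmx_mul WT trmxK -!mulmxA (mulmxA W W) WW.
have eta0 : 0 <= eta by exact: le_trans (n1_ge0 _) hQW.
have cs := omega_cauchy_schwarz pos Px Wy Qxy Ps Wt Qst.
have st := omega_n1 s t.
have s0 := n1_ge0 s; have t0 := n1_ge0 t; have j0 := n1_ge0 J; have x0 := n1_ge0 x.
(* Since [W] fixes [t] and [Q] fixes [s + t], the part of [s] outside [W] is of the order of
   [Q - W]: closeness of [Q] to [W] makes [s] short compared with [t]. *)
have sE : (1%:M - W) *m s = (Q - W) *m (s + t).
  rewrite !mulmxBl Qst [W *m (s + t)]mulmxDr Wt mul1mx.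
  by rewrite opprD addrACA subrr addr0.
have st1 : c / 2 * n1 s <= eta * n1 t.
  have h1 := hc s Ps; rewrite sE in h1.
  have h2 : n1 ((Q - W) *m (s + t)) <= eta * (n1 s + n1 t).
    apply: le_trans (n1M _ _) _; apply: ler_pM; rewrite ?n1_ge0//.
    exact: n1D.
  have h3 : eta * n1 s <= c / 2 * n1 s by rewrite ler_wpM2r.
  lra.
have xt : c * n1 x <= n1 J * n1 t.
  by apply: le_trans (hc x Px) _; rewrite in_lag_compl//; exact: n1M.
have N0 : 0 <= (n + n)%:R :> R by exact: ler0n.
have t4 : n1 t ^+ 4 <= (n + n)%:R ^+ 4 * (- omega x y * (n1 s * n1 J * n1 t)).
  have t2 := n1_sqr_le t.
  have : (n1 t ^+ 2) ^+ 2 <= ((n + n)%:R ^+ 2 * (t^T *m t) 0 0) ^+ 2.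
    by rewrite ler_sqr ?nnegrE ?exprn_ge0//; apply: le_trans t2; rewrite exprn_ge0.
  have -> : n1 t ^+ 4 = (n1 t ^+ 2) ^+ 2 by ring.
  move=> h; apply: le_trans h _.
  have -> : ((n + n)%:R ^+ 2 * (t^T *m t) 0 0) ^+ 2 = (n + n)%:R ^+ 4 * omega x t ^+ 2.
    by rewrite -tt; ring.
  rewrite ler_wpM2l ?exprn_ge0//.
  apply: le_trans cs _; rewrite -mulrNN ler_wpM2l//.
  by apply: le_trans st; rewrite -normrN ler_norm.
have t2 : c * n1 t ^+ 2 <= (n + n)%:R ^+ 4 * (2 * - omega x y) * n1 J * eta.
  have [t00|tn0] := eqVneq (n1 t) 0.
    by rewrite t00 expr0n mulr0 !mulr_ge0// exprn_ge0.
  have tp : 0 < n1 t by rewrite lt_neqAle eq_sym tn0.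
  have t20 : 0 < n1 t ^+ 2 by rewrite exprn_gt0.
  rewrite -(ler_pM2r t20).
  have -> : c * n1 t ^+ 2 * n1 t ^+ 2 = c * n1 t ^+ 4 by ring.
  apply: (@le_trans _ _ (c * ((n + n)%:R ^+ 4 * (- omega x y * (n1 s * n1 J * n1 t))))).
    by rewrite ler_wpM2l// ltW.
  have -> : c * ((n + n)%:R ^+ 4 * (- omega x y * (n1 s * n1 J * n1 t))) =
    (n + n)%:R ^+ 4 * (2 * - omega x y) * n1 J * n1 t * (c / 2 * n1 s) by field.
  have -> : (n + n)%:R ^+ 4 * (2 * - omega x y) * n1 J * eta * n1 t ^+ 2 =
    (n + n)%:R ^+ 4 * (2 * - omega x y) * n1 J * n1 t * (eta * n1 t) by ring.
  by rewrite ler_wpM2l// !mulr_ge0// exprn_ge0.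
apply: (@le_trans _ _ (c * (n1 J * n1 t) ^+ 2)).
  have -> : c ^+ 3 * n1 x ^+ 2 = c * (c * n1 x) ^+ 2 by ring.
  rewrite ler_wpM2l ?(ltW c0)// ler_sqr ?nnegrE ?mulr_ge0 ?(ltW c0)//.
have -> : c * (n1 J * n1 t) ^+ 2 = n1 J ^+ 2 * (c * n1 t ^+ 2) by ring.
have -> : pinch_const * (2 * - omega x y) * eta =
   n1 J ^+ 2 * ((n + n)%:R ^+ 4 * (2 * - omega x y) * n1 J * eta) by rewrite /pinch_const; ring.
by rewrite ler_wpM2l// exprn_ge0.
Qed.

Lemma pr_det2_n1 i x y : `|det2 (pr i x) (pr i y)| <= 2 * (n1 x * n1 y).
Proof.
rewrite /det2 !v2E0 !v2E1; apply: le_trans (ler_normB _ _) _; rewrite !normrM.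
have h a b : `|x a 0| * `|y b 0| <= n1 x * n1 y.
  by apply: ler_pM => //; exact: n1_entry.
by rewrite mulr_natl mulr2n; apply: lerD.
Qed.

End Lagrangian.

Section FdistBounds.
Context {R : realType}.

Lemma fdist_entry m k (A B : 'M[R]_(m, k)) i j : `|A i j - B i j| <= fdist A B.
Proof.
rewrite -sqrtr_sqr /fdist; apply: ler_wsqrtr.
rewrite (bigD1 i)//= (bigD1 j)//= -addrA lerDl addr_ge0//.
  by apply: sumr_ge0 => l _; exact: sqr_ge0.
by apply: sumr_ge0 => l _; apply: sumr_ge0 => l' _; exact: sqr_ge0.
Qed.

Lemma fdist_le_n1 m k (A B : 'M[R]_(m, k)) : fdist A B <= n1 (A - B).
Proof.
rewrite -(ger0_norm (n1_ge0 (A - B))) -sqrtr_sqr /fdist; apply: ler_wsqrtr.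
rewrite expr2 {1}/n1 mulr_suml; apply: ler_sum => i _.
rewrite mulr_suml; apply: ler_sum => j _.
rewrite -real_normK ?num_real// expr2 [(A - B) i j]mxE mxE ler_wpM2l//.
by have := n1_entry (A - B) i j; rewrite !mxE.
Qed.

Lemma mx2_vec_eq (A B : 'M[R]_2) : (forall u : 'cV[R]_2, A *m u = B *m u) -> A = B.
Proof.
move=> h; have := h (v2 1 0); have := h (v2 0 1).
rewrite !mulmx_v2 !v2E0 !v2E1 !mulr1 !mulr0 !addr0 !add0r => /v2_inj[e01 e11] /v2_inj[e00 e10].
by apply/matrixP => i j; have [->|->] := ord2P i; have [->|->] := ord2P j.
Qed.

End FdistBounds.

(** * Splitting along the coordinate symplectic planes *)

Section Blocks.
Context {R : realType} {n : nat}.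
Implicit Types (P : 'M[R]_(n + n)) (x y : 'cV[R]_(n + n)) (u : 'cV[R]_2).

Lemma pr_ext x y : (forall i, pr i x = pr i y) -> x = y.
Proof.
move=> h; apply/colP => a; case: (splitP a) => i ai.
  have -> : a = lshift n i by apply/val_inj.
  by have /v2_inj[] := h i.
have -> : a = rshift n i by apply/val_inj.
by have /v2_inj[] := h i.
Qed.

Lemma prD i x y : pr i (x + y) = pr i x + pr i y.
Proof. by rewrite [RHS]v2P /pr !mxE. Qed.

Lemma pr0 (i : 'I_n) : pr i 0 = 0 :> 'cV[R]_2.
Proof. by rewrite [RHS]v2P /pr !mxE. Qed.

Definition emb (i : 'I_n) u : 'cV[R]_(n + n) :=
  col_mx (\col_j (if j == i then u 0 0 else 0)) (\col_j (if j == i then u 1 0 else 0)).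

Lemma pr_emb i j u : pr j (emb i u) = if j == i then u else 0.
Proof.
rewrite /pr /emb col_mxEu col_mxEd !mxE; case: eqP => _; first by rewrite -v2P.
by rewrite [RHS]v2P !mxE.
Qed.

Definition blk (i : 'I_n) P : 'M[R]_2 :=
  \matrix_(s, t) P (if s == 0 then lshift n i else rshift n i)
                   (if t == 0 then lshift n i else rshift n i).

(* [P] is a direct sum of 2x2 blocks, one in each coordinate symplectic plane. *)
Definition split_mx P := forall i x, pr i (P *m x) = blk i P *m pr i x.

Lemma split_entries P i j : split_mx P -> i != j ->
  [/\ P (lshift n i) (lshift n j) = 0, P (lshift n i) (rshift n j) = 0,
      P (rshift n i) (lshift n j) = 0 & P (rshift n i) (rshift n j) = 0].
Proof.
move=> sP ij.
have h a : (a = lshift n j \/ a = rshift n j) -> pr i (col a P) = 0.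
  move=> ha; rewrite colE sP.
  suff -> : pr i (delta_mx a (0 : 'I_1)) = 0 :> 'cV[R]_2 by rewrite mulmx0.
  rewrite [RHS]v2P /pr !mxE !eqxx !andbT; congr v2.
    by case: ha => ->; rewrite ?eq_lrshift// eq_lshift (negPf ij).
  by case: ha => ->; rewrite ?eq_rlshift// eq_rshift (negPf ij).
have z : (0 : 'cV[R]_2) = v2 0 0 by rewrite [LHS]v2P !mxE.
have := h _ (or_introl erefl); have := h _ (or_intror erefl).
by rewrite z /pr !mxE => /v2_inj[-> ->] /v2_inj[-> ->].
Qed.

Lemma split_n1 P Q : split_mx P -> split_mx Q -> n1 (P - Q) <= \sum_i n1 (blk i P - blk i Q).
Proof.
move=> sP sQ; rewrite /n1 big_split_ord /= -big_split /=; apply: ler_sum => i _.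
have row a : (forall j, j != i -> (P - Q) a (lshift n j) = 0 /\ (P - Q) a (rshift n j) = 0) ->
    \sum_b `|(P - Q) a b| = `|(P - Q) a (lshift n i)| + `|(P - Q) a (rshift n i)|.
  move=> h; rewrite big_split_ord /= (bigD1 i)//= big1 => [|j /h[-> _]]; last exact: normr0.
  rewrite addr0; congr (_ + _); rewrite (bigD1 i)//= big1 ?addr0// => j /h[_ ->].
  exact: normr0.
rewrite !row.
- by rewrite !big_ord_recl !big_ord0 !addr0 !mxE /=.
- move=> j; rewrite eq_sym => ji; have [_ _ p1 p2] := split_entries sP ji.
  by have [_ _ q1 q2] := split_entries sQ ji; rewrite !mxE p1 p2 q1 q2 subrr.
- move=> j; rewrite eq_sym => ji; have [p1 p2 _ _] := split_entries sP ji.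
  by have [q1 q2 _ _] := split_entries sQ ji; rewrite !mxE p1 p2 q1 q2 subrr.
Qed.

Lemma blk_entry P Q i s t : `|blk i P s t - blk i Q s t| <= fdist P Q.
Proof. by rewrite !mxE; exact: fdist_entry. Qed.

(** The orthogonal projections of rank one, that is, the lines of the plane. *)
Definition proj2 (p : 'M[R]_2) := [/\ p^T = p, p *m p = p & p 0 0 + p 1 1 = 1].

Lemma split_lag_emb P i u : split_mx P -> blk i P *m u = u -> in_lag P (emb i u).
Proof.
move=> sP e; apply: pr_ext => j; rewrite sP pr_emb; case: eqP => [->//|_].
by rewrite mulmx0.
Qed.

Lemma split_proj2 P i : is_lag P -> split_mx P -> proj2 (blk i P).
Proof.
move=> LP sP; have [PT PP _ _] := LP; split.
- by apply/matrixP => s t; rewrite !mxE -{1}PT mxE.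
- apply: mx2_vec_eq => u; have e : u = pr i (emb i u) by rewrite pr_emb eqxx.
  by rewrite e -mulmxA -!sP mulmxA PP.
- have := congr1 (fun M : 'M[R]_(n + n) => M (lshift n i) (lshift n i)) (lag_compl LP).
  have -> : (Jmx R n *m P *m (Jmx R n)^T) (lshift n i) (lshift n i) = P (rshift n i) (rshift n i).
    rewrite /Jmx tr_block_mx !trmx0 linearN /= trmx1 -{1}[P]submxK !mulmx_block.
    rewrite !(mul0mx, mulmx0, mul1mx, mulmx1, mulNmx, mulmxN, add0r, addr0) block_mxEul.
    by rewrite !mxE.
  by rewrite !mxE eqxx /=; lra.
Qed.

Definition plane_proj (i : 'I_n) : 'M[R]_(n + n) :=
  diag_mx (\row_a ((a == lshift n i) || (a == rshift n i))%:R).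

Lemma pr_plane_proj i j x : pr j (plane_proj i *m x) = if j == i then pr i x else 0.
Proof.
have E a : (plane_proj i *m x) a 0 = ((a == lshift n i) || (a == rshift n i))%:R * x a 0.
  by rewrite /plane_proj mul_diag_mx !mxE.
rewrite /pr !E !eq_lshift !eq_rshift eq_lrshift eq_rlshift orbF /=.
case: eqP => [->|_]; first by rewrite !mul1r.
by rewrite [RHS]v2P !mxE !mul0r.
Qed.

(** The i-th component of a vector of the Lagrangian is symplectically orthogonal to the whole
    Lagrangian, hence lies in it. So the coordinate projection preserves it, and by symmetry
    commutes with [P]. *)
Lemma lag_split P : is_lag P ->
  (forall i x y, in_lag P x -> in_lag P y -> det2 (pr i x) (pr i y) = 0) -> split_mx P.
Proof.
move=> LP iso i x; have [PT PP _ _] := LP.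
pose D := plane_proj i.
have DPin y : in_lag P y -> in_lag P (D *m y).
  move=> Py; apply: lag_orthP => // z Pz; rewrite omegaE (bigD1 i)//= big1 => [|j ji].
    by rewrite pr_plane_proj eqxx addr0 iso.
  by rewrite pr_plane_proj (negPf ji) /det2 !mxE; ring.
have vec_eq (A B : 'M[R]_(n + n)) : (forall u : 'cV[R]_(n + n), A *m u = B *m u) -> A = B.
  by move=> h; apply/matrixP => a b; have := h (delta_mx b 0); rewrite -!colE => /colP/(_ a); rewrite !mxE.
have PDP : P *m D *m P = D *m P.
  by apply: vec_eq => u; rewrite -!mulmxA; apply: DPin; exact: in_lagM.
have comm : D *m P = P *m D.
  have := congr1 trmx PDP; rewrite !trmx_mul PT /D tr_diag_mx => <-.
  by rewrite mulmxA PDP.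
have -> : pr i (P *m x) = pr i (P *m (D *m x)).
  by rewrite mulmxA -comm -mulmxA pr_plane_proj eqxx.
have dx : D *m x = x (lshift n i) 0 *: delta_mx (lshift n i) 0 + x (rshift n i) 0 *: delta_mx (rshift n i) 0.
  apply: pr_ext => j; rewrite pr_plane_proj prD; rewrite [RHS]v2P /pr !mxE !eqxx !andbT.
  rewrite !eq_lshift !eq_rshift eq_lrshift eq_rlshift /=.
  case: (eqVneq j i) => [_|_]; first by congr v2; rewrite /= ?mulr1n ?mulr0n; ring.
  by rewrite [LHS]v2P !mxE; congr v2; rewrite /= ?mulr1n ?mulr0n; ring.
rewrite dx mulmxDr -!scalemxAr -!colE mulmx_v2 /pr !mxE /=.
by congr v2; ring.
Qed.

End Blocks.

(** * The limit map *)

Section LimitMap.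
Context {R : realType} (G : groupType) (iota : G -> 'M[R]_2) (n : nat).
Context (rhos : 'I_n -> G -> 'M[R]_2) (xi : 'cV[R]_2 -> 'M[R]_(n + n)).
Hypothesis surf : closed_surface_group_in_PSL2 iota.
Hypothesis drhos : forall i g, \det (rhos i g) = 1.
Hypothesis plm : positive_limit_map iota (rho_mx rhos) xi.
Implicit Types (u v w a b : 'cV[R]_2) (g : G) (i : 'I_n) (x y : 'cV[R]_(n + n)).

Let di g : \det (iota g) = 1. Proof. by case: surf. Qed.

Lemma pr_rho i g x : pr i (rho_mx rhos g *m x) = rhos i g *m pr i x.
Proof.
rewrite mulmx_v2 /pr !v2E0 !v2E1 /rho_mx -{1 2}(vsubmxK x) mul_block_col col_mxEu col_mxEd.
by rewrite !mul_diag_mx !mxE.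
Qed.

Lemma omega_rho g x y : omega (rho_mx rhos g *m x) (rho_mx rhos g *m y) = omega x y.
Proof.
by rewrite !omegaE; apply: eq_bigr => i _; rewrite !pr_rho det2_mulmx drhos mul1r.
Qed.

Lemma limit_map_lag v : v != 0 -> is_lag (xi v).
Proof. by case: plm => h _ _ _ _; exact: h. Qed.

Lemma limit_mapZ t v : v != 0 -> t != 0 -> xi (t *: v) = xi v.
Proof. by case: plm => _ h _ _ _; exact: h. Qed.

Lemma limit_map_par u v : u != 0 -> v != 0 -> det2 u v = 0 -> xi u = xi v.
Proof.
move=> u0 v0 /(det2_par u0)[c vE]; rewrite vE limit_mapZ//.
by apply: contraNneq v0 => c0; rewrite vE c0 scale0r.
Qed.

Lemma limit_map_act g v x : v != 0 -> in_lag (xi v) x -> in_lag (xi (iota g *m v)) (rho_mx rhos g *m x).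
Proof.
by move=> v0 xv; case: plm => _ _ _ h _; apply/(h g v v0); exists x.
Qed.

Lemma limit_map_cvg (U : set_system nat) (FU : Filter U) (w : nat -> 'cV[R]_2) (l : 'cV[R]_2) :
  l != 0 -> (forall k, w k != 0) -> dirto U w l -> mxcvg U (fun k => xi (w k)) (xi l).
Proof.
move=> l0 w0 [c c0 [h0 h1]] i j; apply/cvgrPdist_lt => e e0.
case: plm => _ _ hc _ _; have [d d0 hd] := hc l l0 e e0.
have d20 : 0 < d / 3 by rewrite divr_gt0.
move/cvgrPdist_lt : h0 => /(_ _ d20) h0; move/cvgrPdist_lt : h1 => /(_ _ d20) h1.
apply: (filterS3 _ _ c0 h0 h1) => k ck w0k w1k.
have cw0 : c k *: w k != 0 by rewrite scaler_eq0 negb_or ck w0.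
rewrite -(limit_mapZ (w0 k) ck); apply: le_lt_trans (fdist_entry _ _ _ _) (hd _ cw0 _).
apply: le_lt_trans (fdist_le_n1 _ _) _.
rewrite /n1 !big_ord_recl !big_ord0 !addr0 !mxE.
rewrite (_ : lift ord0 ord0 = 1 :> 'I_2); last exact/val_inj.
by have := w0k; have := w1k; lra.
Qed.

(** The coefficient makes the cyclic product a fourth power, positive for either orientation of [a],
    [b]. *)
Lemma det2_between a b : det2 a b != 0 -> cyc_pos a (a - det2 a b *: b) b.
Proof.
move=> ab; rewrite /cyc_pos.
have -> : det2 a (a - det2 a b *: b) * det2 (a - det2 a b *: b) b * det2 b a = (det2 a b ^+ 2) ^+ 2.
  by rewrite /det2 !mxE; ring.
by rewrite exprn_even_gt0//= expf_eq0.
Qed.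

Lemma between_neq0 a b : det2 a b != 0 -> a - det2 a b *: b != 0.
Proof.
move=> ab; apply: (@det2_neq0l _ _ b).
have -> : det2 (a - det2 a b *: b) b = det2 a b by rewrite /det2 !mxE; ring.
exact: ab.
Qed.

Lemma limit_map_pos u v w : u != 0 -> v != 0 -> w != 0 -> cyc_pos u v w ->
  lag_pos (xi u) (xi v) (xi w).
Proof. by case: plm => _ _ _ _; exact. Qed.

Lemma limit_map_transverse a b : det2 a b != 0 -> transverse (xi a) (xi b).
Proof.
move=> ab; have a0 := det2_neq0l ab; have b0 := det2_neq0r ab.
have [_ _ _ [_ _ t] _] := limit_map_pos a0 (between_neq0 ab) b0 (det2_between ab).
exact: t.
Qed.

Lemma cyc_pos_mulmx (M : 'M[R]_2) u v w : \det M = 1 -> cyc_pos u v w ->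
  cyc_pos (M *m u) (M *m v) (M *m w).
Proof. by move=> dM; rewrite /cyc_pos !det2_mulmx dM !mul1r. Qed.

(** The triple (v, u, w) stays positive under the group, and its form at [x] is preserved. As [u]
    and [w] are both attracted to [b] while [v] goes to [a], transverse to [b], pinching shortens
    the image of [x]. *)
Lemma limit_map_contract (U : set_system nat) (g : nat -> G) v a b x :
  ProperFilter U -> v != 0 -> conical U (fun k => iota (g k)) v a b -> in_lag (xi v) x ->
  n1 (rho_mx rhos (g k) *m x) @[k --> U] --> 0.
Proof.
move=> PU v0 [ca cb ab] xv; have FU : Filter U by apply: PU.
have a0 := det2_neq0l ab; have b0 := det2_neq0r ab.
pose w := v2 (- v 1 0) (v 0 0).
have vw : det2 v w != 0.
  rewrite /det2 v2E0 v2E1 mulrN opprK -!expr2 paddr_eq0 ?sqr_ge0// !expf_eq0 /=.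
  by move: v0; rewrite {1}(v2P v) v2_eq0.
have w0 := det2_neq0r vw.
pose u := v - det2 v w *: w.
have u0 : u != 0 := between_neq0 vw.
have cyc : cyc_pos v u w := det2_between vw.
have uv : det2 u v != 0.
  have -> : det2 u v = det2 v w ^+ 2 by rewrite /u /det2 !mxE; ring.
  by rewrite expf_eq0.
have wv : det2 w v != 0 by rewrite det2C oppr_eq0.
have gn k (z : 'cV[R]_2) : z != 0 -> iota (g k) *m z != 0 by move=> z0; rewrite unit_vec_neq0.
have cP := limit_map_cvg FU a0 (fun k => gn k v v0) ca.
have cQ := limit_map_cvg FU b0 (fun k => gn k u u0) (cb u uv).
have cW := limit_map_cvg FU b0 (fun k => gn k w w0) (cb w wv).
have [Lv Lu Lw [tvu tuw tvw] _] := limit_map_pos v0 u0 w0 cyc.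
have [q [y' [uq wy' xE]]] := transverse_decomp x Lu Lw tuw.
pose y := - y'.
have wy : in_lag (xi w) y by rewrite /y -scaleN1r; exact: in_lagZ.
have uxy : in_lag (xi u) (x + y) by rewrite xE /y addrK.
have [N hN] := transverse_left_inverse (limit_map_lag a0) (limit_map_lag b0) (limit_map_transverse ab).
(* On the Lagrangian at the image of [v], [z] is [N] applied to its part outside the third
   Lagrangian, up to an error at most half of [z]: this gives the constant [2 * n1 N], and 1 is
   added for positivity. *)
pose c : R := (2 * n1 N + 1)^-1.
have N0 := n1_ge0 N.
have c0 : 0 < c by rewrite invr_gt0 ltr_wpDl// mulr_ge0.
have cM : mxcvg U (fun k => N *m (1%:M - xi (iota (g k) *m w)) *m xi (iota (g k) *m v) - xi (iota (g k) *m v)) 0.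
  rewrite -(subrr (xi a)) -{1}hN; apply: mxcvgB => //; apply: mxcvgM => //; apply: mxcvgM => //.
    exact: mxcvg_cst.
  by apply: mxcvgB => //; exact: mxcvg_cst.
have cQW : mxcvg U (fun k => xi (iota (g k) *m u) - xi (iota (g k) *m w)) 0.
  by rewrite -(subrr (xi b)); exact: mxcvgB.
have h20 : 0 < 2^-1 :> R by rewrite invr_gt0.
have nM := cvg0_norm_lt FU h20 (mxcvg_n1 FU cM).
have K0 : 0 <= pinch_const (R := R) (n := n).
  by rewrite /pinch_const mulr_ge0 ?exprn_ge0 ?n1_ge0.
have q0 : 0 <= - omega x y.
  rewrite oppr_ge0; have [->|x0] := eqVneq x 0.
    by rewrite -(scale0r (0 : 'cV[R]_(n + n))) omegaZl mul0r.
  by have [_ _ _ _ neg] := limit_map_pos v0 u0 w0 cyc; apply: ltW; exact: neg.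
apply/cvgrPdist_le => e e0.
pose B := pinch_const (R := R) (n := n) * (2 * - omega x y) + 1.
have B0 : 0 < B by rewrite /B ltr_wpDl// mulr_ge0// mulr_ge0.
(* The first bound is the closeness required by [lag_pinching], the second makes its conclusion read
   [n1 X ^+ 2 <= e ^+ 2]. *)
pose eta := Num.min (c / 2) (c ^+ 3 * e ^+ 2 / B).
have eta0 : 0 < eta by rewrite lt_min !divr_gt0// mulr_gt0// exprn_gt0.
have nQW := cvg0_norm_lt FU eta0 (mxcvg_n1 FU cQW).
apply: (filterS2 _ _ nM nQW) => k Mk QWk.
rewrite sub0r normrN (ger0_norm (n1_ge0 _)).
set X := rho_mx rhos (g k) *m x; pose Y := rho_mx rhos (g k) *m y.
have pos : lag_pos (xi (iota (g k) *m v)) (xi (iota (g k) *m u)) (xi (iota (g k) *m w)).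
  by apply: limit_map_pos; rewrite ?gn//; exact: cyc_pos_mulmx (di _) cyc.
have PX := limit_map_act (g k) v0 xv.
have WY := limit_map_act (g k) w0 wy.
have QXY : in_lag (xi (iota (g k) *m u)) (X + Y).
  by rewrite -mulmxDr; exact: limit_map_act.
have hc z : in_lag (xi (iota (g k) *m v)) z -> c * n1 z <= n1 ((1%:M - xi (iota (g k) *m w)) *m z).
  move=> zP; rewrite /c mulrC ler_pdivrMr; last by rewrite ltr_wpDl// mulr_ge0.
  set M := N *m _ *m _ - _ in Mk.
  have e1 : z = N *m ((1%:M - xi (iota (g k) *m w)) *m z) - M *m z.
    have -> : M *m z = N *m ((1%:M - xi (iota (g k) *m w)) *m z) - z.
      by rewrite /M [LHS]mulmxBl zP -!mulmxA zP.
    by rewrite opprB addrC subrK.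
  have : n1 z <= n1 N * n1 ((1%:M - xi (iota (g k) *m w)) *m z) + 2^-1 * n1 z.
    rewrite {1}e1; apply: le_trans (n1D _ _) _; rewrite n1N; apply: lerD; first exact: n1M.
    apply: le_trans (n1M _ _) _; rewrite ler_wpM2r ?n1_ge0//.
    by apply: ltW; apply: le_lt_trans Mk; rewrite ler_norm.
  have := n1_ge0 ((1%:M - xi (iota (g k) *m w)) *m z).
  set t := n1 ((1%:M - _) *m z); rewrite mulrDr mulr1 mulrCA (mulrC t); lra.
have eta2 : eta <= c / 2 by rewrite ge_min lexx.
have QWe : n1 (xi (iota (g k) *m u) - xi (iota (g k) *m w)) <= eta.
  by apply: ltW; apply: le_lt_trans QWk; rewrite ler_norm.
have := lag_pinching pos PX WY QXY c0 eta2 hc QWe.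
rewrite omega_rho => pinch.
rewrite -(ler_pXn2r (n := 2)) ?nnegrE ?n1_ge0 ?(ltW e0)//.
have c30 : 0 < c ^+ 3 by rewrite exprn_gt0.
rewrite -(ler_pM2l c30); apply: le_trans pinch _.
apply: (@le_trans _ _ (B * eta)).
  by rewrite ler_wpM2r ?(ltW eta0)// /B lerDl.
apply: (@le_trans _ _ (B * (c ^+ 3 * e ^+ 2 / B))).
  by rewrite ler_wpM2l ?(ltW B0)// ge_min lexx orbT.
by rewrite mulrC divfK// lt0r_neq0.
Qed.

Lemma limit_map_split v : v != 0 -> split_mx (xi v).
Proof.
move=> v0; apply: lag_split; first exact: limit_map_lag.
move=> i x y xv yv.
have [g [U PU [a [b con]]]] := conical_exists surf v0.
have FU : Filter U by apply: PU.
have cx := limit_map_contract PU v0 con xv.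
have cy := limit_map_contract PU v0 con yv.
have c0 : 2 * (n1 (rho_mx rhos (g k) *m x) * n1 (rho_mx rhos (g k) *m y)) @[k --> U] --> 2 * (0 * 0 : R).
  by apply: cvgM; [exact: cvg_cst|exact: cvgM].
rewrite mulr0 mulr0 in c0.
have inv k : det2 (pr i (rho_mx rhos (g k) *m x)) (pr i (rho_mx rhos (g k) *m y)) = det2 (pr i x) (pr i y).
  by rewrite !pr_rho det2_mulmx drhos mul1r.
apply/eqP; rewrite -normr_le0; apply/ler_addgt0Pr => e e0; rewrite add0r.
have /(@filter_ex _ U PU)[k hk] := cvg0_norm_lt FU e0 c0.
rewrite -(inv k); apply: le_trans (pr_det2_n1 _ _ _) _.
by apply: ltW; apply: le_lt_trans hk; rewrite ler_norm.
Qed.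

End LimitMap.

(** * Rank-one projections of the plane and slopes *)

Section Projections.
Context {R : realType}.
Implicit Types (p A : 'M[R]_2) (u w : 'cV[R]_2).

Lemma proj2E p : proj2 p -> [/\ p 1 0 = p 0 1, p 0 0 = 1 - p 1 1 & p 0 1 ^+ 2 = p 1 1 * (1 - p 1 1)].
Proof.
move=> [pT pp tr]; have e10 : p 1 0 = p 0 1 by rewrite -{1}pT mxE.
split=> //; first lra.
have := congr1 (fun M : 'M[R]_2 => M 1 1) pp; rewrite mulmx22 e10 -expr2 => e.
by transitivity (p 1 1 - p 1 1 * p 1 1); [lra|ring].
Qed.

Lemma proj2_line p u w : proj2 p -> p *m u = u -> p *m w = w -> det2 u w = 0.
Proof.
move=> pp <- <-; rewrite det2_mulmx det22.
by have [-> -> e] := proj2E pp; rewrite -expr2 e; ring.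
Qed.

Lemma proj2_conj p A : proj2 p -> A *m A^T = 1%:M -> A^T *m A = 1%:M -> proj2 (A^T *m p *m A).
Proof.
move=> [pT pp tr] A1 A2; split.
- by rewrite !trmx_mul trmxK pT mulmxA.
- by rewrite !mulmxA -(mulmxA _ A A^T) A1 mulmx1 -(mulmxA A^T) pp.
- have trE (M : 'M[R]_2) : M 0 0 + M 1 1 = \tr M.
    by rewrite /mxtrace !big_ord_recl big_ord0 addr0; congr (_ + M _ _); apply/val_inj.
  by rewrite trE mxtrace_mulC mulmxA A1 mul1mx -trE.
Qed.

Lemma proj2_rotation p : proj2 p -> exists A, [/\ A *m A^T = 1%:M, A^T *m A = 1%:M, \det A = 1 &
  (A^T *m p *m A) 0 1 = 0 /\ (A^T *m p *m A) 1 1 = 0].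
Proof.
move=> pp; have [e10 e00 e01] := proj2E pp.
suff [f0 [f1 [ff pf0 pf1]]] : exists f0 f1, [/\ f0 ^+ 2 + f1 ^+ 2 = 1,
    p 0 0 * f0 + p 0 1 * f1 = f0 & p 0 1 * f0 + p 1 1 * f1 = f1].
  pose A : 'M[R]_2 := \matrix_(i, j) (if i == 0 then (if j == 0 then f0 else - f1)
                                      else (if j == 0 then f1 else f0)).
  exists A; rewrite !expr2 in ff.
  have h (M N : 'M[R]_2) : (forall i j, M i j = N i j) -> M = N by move=> ?; apply/matrixP.
  split.
  - apply: h => i j; have [->|->] := ord2P i; have [->|->] := ord2P j;
      by rewrite mulmx22 !mxE /= ?mulr1n ?mulr0n; lra.
  - apply: h => i j; have [->|->] := ord2P i; have [->|->] := ord2P j;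
      by rewrite mulmx22 !mxE /= ?mulr1n ?mulr0n; lra.
  - by rewrite det22 !mxE /=; lra.
  - have pf : p *m v2 f0 f1 = v2 f0 f1.
      by rewrite mulmx_v2 !v2E0 !v2E1 e10 pf0 pf1.
    have c0 : (A^T *m p *m A) 0 1 = 0.
      rewrite -mulmxA mulmx22 !mulmx22 !mxE /= e10.
      transitivity (- f1 * (p 0 0 * f0 + p 0 1 * f1) + f0 * (p 0 1 * f0 + p 1 1 * f1)); first ring.
      by rewrite pf0 pf1; ring.
    split => //.
    rewrite -mulmxA mulmx22 !mulmx22 !mxE /= e10.
    transitivity ((p 0 0 + p 1 1) * (f0 * f0 + f1 * f1)
      - (f0 * (p 0 0 * f0 + p 0 1 * f1) + f1 * (p 0 1 * f0 + p 1 1 * f1))); first ring.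
    by rewrite pf0 pf1 e00; lra.
(* A unit vector of the line: the first column of [p] normalised, its squared norm being [p 0 0], or
   the second basis vector when that column vanishes. *)
have [p00|p00] := eqVneq (p 0 0) 0.
  exists 0, 1; have p11 : p 1 1 = 1 by lra.
  have p01 : p 0 1 = 0 by apply/eqP; rewrite -sqrf_eq0 e01 p11 subrr mulr0.
  by split; [ring|rewrite p01; ring|rewrite p01 p11; ring].
have pos : 0 < p 0 0.
  rewrite lt_neqAle eq_sym p00 /=.
  have -> : p 0 0 = p 0 0 ^+ 2 + p 0 1 ^+ 2 by rewrite e01 e00; ring.
  by rewrite addr_ge0// sqr_ge0.
have s0 : Num.sqrt (p 0 0) != 0 by rewrite lt0r_neq0// sqrtr_gt0.
exists (p 0 0 / Num.sqrt (p 0 0)), (p 0 1 / Num.sqrt (p 0 0)); split.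
- rewrite !exprMn exprVn sqr_sqrtr ?(ltW pos)// e01 e00.
  by field; rewrite -e00.
- rewrite !mulrA -mulrDl; congr (_ / _).
  transitivity (p 0 0 ^+ 2 + p 0 1 ^+ 2); first by ring.
  by rewrite e01 e00; ring.
- by rewrite !mulrA -mulrDl; congr (_ / _); rewrite e00; ring.
Qed.

Lemma proj2_slope p : proj2 p -> p 1 1 != 0 ->
  let s := p 0 1 / p 1 1 in
  [/\ p 1 1 = (1 + s ^+ 2)^-1, p 0 1 = s / (1 + s ^+ 2) & p *m v2 s 1 = v2 s 1].
Proof.
move=> pp d0 s; have [e10 e00 e01] := proj2E pp.
have s2 : 1 + s ^+ 2 = (p 1 1)^-1.
  by rewrite /s exprMn exprVn e01; field.
split.
- by rewrite s2 invrK.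
- by rewrite s2 invrK /s divfK.
- rewrite mulmx_v2 !v2E0 !v2E1 e10 e00 !mulr1; congr v2.
    by rewrite /s; field.
  have -> : p 0 1 * s = p 0 1 ^+ 2 / p 1 1 by rewrite /s expr2 mulrA.
  by rewrite e01; field.
Qed.

(** The entries of the projection onto the line of slope [s] are globally Lipschitz in [s]; only the
    converse estimate degenerates near infinity. *)
Lemma slope_lipschitz (s t : R) :
  `|(1 + s ^+ 2)^-1 - (1 + t ^+ 2)^-1| <= `|s - t| /\
  `|s / (1 + s ^+ 2) - t / (1 + t ^+ 2)| <= `|s - t|.
Proof.
have s0 : 0 < 1 + s ^+ 2 by rewrite ltr_pwDl// sqr_ge0.
have t0 : 0 < 1 + t ^+ 2 by rewrite ltr_pwDl// sqr_ge0.
have st0 := mulr_gt0 s0 t0.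
have sn := lt0r_neq0 s0; have tn := lt0r_neq0 t0.
have key (x : R) : - ((1 + s ^+ 2) * (1 + t ^+ 2)) <= x <= (1 + s ^+ 2) * (1 + t ^+ 2) ->
    `|(s - t) * (x / ((1 + s ^+ 2) * (1 + t ^+ 2)))| <= `|s - t|.
  rewrite -ler_norml => hx; rewrite normrM -[leRHS]mulr1 ler_wpM2l//.
  by rewrite normrM normfV (gtr0_norm st0) ler_pdivrMr// mul1r.
have q1 := sqr_ge0 (s + t); have q2 := sqr_ge0 (s - t); have q3 := sqr_ge0 (s * t).
have q4 := sqr_ge0 (s + t - 1); have q5 := sqr_ge0 (s + t + 1).
have q6 := sqr_ge0 (s + t); have q7 := sqr_ge0 s; have q8 := sqr_ge0 t.
split.
  have -> : (1 + s ^+ 2)^-1 - (1 + t ^+ 2)^-1 = (s - t) * (- (s + t) / ((1 + s ^+ 2) * (1 + t ^+ 2))).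
    by field; rewrite sn tn.
  apply: key; nra.
have -> : s / (1 + s ^+ 2) - t / (1 + t ^+ 2) = (s - t) * ((1 - s * t) / ((1 + s ^+ 2) * (1 + t ^+ 2))).
  by field; rewrite sn tn.
apply: key; nra.
Qed.

End Projections.

(** * Charts *)

Lemma mxBE (R : zmodType) m k (M N : 'M[R]_(m, k)) a b : (M - N) a b = M a b - N a b.
Proof. by rewrite !mxE. Qed.

Section Charts.
Context {R : realType} (G : groupType) (iota : G -> 'M[R]_2) (n : nat).
Context (rhos : 'I_n -> G -> 'M[R]_2) (xi : 'cV[R]_2 -> 'M[R]_(n + n)).
Hypothesis surf : closed_surface_group_in_PSL2 iota.
Hypothesis drhos : forall i g, \det (rhos i g) = 1.
Hypothesis plm : positive_limit_map iota (rho_mx rhos) xi.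
Variables (i : 'I_n) (A : 'M[R]_2).
Hypotheses (AAT : A *m A^T = 1%:M) (ATA : A^T *m A = 1%:M) (dA : \det A = 1).

Definition chart_proj (P : 'M[R]_(n + n)) : 'M[R]_2 := A^T *m blk i P *m A.

Hypothesis chart_e1 : chart_proj (xi (v2 1 0)) 0 1 = 0 /\ chart_proj (xi (v2 1 0)) 1 1 = 0.

Definition slope (P : 'M[R]_(n + n)) : R := chart_proj P 0 1 / chart_proj P 1 1.
Definition chart (t : R) : R := slope (xi (v2 t 1)).
Definition chart_rep (g : G) : 'M[R]_2 := A^T *m rhos i g *m A.

Implicit Types (u v w : 'cV[R]_2).
Local Notation q v := (chart_proj (xi v)).

Let di g : \det (iota g) = 1. Proof. by case: surf. Qed.
Let e1_neq0 : v2 1 0 != 0 :> 'cV[R]_2. Proof. by rewrite v2_eq0 oner_eq0. Qed.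

Lemma chart_proj2 v : v != 0 -> proj2 (q v).
Proof.
move=> v0; apply: proj2_conj => //; apply: split_proj2.
  exact: (limit_map_lag plm v0).
exact: (limit_map_split surf drhos plm v0).
Qed.

Lemma chart_rep_det g : \det (chart_rep g) = 1.
Proof. by rewrite /chart_rep !det_mulmx det_tr dA drhos !mulr1. Qed.

Lemma chart_par v w : v != 0 -> w != 0 -> det2 v w = 0 -> q v = q w.
Proof. by move=> v0 w0 vw; rewrite (limit_map_par plm v0 w0 vw). Qed.

Lemma chart_fix_lag v u : v != 0 -> q v *m u = u -> in_lag (xi v) (emb i (A *m u)).
Proof.
move=> v0 qu; apply: split_lag_emb; first exact: (limit_map_split surf drhos plm v0).
by rewrite -[in RHS]qu /chart_proj !mulmxA AAT mul1mx.
Qed.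

Lemma chart_fix_e1 : q (v2 1 0) *m v2 1 0 = v2 1 0.
Proof.
have [e10 e00 _] := proj2E (chart_proj2 e1_neq0); have [h01 h11] := chart_e1.
by rewrite mulmx_v2 !v2E0 !v2E1 e10 e00 h01 h11; congr v2; ring.
Qed.

Lemma emb_neq0 u : u != 0 -> emb i (A *m u) != 0 :> 'cV[R]_(n + n).
Proof.
move=> u0; apply: contraNneq (unit_vec_neq0 dA u0) => e.
by have := pr_emb i i (A *m u); rewrite eqxx e pr0 => <-.
Qed.

(** A vanishing denominator would put the i-th line at [v] on the i-th line at infinity, against
    transversality of the two Lagrangians. *)
Lemma chart_den_neq0 v : v 1 0 != 0 -> q v 1 1 != 0.
Proof.
move=> v1; have v0 : v != 0 by apply: contraNneq v1 => ->; rewrite mxE.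
apply/eqP => d0.
have [e10 e00 e01] := proj2E (chart_proj2 v0).
have q01 : q v 0 1 = 0 by apply/eqP; rewrite -sqrf_eq0 e01 d0 mul0r.
have fixv : q v *m v2 1 0 = v2 1 0.
  by rewrite mulmx_v2 !v2E0 !v2E1 e10 e00 q01 d0; congr v2; ring.
have ve1 : det2 v (v2 1 0) != 0.
  by rewrite /det2 v2E0 v2E1 mulr0 mulr1 sub0r oppr_eq0.
have := limit_map_transverse plm ve1 (chart_fix_lag v0 fixv) (chart_fix_lag e1_neq0 chart_fix_e1).
by apply/eqP; rewrite emb_neq0.
Qed.

Lemma chart_fix v : v != 0 -> q v *m plift chart v = plift chart v.
Proof.
move=> v0; rewrite /plift; case: (eqVneq (v 1 0) 0) => v1.
  rewrite (chart_par v0 e1_neq0) ?chart_fix_e1//.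
  by rewrite /det2 v2E0 v2E1 v1; ring.
have par : det2 v (v2 (v 0 0 / v 1 0) 1) = 0 by rewrite /det2 v2E0 v2E1; field.
rewrite (chart_par v0 (v2x1_neq0 _) par).
have := chart_den_neq0 (v := v2 (v 0 0 / v 1 0) 1); rewrite v2E1 oner_neq0 => /(_ isT) d0.
by have [_ _] := proj2_slope (chart_proj2 (v2x1_neq0 (v 0 0 / v 1 0))) d0.
Qed.

Lemma chart_equivariant g : circle_equivariant (iota g) (chart_rep g) chart.
Proof.
move=> w w0; have gw0 : iota g *m w != 0 by rewrite unit_vec_neq0.
apply: (proj2_line (chart_proj2 gw0)); last exact: chart_fix.
have := limit_map_act plm g w0 (chart_fix_lag w0 (chart_fix w0)) => /(congr1 (pr i)).
rewrite (limit_map_split surf drhos plm gw0) pr_rho pr_emb eqxx => h.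
by rewrite /chart_proj /chart_rep -!mulmxA (mulmxA A) AAT mul1mx h.
Qed.

(** For the positive triple (t1, t2, infinity), the negative form evaluated on the i-th line at t1
    is [chart t1 - chart t2]. *)
Lemma chart_incr t1 t2 : t1 < t2 -> chart t1 < chart t2.
Proof.
move=> t12; have n1 := v2x1_neq0 t1; have n2 := v2x1_neq0 t2.
have cyc : cyc_pos (v2 t1 1) (v2 t2 1) (v2 1 0) by rewrite /cyc_pos !det2_v2; lra.
have [L1 _ _ _ neg] := limit_map_pos plm n1 n2 e1_neq0 cyc.
have f1 := chart_fix n1; have f2 := chart_fix n2; rewrite !plift_v2 in f1 f2.
pose y := v2 (chart t2 - chart t1) 0.
have fy : q (v2 1 0) *m y = y.
  have -> : y = (chart t2 - chart t1) *: v2 1 0 by rewrite scale_v2 mulr1 mulr0.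
  by rewrite -scalemxAr chart_fix_e1.
have := neg _ _ (chart_fix_lag n1 f1) (chart_fix_lag e1_neq0 fy).
rewrite emb_neq0 ?v2x1_neq0// => /(_ isT).
have -> : emb i (A *m v2 (chart t1) 1) + emb i (A *m y) = emb i (A *m v2 (chart t2) 1) :> 'cV[R]_(n + n).
  apply: pr_ext => j; rewrite prD !pr_emb; case: ifP => _; last by rewrite addr0.
  rewrite -mulmxDr; congr (_ *m _); rewrite [LHS]v2P !mxE /=; congr v2; ring.
move=> /(_ (chart_fix_lag n2 f2)).
rewrite omegaE (bigD1 i)//= big1 => [|j ji]; last first.
  by rewrite !pr_emb (negPf ji) /det2 !mxE; ring.
by rewrite !pr_emb eqxx det2_mulmx dA det2_v2; lra.
Qed.

Lemma chart_mono : {mono chart : x y / x <= y}.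
Proof. by apply: le_mono => x y; exact: chart_incr. Qed.

Lemma chart_proj_entry P Q s t :
  `|chart_proj P s t - chart_proj Q s t| <= 4 * (n1 A ^+ 2 * fdist P Q).
Proof.
have -> : chart_proj P s t - chart_proj Q s t = (A^T *m (blk i P - blk i Q) *m A) s t.
  by rewrite mulmxBr mulmxBl mxBE.
apply: le_trans (n1_entry _ _ _) _; apply: le_trans (n1M _ _) _.
have nT : n1 A^T = n1 A.
  by rewrite /n1 exchange_big; apply: eq_bigr => a _; apply: eq_bigr => b _; rewrite mxE.
have h : n1 (blk i P - blk i Q) <= 4 * fdist P Q.
  rewrite /n1 !big_ord_recl !big_ord0 !addr0.
  have e a b : `|(blk i P - blk i Q) a b| <= fdist P Q.
    by rewrite mxBE; exact: blk_entry.
  have := e ord0 ord0; have := e ord0 (lift ord0 ord0).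
  have := e (lift ord0 ord0) ord0; have := e (lift ord0 ord0) (lift ord0 ord0).
  lra.
apply: (@le_trans _ _ (n1 A * (4 * fdist P Q) * n1 A)); last first.
  by rewrite le_eqVlt; apply/orP; left; apply/eqP; ring.
rewrite ler_wpM2r ?n1_ge0//; apply: le_trans (n1M _ _) _; rewrite nT.
by rewrite ler_wpM2l ?n1_ge0.
Qed.

Lemma chart_proj_cvg (v : 'cV[R]_2) (s t : 'I_2) (e : R) : v != 0 -> 0 < e -> exists2 d : R, 0 < d &
  forall w, w != 0 -> fdist v w < d -> `|q v s t - q w s t| < e.
Proof.
move=> v0 e0; have A0 := n1_ge0 A.
have k0 : 0 < 4 * n1 A ^+ 2 + 1 by rewrite ltr_wpDl// mulr_ge0// exprn_ge0.
have ek : 0 < e / (4 * n1 A ^+ 2 + 1) by rewrite divr_gt0.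
case: plm => _ _ cont _ _; have [d d0 hd] := cont v v0 _ ek.
exists d => // w w0 vw; apply: le_lt_trans (chart_proj_entry _ _ _ _) _.
have := hd w w0 vw; rewrite ltr_pdivlMr//; apply: le_lt_trans.
have := fdist_ge0 (xi v) (xi w).
by rewrite mulrDr mulr1 mulrA mulrC => ?; rewrite lerDl.
Qed.

Lemma fdist_v2 a b c d : fdist (v2 a b : 'cV[R]_2) (v2 c d) <= `|a - c| + `|b - d|.
Proof.
apply: le_trans (fdist_le_n1 _ _) _.
by rewrite /n1 !big_ord_recl !big_ord0 !addr0 !mxE.
Qed.

Lemma chart_continuous : continuous chart.
Proof.
move=> t; have d0 := chart_den_neq0 (v := v2 t 1); rewrite v2E1 oner_neq0 in d0.
have {}d0 := d0 isT.
have ent a b : q (v2 x 1) a b @[x --> t] --> q (v2 t 1) a b.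
  apply/cvgrPdist_lt => e e0; have [d dp hd] := chart_proj_cvg a b (v2x1_neq0 t) e0.
  apply/nbhs_ballP; exists d => //= x tx; apply: hd; first exact: v2x1_neq0.
  by apply: le_lt_trans (fdist_v2 _ _ _ _) _; rewrite subrr normr0 addr0.
by apply: cvgM; [exact: ent|apply: cvgV => //; exact: ent].
Qed.

(** As [t] goes to either end, the denominator [1 / (1 + chart t ^+ 2)] tends by continuity to its
    value 0 at infinity. *)
Lemma chart_unbounded (K : R) : exists2 T : R, 0 < T & forall t, T < `|t| -> K < `|chart t|.
Proof.
have K0 : 0 < (1 + K ^+ 2)^-1 by rewrite invr_gt0 ltr_pwDl// sqr_ge0.
have [d d0 hd] := chart_proj_cvg 1 1 e1_neq0 K0.
exists d^-1; first by rewrite invr_gt0.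
move=> t dt; have t0 : 0 < `|t| by rewrite (lt_trans _ dt)// invr_gt0.
have tn0 : t != 0 by rewrite -normr_gt0.
have den := chart_den_neq0 (v := v2 t 1); rewrite v2E1 oner_neq0 in den.
have [s1 _ _] := proj2_slope (chart_proj2 (v2x1_neq0 t)) (den isT).
have par : q (v2 t 1) = q (v2 1 t^-1).
  apply: chart_par; rewrite ?v2x1_neq0 ?v2_eq0 ?oner_eq0//.
  by rewrite det2_v2; field.
have := hd (v2 1 t^-1); rewrite v2_eq0 oner_eq0 /= => /(_ isT).
have -> : fdist (v2 1 0 : 'cV[R]_2) (v2 1 t^-1) < d.
  apply: le_lt_trans (fdist_v2 _ _ _ _) _; rewrite subrr normr0 add0r sub0r normrN normfV.
  by rewrite -[ltRHS]invrK ltf_pV2 ?posrE ?invr_gt0.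
have [_ h11] := chart_e1.
move=> /(_ isT); rewrite -par s1 -/(slope _) -/(chart t) h11 sub0r normrN.
have c0 : 0 < 1 + chart t ^+ 2 by rewrite ltr_pwDl// sqr_ge0.
rewrite ger0_norm; last by rewrite invr_ge0 ltW.
have K1' : 0 < 1 + K ^+ 2 by rewrite ltr_pwDl// sqr_ge0.
rewrite ltf_pV2 ?posrE// ltrD2l => h.
rewrite -(real_normK (num_real (chart t))) in h.
have [K1|K1] := ltP K 0; first by rewrite (lt_le_trans K1).
by move: h; rewrite ltr_sqr ?nnegrE.
Qed.

Lemma chart_homeo : exists psi, incr_homeo chart psi.
Proof.
apply: incr_homeo_of_surj; first exact: chart_mono.
move=> y; have [T T0 hT] := chart_unbounded (`|chart 0| + `|y|).
pose a := - (T + 1); pose b := T + 1.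
have hb : `|chart 0| + `|y| < `|chart b|.
  by apply: hT; rewrite ger0_norm /b; lra.
have ha : `|chart 0| + `|y| < `|chart a|.
  by apply: hT; rewrite normrN ger0_norm; lra.
have c0b : chart 0 < chart b by apply: chart_incr; rewrite /b; lra.
have ca0 : chart a < chart 0 by apply: chart_incr; rewrite /a; lra.
have yb : y <= chart b.
  have := ler_norm y; have := ler_norm (- chart 0); have := normr_ge0 y.
  have := normr_ge0 (chart 0); rewrite normrN; move: hb.
  by have [h|h] := leP 0 (chart b); [rewrite (ger0_norm h)|rewrite (ltr0_norm h)]; lra.
have ay : chart a <= y.
  have := ler_norm (- y); have := ler_norm (chart 0); have := normr_ge0 y.
  have := normr_ge0 (chart 0); rewrite normrN; move: ha.
  by have [h|h] := leP 0 (chart a); [rewrite (ger0_norm h)|rewrite (ltr0_norm h)]; lra.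
have [||| x _ xE] := @IVT R chart a b y.
- by rewrite /a /b; lra.
- by apply: continuous_subspaceT; exact: chart_continuous.
- by rewrite ge_min le_max ay yb orbT.
by exists x.
Qed.

Lemma chart_lower_lipschitz (K : R) : exists2 L : R, 0 < L & forall t t',
  `|chart t| <= K -> `|chart t'| <= K ->
  `|chart t - chart t'| <= L * fdist (xi (v2 t 1)) (xi (v2 t' 1)).
Proof.
pose k := 1 + K ^+ 2; have k0 : 0 < k by rewrite ltr_pwDl// sqr_ge0.
have A0 := n1_ge0 A.
exists (k ^+ 2 * (8 * n1 A ^+ 2) + 1); first by rewrite ltr_wpDl// !mulr_ge0 ?exprn_ge0// ltW.
move=> t t' tK t'K.
have main x : `|chart x| <= K -> [/\ k^-1 <= q (v2 x 1) 1 1, q (v2 x 1) 1 1 <= 1,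
    `|q (v2 x 1) 0 1| <= 1 & chart x = q (v2 x 1) 0 1 / q (v2 x 1) 1 1].
  move=> xK; have den := chart_den_neq0 (v := v2 x 1); rewrite v2E1 oner_neq0 in den.
  have pp := chart_proj2 (v2x1_neq0 x).
  have [s1 _ _] := proj2_slope pp (den isT); have [_ _ e01] := proj2E pp.
  have c0 : 0 < 1 + chart x ^+ 2 by rewrite ltr_pwDl// sqr_ge0.
  have d0 : 0 < q (v2 x 1) 1 1 by rewrite s1 invr_gt0.
  have d1 : q (v2 x 1) 1 1 <= 1 by rewrite s1 invf_le1// lerDl sqr_ge0.
  split => //.
    rewrite s1 lef_pV2 ?posrE// /k lerD2l -(real_normK (num_real (slope _))).
    by rewrite ler_sqr ?nnegrE// (le_trans _ xK).
  rewrite -(ler_pXn2r (n := 2)) ?nnegrE// real_normK ?num_real// e01 expr1n.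
  have q2 := sqr_ge0 (q (v2 x 1) 1 1 - 1); nra.
have [d1 d2 b1 c1] := main t tK; have [d1' d2' b1' c1'] := main t' t'K.
have fE := chart_proj_entry (xi (v2 t 1)) (xi (v2 t' 1)).
have f01 := fE 0 1; have f11 := fE 1 1; have f0 := fdist_ge0 (xi (v2 t 1)) (xi (v2 t' 1)).
set F := fdist _ _ in f01 f11 f0 *.
rewrite c1 c1'.
move: d1 d2 b1 d1' d2' b1' f01 f11.
set d := q (v2 t 1) 1 1; set d' := q (v2 t' 1) 1 1.
set b := q (v2 t 1) 0 1; set b' := q (v2 t' 1) 0 1 => d1 d2 b1 d1' d2' b1' f01 f11.
have ki : 0 < k^-1 by rewrite invr_gt0.
have dp : 0 < d by rewrite (lt_le_trans ki).
have dp' : 0 < d' by rewrite (lt_le_trans ki).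
have -> : b / d - b' / d' = ((b - b') * d' + b' * (d' - d)) * (d^-1 * d'^-1).
  by field; rewrite !lt0r_neq0.
rewrite normrM [X in _ * X]gtr0_norm ?mulr_gt0 ?invr_gt0//.
apply: (@le_trans _ _ (8 * n1 A ^+ 2 * F * k ^+ 2)).
  apply: ler_pM => //; first by rewrite mulr_ge0// invr_ge0 ltW.
    apply: le_trans (ler_normD _ _) _; rewrite !normrM (gtr0_norm dp') (distrC d' d).
    have h1 : `|b - b'| * d' <= 4 * (n1 A ^+ 2 * F) * 1 by apply: ler_pM => //; exact: ltW.
    have h2 : `|b'| * `|d - d'| <= 1 * (4 * (n1 A ^+ 2 * F)) by apply: ler_pM.
    by lra.
  rewrite expr2; apply: ler_pM; rewrite ?invr_ge0 ?(ltW dp) ?(ltW dp')//.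
    by rewrite -[leRHS]invrK lef_pV2 ?posrE ?invr_gt0.
  by rewrite -[leRHS]invrK lef_pV2 ?posrE ?invr_gt0.
have -> : (k ^+ 2 * (8 * n1 A ^+ 2) + 1) * F = 8 * n1 A ^+ 2 * F * k ^+ 2 + F by ring.
by rewrite lerDl.
Qed.

Lemma chart_blk_lipschitz t t' :
  n1 (blk i (xi (v2 t 1)) - blk i (xi (v2 t' 1))) <= 4 * n1 A ^+ 2 * `|chart t - chart t'|.
Proof.
have bE P : blk i P = A *m chart_proj P *m A^T.
  by rewrite /chart_proj !mulmxA AAT mul1mx -mulmxA AAT mulmx1.
have -> : blk i (xi (v2 t 1)) - blk i (xi (v2 t' 1)) =
    A *m (q (v2 t 1) - q (v2 t' 1)) *m A^T by rewrite !bE mulmxBr mulmxBl.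
have nT : n1 A^T = n1 A.
  by rewrite /n1 exchange_big; apply: eq_bigr => a _; apply: eq_bigr => b _; rewrite mxE.
have A0 := n1_ge0 A.
have main x : [/\ q (v2 x 1) 0 0 = 1 - q (v2 x 1) 1 1, q (v2 x 1) 1 0 = q (v2 x 1) 0 1,
    q (v2 x 1) 1 1 = (1 + chart x ^+ 2)^-1 & q (v2 x 1) 0 1 = chart x / (1 + chart x ^+ 2)].
  have den := chart_den_neq0 (v := v2 x 1); rewrite v2E1 oner_neq0 in den.
  have pp := chart_proj2 (v2x1_neq0 x).
  by have [s1 s2 _] := proj2_slope pp (den isT); have [e1 e2 _] := proj2E pp.
have h : n1 (q (v2 t 1) - q (v2 t' 1)) <= 4 * `|chart t - chart t'|.
  have [l1 l2] := slope_lipschitz (chart t) (chart t').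
  have [t1 t2 t3 t4] := main t; have [t1' t2' t3' t4'] := main t'.
  have e a b : `|(q (v2 t 1) - q (v2 t' 1)) a b| <= `|chart t - chart t'|.
    rewrite mxBE; have [->|->] := ord2P a; have [->|->] := ord2P b.
    - rewrite t1 t1' t3 t3' (_ : 1 - _ - _ = - ((1 + chart t ^+ 2)^-1 - (1 + chart t' ^+ 2)^-1)).
        by rewrite normrN.
      by ring.
    - by rewrite t4 t4'.
    - by rewrite t2 t2' t4 t4'.
    - by rewrite t3 t3'.
  rewrite /n1 !big_ord_recl !big_ord0 !addr0.
  have := e ord0 ord0; have := e ord0 (lift ord0 ord0).
  have := e (lift ord0 ord0) ord0; have := e (lift ord0 ord0) (lift ord0 ord0).
  lra.
apply: le_trans (n1M _ _) _; rewrite nT.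
have -> : 4 * n1 A ^+ 2 * `|chart t - chart t'| = n1 A * (4 * `|chart t - chart t'|) * n1 A by ring.
rewrite ler_wpM2r//; apply: le_trans (n1M _ _) _.
by rewrite ler_wpM2l.
Qed.

End Charts.

(** * Borel sets *)

Section Borel.
Context {R : realType}.

Section borel_sets.
Variables m k : nat.
Implicit Types A B : set 'M[R]_(m, k).

Lemma borel_sigma_closed : sigma_closed (@borel R m k).
Proof.
split=> [S [S0 _ _] _|A bA S sS oS|F bF S sS oS]; first exact: S0.
  by case: (sS) => _ SC _; apply: SC; exact: bA.
by case: (sS) => _ _ SU; apply: SU => i; exact: bF.
Qed.

Lemma borelC A : borel A -> borel (~` A).
Proof. by case: borel_sigma_closed => _ h _; exact: h. Qed.

Lemma borel_bigcup (F : nat -> set 'M[R]_(m, k)) : (forall i, borel (F i)) -> borel (\bigcup_i F i).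
Proof. by case: borel_sigma_closed => _ _; exact. Qed.

Lemma borelI A B : borel A -> borel B -> borel (A `&` B).
Proof.
move=> bA bB; rewrite -[A `&` B]setCK setCI -bigcup2E; apply: borelC; apply: borel_bigcup; case=> [|[|i]] /=.
- exact: borelC.
- exact: borelC.
- by case: borel_sigma_closed.
Qed.

Lemma borelD A B : borel A -> borel B -> borel (A `\` B).
Proof. by move=> bA bB; rewrite setDE; apply: borelI => //; exact: borelC. Qed.

Lemma borel_fopen A : fopen A -> borel A.
Proof. by move=> oA S _; exact. Qed.

Definition fnbhs (P : 'M[R]_(m, k)) : set_system 'M[R]_(m, k) :=
  [set S | exists2 e : R, 0 < e & forall Q, fdist P Q < e -> S Q].

#[global] Instance fnbhs_filter P : Filter (fnbhs P).
Proof.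
split.
- by exists 1.
- move=> A B [e e0 hA] [d d0 hB]; exists (Num.min e d); first by rewrite lt_min e0.
  by move=> Q; rewrite lt_min => /andP[h1 h2]; split; [exact: hA|exact: hB].
- by move=> A B AB [e e0 hA]; exists e => // Q /hA /AB.
Qed.

Lemma fopenP A : (forall P, A P -> fnbhs P A) -> fopen A.
Proof. by []. Qed.

Lemma fnbhs_lipschitz (f : 'M[R]_(m, k) -> R) (L : R) P : 0 <= L ->
  (forall Q, `|f P - f Q| <= L * fdist P Q) -> f Q @[Q --> fnbhs P] --> f P.
Proof.
move=> L0 h; apply/cvgrPdist_lt => e e0.
have L1 : 0 < L + 1 by rewrite ltr_wpDl.
exists (e / (L + 1)); first by rewrite divr_gt0.
move=> Q; rewrite ltr_pdivlMr// => hQ; apply: le_lt_trans (h Q) _.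
apply: le_lt_trans hQ; rewrite mulrC ler_wpM2l ?sqrtr_ge0//; lra.
Qed.

Lemma fnbhs_entry P i j : (Q i j) @[Q --> fnbhs P] --> P i j.
Proof.
by apply: (@fnbhs_lipschitz (fun Q : 'M[R]_(m, k) => Q i j) 1) => // Q; rewrite mul1r; exact: fdist_entry.
Qed.

Lemma borel_measurable_comp (f : R -> 'M[R]_(m, k)) A :
  (forall t (e : R), 0 < e -> exists2 d : R, 0 < d & forall t', `|t - t'| < d -> fdist (f t) (f t') < e) ->
  borel A -> measurable [set t | A (f t)].
Proof.
move=> cf bA; apply: (bA [set B | measurable [set t | B (f t)]]); first split=> /=.
- by rewrite (_ : [set t | _] = set0)// -subset0.
- by move=> B mB; rewrite (_ : [set t | _] = ~` [set t | B (f t)])//; exact: measurableC.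
- move=> F mF; rewrite (_ : [set t | _] = \bigcup_i [set t | F i (f t)])//; exact: bigcupT_measurable.
- move=> U oU; apply: open_measurable; rewrite openE => t /= Ut.
  have [e e0 he] := oU _ Ut; have [d d0 hd] := cf t e e0.
  by apply/nbhs_ballP; exists d => //= t' tt'; apply/he/hd.
Qed.

(** The good sets [D] form a sigma-algebra, and a half-open interval is a difference of two open
    rays, whose preimages in [Om] are open. *)
Lemma borel_ratio (Om : set 'M[R]_(m, k)) (f : 'M[R]_(m, k) -> R) (D : set R) : fopen Om ->
  (forall P, Om P -> f Q @[Q --> fnbhs P] --> f P) -> measurable D -> borel (Om `&` f @^-1` D).
Proof.
move=> oOm cf mD.
have gt a : fopen (Om `&` [set P | a < f P]).
  apply: fopenP => P [OmP aP]; apply: filterI; first exact: oOm.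
  have e0 : 0 < f P - a by rewrite subr_gt0.
  move/cvgrPdist_lt : (cf P OmP) => /(_ _ e0); apply: (filterS _) => Q /=.
  by rewrite ltr_distl => /andP[_]; lra.
have : (R.-ocitv.-measurable).-sigma.-measurable D by exact: mD.
apply: (smallest_sub (X := [set D | borel (Om `&` f @^-1` D)])).
  split => /=.
  - by rewrite preimage_set0 setI0; case: borel_sigma_closed.
  - move=> B bB; rewrite setTD.
    rewrite (_ : _ `&` _ = Om `\` (Om `&` f @^-1` B)); first by apply: borelD => //; exact: borel_fopen.
    apply/seteqP; split=> P /=; first by move=> [OP nB]; split=> // -[].
    by move=> [OP h]; split=> // BP; apply: h.
  - by move=> F bF; rewrite preimage_bigcup setI_bigcupr; exact: borel_bigcup.
move=> _ [[a b] _ <-] /=.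
rewrite (_ : _ `&` _ = (Om `&` [set P | a < f P]) `\` (Om `&` [set P | b < f P])).
  by apply: borelD; apply: borel_fopen.
apply/seteqP; split=> P /=; rewrite in_itv/=.
  by move=> [OP /andP[aP Pb]]; split=> // -[_]; rewrite ltNge Pb.
by move=> [[OP aP] h]; split=> //; rewrite aP /= leNgt; apply/negP => bP; apply: h.
Qed.

End borel_sets.
End Borel.

Section LagAction.
Context {R : realType} (G : groupType) (n : nat) (rhos : 'I_n -> G -> 'M[R]_2).
Hypothesis drhos : forall i g, \det (rhos i g) = 1.

Lemma lag_eq (P Q : 'M[R]_(n + n)) : is_lag P -> is_lag Q ->
  (forall x, in_lag P x <-> in_lag Q x) -> P = Q.
Proof.
move=> LP LQ h; have [PT PP _ _] := LP; have [QT QQ _ _] := LQ.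
have vec_eq (A B : 'M[R]_(n + n)) : (forall u : 'cV[R]_(n + n), A *m u = B *m u) -> A = B.
  by move=> e; apply/matrixP => a b; have := e (delta_mx b 0); rewrite -!colE => /colP/(_ a); rewrite !mxE.
have QP : Q *m P = P by apply: vec_eq => u; rewrite -mulmxA; apply/h; exact: in_lagM.
have PQ : P *m Q = Q by apply: vec_eq => u; rewrite -mulmxA; apply/(h _); exact: in_lagM.
by rewrite -[LHS]PT -{1}QP trmx_mul PT QT.
Qed.

Lemma rho_inj g (x y : 'cV[R]_(n + n)) : rho_mx rhos g *m x = rho_mx rhos g *m y -> x = y.
Proof.
move=> e; apply: pr_ext => i; have := congr1 (pr i) e; rewrite !pr_rho.
have u : rhos i g \in unitmx by rewrite unitmxE drhos unitr1.
by move=> /(congr1 (mulmx (invmx (rhos i g)))); rewrite !mulKmx.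
Qed.

Lemma lag_act_in (g : G) (P Q : 'M[R]_(n + n)) : lag_act (rho_mx rhos g) P Q ->
  forall x, in_lag P x <-> in_lag Q (rho_mx rhos g *m x).
Proof.
move=> h x; split=> [Px|/h[y Py /rho_inj->//]].
by apply/h; exists x.
Qed.

Lemma lag_act_right (g : G) (P Q Q' : 'M[R]_(n + n)) : is_lag Q -> is_lag Q' ->
  lag_act (rho_mx rhos g) P Q -> lag_act (rho_mx rhos g) P Q' -> Q = Q'.
Proof. by move=> LQ LQ' h h'; apply: lag_eq => // x; split=> [/h/h'|/h'/h]. Qed.

Lemma lag_act_left (g : G) (P P' Q : 'M[R]_(n + n)) : is_lag P -> is_lag P' ->
  lag_act (rho_mx rhos g) P Q -> lag_act (rho_mx rhos g) P' Q -> P = P'.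
Proof.
move=> LP LP' h h'; apply: lag_eq => // x.
by rewrite (lag_act_in h) (lag_act_in h').
Qed.

End LagAction.

Section LimitCurve.
Context {R : realType} (G : groupType) (iota : G -> 'M[R]_2) (n : nat).
Context (rhos : 'I_n -> G -> 'M[R]_2) (xi : 'cV[R]_2 -> 'M[R]_(n + n)).
Hypothesis surf : closed_surface_group_in_PSL2 iota.
Hypothesis drhos : forall i g, \det (rhos i g) = 1.
Hypothesis plm : positive_limit_map iota (rho_mx rhos) xi.
Local Notation gamma t := (xi (v2 t 1)).
Local Notation rho := (rho_mx rhos).

Lemma limit_map_affine (v : 'cV[R]_2) : v 1 0 != 0 -> xi v = gamma (v 0 0 / v 1 0).
Proof.
move=> v1; have v0 : v != 0 by apply: contraNneq v1 => ->; rewrite mxE.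
by apply: (limit_map_par plm v0 (v2x1_neq0 _)); rewrite /det2 v2E0 v2E1; field.
Qed.

Lemma limit_curve_range : limit_curve xi `<=` range (fun t => gamma t) `|` [set xi (v2 1 0)].
Proof.
move=> _ [v v0 <-]; have [v1|v1] := eqVneq (v 1 0) 0.
  right; apply: (limit_map_par plm v0); first by rewrite v2_eq0 oner_eq0.
  by rewrite /det2 v2E0 v2E1 v1; ring.
by left; exists (v 0 0 / v 1 0) => //; rewrite -limit_map_affine.
Qed.

Lemma limit_curve_affine t : limit_curve xi (gamma t).
Proof. by exists (v2 t 1) => //; exact: v2x1_neq0. Qed.

Lemma limit_curve_continuous t (e : R) : 0 < e -> exists2 d : R, 0 < d &
  forall t', `|t - t'| < d -> fdist (gamma t) (gamma t') < e.
Proof.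
move=> e0; case: plm => _ _ cont _ _; have [d d0 hd] := cont _ (v2x1_neq0 t) _ e0.
exists d => // t' tt'; apply: hd; first exact: v2x1_neq0.
by apply: le_lt_trans (fdist_v2 _ _ _ _) _; rewrite subrr normr0 addr0.
Qed.

Lemma limit_map_lag_act g (v w : 'cV[R]_2) : v != 0 -> w != 0 -> det2 (iota g *m v) w = 0 ->
  lag_act (rho g) (xi v) (xi w).
Proof.
move=> v0 w0 e; rewrite -(limit_map_par plm (surface_neq0 surf g v0) w0 e).
by case: plm => _ _ _ h _; exact: h.
Qed.

Lemma rho_invariant_inv_action B : rho_invariant rho B -> inv_action iota [set t | B (gamma t)].
Proof.
move=> iB g s s' e; apply: (iB g); try exact: (limit_map_lag plm (v2x1_neq0 _)).
by apply: limit_map_lag_act => //; exact: v2x1_neq0.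
Qed.

(** Avoiding the orbit of infinity guarantees that a group element moves a point of [T] to a finite
    point, so the image curve over [T] is mapped into itself. *)
Lemma rho_invariant_image (T : set R) : inv_action iota T ->
  T `<=` ~` saturation iota (eq (v2 1 0)) -> rho_invariant rho [set gamma t | t in T].
Proof.
move=> iT Tsub.
have affine g t : T t -> exists2 t', T t' & det2 (iota g *m v2 t 1) (v2 t' 1) = 0.
  move=> Tt; set w := iota g *m v2 t 1.
  have w1 : w 1 0 != 0.
    apply: contra_notN (Tsub _ Tt) => /eqP w1; exists g, (v2 1 0); split=> //.
      by rewrite v2_eq0 oner_eq0.
    by rewrite -/w /det2 v2E0 v2E1 w1; ring.
  have e : det2 w (v2 (w 0 0 / w 1 0) 1) = 0 by rewrite /det2 v2E0 v2E1; field.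
  by exists (w 0 0 / w 1 0) => //; apply/(iT g t).
have lag t := limit_map_lag plm (v2x1_neq0 t).
move=> g P Q LP LQ act; split=> -[t Tt tE].
  have [t' Tt' e] := affine g t Tt; exists t' => //.
  have act' := limit_map_lag_act (v2x1_neq0 t) (v2x1_neq0 t') e.
  by rewrite tE in act'; exact: lag_act_right (lag t') LQ act' act.
have [t' Tt' e] := affine g^-1%g t Tt; exists t' => //.
have {}e := (surface_inv surf g (v2x1_neq0 t') (v2x1_neq0 t)).2 e.
have act' := limit_map_lag_act (v2x1_neq0 t') (v2x1_neq0 t) e.
by rewrite tE in act'; exact: (lag_act_left drhos (lag t') LP act' act).
Qed.

Lemma chart_proj_fnbhs i (A : 'M[R]_2) (P : 'M[R]_(n + n)) s t :
  chart_proj i A (Q : 'M[R]_(n + n)) s t @[Q --> fnbhs P] --> chart_proj i A P s t.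
Proof.
apply: (@fnbhs_lipschitz _ _ _ (fun Q : 'M[R]_(n + n) => chart_proj i A Q s t) (4 * n1 A ^+ 2)) => [|Q].
  by rewrite mulr_ge0// exprn_ge0// n1_ge0.
by rewrite -mulrA; exact: chart_proj_entry.
Qed.

Lemma slope_fnbhs i (A : 'M[R]_2) (P : 'M[R]_(n + n)) : chart_proj i A P 1 1 != 0 ->
  slope i A Q @[Q --> fnbhs P] --> slope i A P.
Proof.
by move=> P0; apply: cvgM; [exact: chart_proj_fnbhs|apply: cvgV => //; exact: chart_proj_fnbhs].
Qed.

Section Chart.
Variables (i : 'I_n) (A : 'M[R]_2) (psi : R -> R).
Hypothesis H : incr_homeo (chart xi i A) psi.
Hypothesis den : forall t, chart_proj i A (gamma t) 1 1 != 0.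

Lemma limit_curve_inj s t : gamma s = gamma t -> s = t.
Proof. by move=> e; case: H => _ k _; rewrite -[s]k -[t]k /chart e. Qed.

(* A point P belongs to the image of the curve iff P is the point of the curve
   with the slope of P, which is a closed condition where the slope is defined. *)
Lemma borel_limit_curve_image (T : set R) : measurable T -> borel [set gamma t | t in T].
Proof.
move=> mT; have H' := incr_homeo_sym H; have [_ k k'] := H.
pose Om := [set P : 'M[R]_(n + n) | chart_proj i A P 1 1 != 0].
have nOm P : Om P -> fnbhs P Om.
  by move=> OP; exact: (cvg_neq0 (fnbhs_filter P) OP (@chart_proj_fnbhs i A P 1 1)).
pose W := Om `&` [set P | gamma (psi (slope i A P)) != P].
have oW : fopen W.
  move=> P [OP /eqP PW]; have [a [b ab]] : exists a b, gamma (psi (slope i A P)) a b - P a b != 0.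
    apply: contrapT => no; apply: PW; apply/matrixP => a b; apply: contrapT => ne.
    by apply: no; exists a, b; rewrite subr_eq0; apply/eqP.
  have c : (gamma (psi (slope i A Q)) a b - Q a b) @[Q --> fnbhs P] -->
      gamma (psi (slope i A P)) a b - P a b.
    apply: cvgB; last exact: fnbhs_entry.
    have c1 : psi (slope i A Q) @[Q --> fnbhs P] --> psi (slope i A P).
      apply: cvg_comp (slope_fnbhs OP) _; exact: incr_homeo_continuous H' _.
    apply: (cvg_comp _ (fun x : R => gamma x a b) c1).
    apply/cvgrPdist_lt => e e0; have [d d0 hd] := limit_curve_continuous (psi (slope i A P)) e0.
    apply/nbhs_ballP; exists d => //= x tx; apply: le_lt_trans (fdist_entry _ _ _ _) _.
    exact: hd.
  apply: (filterS2 _ _ (nOm P OP) (cvg_neq0 (fnbhs_filter P) ab c)) => Q OQ Qab; split=> //.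
  by apply: contraNneq Qab => ->; rewrite subrr.
rewrite (_ : [set _ | _ in _] = (Om `&` slope i A @^-1` (psi @^-1` T)) `\` W).
  apply: borelD; last exact: borel_fopen.
  apply: borel_ratio => //; first by move=> P; exact: slope_fnbhs.
  exact: (measurable_homeo_preimage H' mT).
apply/seteqP; split=> P /=.
  move=> [t Tt <-]; have e : psi (slope i A (gamma t)) = t := k t.
  by split; [split; [exact: den|rewrite /= e]|rewrite /W /= e eqxx => -[]].
move=> [[OP TP] nW]; exists (psi (slope i A P)) => //.
by apply: contrapT => ne; apply: nW; split=> //; apply/eqP.
Qed.

End Chart.
End LimitCurve.

(** * Ergodic components of the arc-length measure *)

Lemma lebesgue_setT_neq0 (R : realType) : @lebesgue_measure R [set: R] != 0%E.
Proof.
apply/eqP => T0; have : @lebesgue_measure R `[0%R, 1%R]%classic = 0%E.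
  exact: (lebesgue_null_sub _ T0).
by rewrite lebesgue_measure_itv /= lte_fin ltr01 sube0 => -[] /eqP; rewrite oner_eq0.
Qed.

Lemma chart_rep_conjugate (R : realType) (G : groupType) n (rhos : 'I_n -> G -> 'M[R]_2) i j (A B : 'M[R]_2) :
  A *m A^T = 1%:M -> A^T *m A = 1%:M -> B *m B^T = 1%:M -> B^T *m B = 1%:M ->
  pgl_conjugate (chart_rep rhos i A) (chart_rep rhos j B) -> pgl_conjugate (rhos i) (rhos j).
Proof.
move=> AA AA' BB BB' [P uP hP].
have uA : A \in unitmx by case: (mulmx1_unit AA).
have uB : B \in unitmx by case: (mulmx1_unit BB).
have iA : invmx A = A^T by rewrite -[LHS]mulmx1 -AA mulKmx.
have iB : invmx B = B^T by rewrite -[LHS]mulmx1 -BB mulKmx.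
exists (B *m P *m A^T); first by rewrite !unitmx_mul uB uP unitmx_tr uA.
have inv : invmx (B *m P *m A^T) = A *m invmx P *m B^T.
  have e : (B *m P *m A^T) *m (A *m invmx P *m B^T) = 1%:M.
    by rewrite !mulmxA -(mulmxA _ A^T A) AA' mulmx1 -(mulmxA _ P) mulmxV// mulmx1.
  by rewrite -[LHS]mulmx1 -e mulKmx//; case: (mulmx1_unit e).
have back g : rhos j g = B *m chart_rep rhos j B g *m B^T.
  by rewrite /chart_rep !mulmxA BB mul1mx -mulmxA BB mulmx1.
have conj g : B *m P *m A^T *m rhos i g *m invmx (B *m P *m A^T) =
    B *m (P *m chart_rep rhos i A g *m invmx P) *m B^T.
  by rewrite inv /chart_rep !mulmxA.
move=> g; rewrite conj back; case: (hP g) => ->; [by left|right].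
by rewrite mulmxN mulNmx.
Qed.

Theorem theoremC1 (R : realType) (G : groupType) (iota : G -> 'M[R]_2) (n : nat)
    (rhos : 'I_n -> G -> 'M[R]_2) (xi : 'cV[R]_2 -> 'M[R]_(n + n)) :
  (1 <= n)%N ->
  closed_surface_group_in_PSL2 iota ->
  (forall i, fuchsian_SL2 (rhos i)) ->
  (forall i j, i != j -> ~ pgl_conjugate (rhos i) (rhos j)) ->
  positive_limit_map iota (rho_mx rhos) xi ->
  n_ergodic_components (rho_mx rhos)
    (fun A => hausdorff1 (A `&` limit_curve xi)) n.
Proof.
case: n rhos xi => // n rhos xi _ surf fuch nconj plm.
have drhos i g : \det (rhos i g) = 1 by case: (fuch i).
have di g : \det (iota g) = 1 by case: surf.
have [enumG enumGP] := fuchsian_countable (fuch ord0).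
have e10 : v2 1 0 != 0 :> 'cV[R]_2 by rewrite v2_eq0 oner_eq0.
have /choice[A hA] : forall i, exists A : 'M[R]_2, [/\ A *m A^T = 1%:M, A^T *m A = 1%:M, \det A = 1 &
    chart_proj i A (xi (v2 1 0)) 0 1 = 0 /\ chart_proj i A (xi (v2 1 0)) 1 1 = 0].
  move=> i; apply: proj2_rotation; apply: split_proj2; first exact: (limit_map_lag plm e10).
  exact: (limit_map_split surf drhos plm e10).
have /choice[psi H] : forall i, exists psi, incr_homeo (chart xi i (A i)) psi.
  by move=> i; have [A1 A2 A3 A4] := hA i; exact: (chart_homeo surf drhos plm A1 A2 A3 A4).
pose sigma i := chart_rep rhos i (A i).
have ds i g : \det (sigma i g) = 1.
  by have [_ _ A3 _] := hA i; exact: (chart_rep_det drhos i A3).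
have eqv i g : circle_equivariant (iota g) (sigma i g) (chart xi i (A i)).
  by have [A1 A2 A3 A4] := hA i; exact: (chart_equivariant surf drhos plm A1 A2 A3 A4).
have den i t : chart_proj i (A i) (xi (v2 t 1)) 1 1 != 0.
  have [A1 A2 A3 A4] := hA i; apply: (chart_den_neq0 surf drhos plm A1 A2 A3 A4).
  by rewrite v2E1 oner_neq0.
have nconj' i j : i != j -> ~ pgl_conjugate (sigma i) (sigma j).
  move=> ij; have [A1 A2 _ _] := hA i; have [B1 B2 _ _] := hA j.
  by move/(chart_rep_conjugate A1 A2 B1 B2); exact: nconj.
have [T [mT Taff Tdisj Tnull]] := circle_components surf enumGP H ds eqv nconj'.
pose gamma t := xi (v2 t 1).
have inj s t : gamma s = gamma t -> s = t := limit_curve_inj (H ord0) (s := s) (t := t).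
have preE S : [set t | [set gamma s | s in S] (gamma t)] = S.
  by apply/seteqP; split=> t /=; [move=> [s Ss /inj <-]|exists t].
pose L := \sum_i 4 * n1 (A i) ^+ 2 + 1.
have k0 i : 0 <= 4 * n1 (A i) ^+ 2 by rewrite mulr_ge0// exprn_ge0// n1_ge0.
have L0 : 0 < L by rewrite ltr_wpDl// sumr_ge0.
have lip t t' : fdist (gamma t) (gamma t') <= L * \sum_i `|chart xi i (A i) t - chart xi i (A i) t'|.
  apply: le_trans (fdist_le_n1 _ _) _.
  have sp s := limit_map_split surf drhos plm (v2x1_neq0 s).
  apply: le_trans (split_n1 (sp t) (sp t')) _; rewrite mulr_sumr; apply: ler_sum => i _.
  have [A1 A2 A3 A4] := hA i.
  apply: le_trans (chart_blk_lipschitz surf drhos plm A1 A2 A3 A4 t t') _.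
  by rewrite ler_wpM2r// /L (bigD1 i)//= -addrA lerDl addr_ge0// sumr_ge0.
have mcomp B : borel B -> measurable [set t | B (gamma t)].
  by apply: borel_measurable_comp => t e; exact: (limit_curve_continuous plm).
have null B : borel B -> (forall i, lebesgue_measure (psi i @^-1` [set t | B (gamma t)]) = 0%E) ->
    hausdorff1 (B `&` limit_curve xi) = 0%E.
  move=> bB; exact: (hausdorff1_null_curve H (limit_curve_range plm) L0 lip (mcomp B bB)).
pose E i := [set gamma t | t in T i].
have bE i : borel (E i) by exact: (borel_limit_curve_image plm (H ord0) (den ord0) (mT i).1).
exists E; split.
- move=> i; split=> //; exact: (rho_invariant_image surf drhos plm (mT i).2 (Taff i)).
(* [T i] is conull for the i-th class, so a null [E i] would make the whole line null. *)
- move=> i; rewrite lt_neqAle hausdorff1_ge0 andbT eq_sym; apply/eqP => E0.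
  have [A1 A2 A3 A4] := hA i.
  have := hausdorff1_null_chart (H i) (@limit_curve_affine _ _ xi)
    (chart_lower_lipschitz surf drhos plm A1 A2 A3 A4) E0.
  rewrite -/gamma preE => T0; have /eqP[] := @lebesgue_setT_neq0 R.
  rewrite -(setUv (psi i @^-1` T i)) preimage_setC.
  by apply: lebesgue_setU0 => //; have [] := Tnull i.
- move=> i j ij; rewrite -subset0 => P [[t Tt <-] [s Ts /inj st]].
  have : (T i `&` T j) t by split=> //; rewrite -st.
  by rewrite Tdisj.
- apply: null => [|i].
    apply: borelC; rewrite (_ : \bigcup_(i in _) E i =
        \bigcup_k (if insub k is Some i then E i else set0)).
      by apply: borel_bigcup => k; case: insub => // ; case: (@borel_sigma_closed R (n.+1 + n.+1) (n.+1 + n.+1)).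
    apply/seteqP; split=> P; first by move=> [i _ EP]; exists (val i) => //; rewrite valK.
    by move=> [k _]; case: insub => // i EP; exists i.
  have [h _] := Tnull i; apply: lebesgue_null_sub h => s /= nE Ts; apply: nE.
  by exists i => //; exists (psi i s).
- move=> i B bB iB BE; pose S := [set t | B (gamma t)].
  have mS : measurable S := mcomp B bB.
  have iS : inv_action iota S := rho_invariant_inv_action surf plm iB.
  have ST : S `<=` T i by move=> t /BE [s Ts /inj <-].
  (* Subsets of [T i] are null for every other class, so inside [E i] only the i-th class decides
     nullity, and its ergodicity gives the dichotomy. *)
  have offdiag C : [set t | C (gamma t)] `<=` T i -> forall j, j != i ->
      lebesgue_measure (psi j @^-1` [set t | C (gamma t)]) = 0%E.
    move=> CT j ji; have [_ h] := Tnull i; rewrite eq_sym in ji.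
    by apply: lebesgue_null_sub (h j ji) => s; exact: CT.
  have [S0|S0] := ergodic_action (H i) di (ds i) (eqv i) (surface_conical surf)
    (measurable_homeo_preimage (incr_homeo_sym (H i)) mS)
    (inv_action_homeo surf (H i) (ds i) (eqv i) iS); [left|right].
    by apply: null => // j; have [->//|ji] := eqVneq j i; exact: offdiag.
  have DT : [set t | (E i `\` B) (gamma t)] `<=` T i by move=> t [[s Ts /inj <-]].
  apply: null => [|j]; first exact: borelD.
  have [->|ji] := eqVneq j i; last exact: offdiag.
  by apply: lebesgue_null_sub S0 => s [].
Qed.
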